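(* With the notation defined in the context (where $t_0=u+iv$ and $A,B,a,b,c_1,c_2,d_1,d_2$ are determined by $t_0$), $$\gamma_n\sim\frac{Be^{nA}}{\sqrt{n}}\left\{\cos(na+b)\left(1+\frac{c_1}{n}+\frac{c_2}{n^2}\right)-\sin(na+b)\left(\frac{d_1}{n}+\frac{d_2}{n^2}\right)\right\}\qquad(n\to\infty),$$ that is, as $n\to\infty$ through the positive integers, $$\gamma_n=\frac{Be^{nA}}{\sqrt{n}}\left\{\cos(na+b)\left(1+\frac{c_1}{n}+\frac{c_2}{n^2}\right)-\sin(na+b)\left(\frac{d_1}{n}+\frac{d_2}{n^2}\right)+o(n^{-2})\right\}.$$
   Context: The Stieltjes constants $\gamma_n$ are defined by the Laurent expansion of the Riemann zeta function about $s=1$: $\zeta(s)=\frac{1}{s-1}+\sum_{n=0}^\infty \frac{(-1)^n}{n!}\gamma_n (s-1)^n$. For a positive integer $n$, let $t_0=t_0(n)=u+iv$ ($u,v$ real) be the principal solution of $t e^t=\frac{ni}{2\pi}$, i.e. $t_0=W_0(ni/(2\pi))$ with $W_0$ the principal branch of the Lambert function (so $u>0$, $0<v<\pi/2$). Define $$A=\tfrac12\log(u^2+v^2)-\frac{u}{u^2+v^2},\qquad a=\arctan\left(\frac{v}{u}\right)+\frac{v}{u^2+v^2},$$ $$B=2\sqrt{2\pi}\left|\frac{t_0}{\sqrt{1+t_0}}\right|,\qquad b=\tfrac12\pi-v-\tfrac12\arctan\left(\frac{v}{1+u}\right).$$ Let $$\wp_2(t_0)=2-18t_0-20t_0^2-3t_0^3+2t_0^4,$$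 $$\wp_4(t_0)=4-72t_0-332t_0^2-8028t_0^3-19644t_0^4-20280t_0^5-9911t_0^6-1884t_0^7+4t_0^8,$$ and define real numbers $c_1,d_1,c_2,d_2$ (functions of $t_0$, with no explicit dependence on $n$ other than through $t_0$) by $$c_1+id_1=\frac{\wp_2(t_0)}{24(1+t_0)^3},\qquad c_2+id_2=\frac{\wp_4(t_0)}{1152(1+t_0)^6}+\frac{(4+3t_0)t_0^2}{2(1+t_0)^2}.$$ *)

(* Defs.v *)
(* Stdlib reals with Coquelicot's complex numbers. *)
From Stdlib Require Import Reals Factorial.
From Coquelicot Require Import Coquelicot.
Open Scope R_scope.

Definition Cexp (z : C) : C :=
  (exp (Re z) * cos (Im z), exp (Re z) * sin (Im z)).

(* Principal branch, cut along the negative reals; on the cut the root has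
   nonnegative imaginary part. *)
Definition Csqrt (z : C) : C :=
  (sqrt ((Cmod z + Re z) / 2),
   (if Rle_dec 0 (Im z) then 1 else -1) * sqrt ((Cmod z - Re z) / 2)).

(* The analytic continuation of the Dirichlet series to C \ {1}; by the
   identity theorem it is unique away from 1, and the value at 1 is
   unconstrained.  The k-th term of the series is (k+1)^(-s). *)
Definition is_riemann_zeta (zeta : C -> C) : Prop :=
  (forall s : C, s <> RtoC 1 -> ex_derive zeta s) /\
  (forall s : C, 1 < Re s ->
     is_series (fun k : nat => Cexp (- s * RtoC (ln (INR (S k))))%C) (zeta s)).

(* Laurent expansion on some punctured disc about 1. *)
Definition is_stieltjes (zeta : C -> C) (gamma : nat -> R) : Prop :=
  exists r : R, 0 < r /\
    forall s : C, 0 < Cmod (s - 1)%C < r ->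
      is_series
        (fun n : nat =>
           (RtoC ((-1) ^ n / INR (fact n) * gamma n) * (s - 1) ^ n)%C)
        (zeta s - 1 / (s - 1))%C.

(* The range of the principal branch W_0 with its usual cut ]-oo, -1/e]: the
   region to the right of the curve  -y cot y + i y, -pi < y < pi.  The curve
   itself is mapped by w e^w onto the cut; W_0 is continuous onto the cut from
   above, so that only the part y >= 0 of the curve belongs to the range. *)
Definition lambertW0_range (w : C) : Prop :=
  - PI < Im w < PI /\
  (Im w = 0 -> -1 <= Re w) /\
  (0 < Im w -> - Im w * (cos (Im w) / sin (Im w)) <= Re w) /\
  (Im w < 0 -> - Im w * (cos (Im w) / sin (Im w)) < Re w).

(* w = W_0(z) *)
Definition is_lambertW0 (z w : C) : Prop :=
  (w * Cexp w)%C = z /\ lambertW0_range w.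

(* In all that follows t stands for t_0 = u + i v. *)

Definition coefA (t : C) : R :=
  let u := Re t in let v := Im t in
  1 / 2 * ln (u ^ 2 + v ^ 2) - u / (u ^ 2 + v ^ 2).

Definition coefa (t : C) : R :=
  let u := Re t in let v := Im t in
  atan (v / u) + v / (u ^ 2 + v ^ 2).

Definition coefB (t : C) : R :=
  2 * sqrt (2 * PI) * Cmod (t / Csqrt (1 + t))%C.

Definition coefb (t : C) : R :=
  let u := Re t in let v := Im t in
  1 / 2 * PI - v - 1 / 2 * atan (v / (1 + u)).

Definition wp2 (t : C) : C :=
  (2 - 18 * t - 20 * t ^ 2 - 3 * t ^ 3 + 2 * t ^ 4)%C.

Definition wp4 (t : C) : C :=
  (4 - 72 * t - 332 * t ^ 2 - 8028 * t ^ 3 - 19644 * t ^ 4 - 20280 * t ^ 5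
   - 9911 * t ^ 6 - 1884 * t ^ 7 + 4 * t ^ 8)%C.

Definition cd1 (t : C) : C := (wp2 t / (24 * (1 + t) ^ 3))%C.

Definition cd2 (t : C) : C :=
  (wp4 t / (1152 * (1 + t) ^ 6)
   + (4 + 3 * t) * t ^ 2 / (2 * (1 + t) ^ 2))%C.

Definition coefc1 (t : C) : R := Re (cd1 t).
Definition coefd1 (t : C) : R := Im (cd1 t).
Definition coefc2 (t : C) : R := Re (cd2 t).
Definition coefd2 (t : C) : R := Im (cd2 t).

(* Main.v *)
Require Import Defs.
From Stdlib Require Import Reals Factorial Lra Lia.
From Coquelicot Require Import Coquelicot.
Open Scope R_scope.

(** Near [s = 1] on the real axis both the Dirichlet series and the Laurent
    expansion of zeta hold, and comparing coefficients shows that [gamma_n] is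
    the limit of [sum_(m <= N) ln^n m / m - ln^(n+1) N / (n+1)]
    ([stieltjes_limit]).  This difference between a sum and an integral has a
    Fourier expansion, and the substitution [x = e^t] turns its k-th term into
    twice the real part of the integral of [t^n exp (2 PI i k e^t)] over
    [0 <= t <= ln N] ([stieltjes_fourier_approx]).

    The exponent of the first harmonic is stationary at the point [t] with
    [t e^t = i n / (2 PI)], the Lambert value.  By Cauchy's theorem every path
    is moved to the horizontal line through this point ([shift_harmonics]): the
    side on the imaginary axis contributes at most [2^n], the side at [ln N]
    vanishes in the limit.  On the line the modulus of the first harmonic lies
    below a Gaussian centred at the saddle point ([harmonic_gaussian_decay]), and
    the k-th harmonic is smaller by a factor [q^(k-1)] with [q] doubly
    exponentially small near the saddle point.  Hence [gamma_n] is twice the real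
    part of the integral of the first harmonic over a short window around the
    saddle point, up to terms that are relatively smaller than every power of
    [1 / n] ([stieltjes_window]).

    On the window the first harmonic is its central value times a Gaussian with
    complex parameter [q = n (1 + t) / (2 t^2)] times the exponential of the
    cubic and higher terms of the phase.  The window has half-width [u^3 /
    sqrt n] with [u = Re t] of size [ln n], so each power of the displacement
    gains [n^(-1/2)] up to logarithms, and the exponential is replaced by a
    polynomial with an error of relative order [n^(-5/2)]
    ([saddle_ratio_approx]).  Odd moments of the Gaussian vanish, even ones
    follow from the total mass by integration by parts, and the mass itself is
    the square root of [PI / q] ([gauss_value]); the resulting finite sum is
    exactly [1 + (c1 + i d1) / n + (c2 + i d2) / n^2] ([saddle_series_eq]).
    Polar coordinates turn the central value times this root into the modulus
    [B e^(n A) / (2 sqrt n)] and the phase [n a + b] ([saddle_main_term]).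

    The saddle point moves with [n], so that no constant may depend on it: all
    errors are bounded by explicit expressions in [u], and [n] lies between
    [e^u] and [e^(3 u)]. *)

(** * Real calculus *)

(** Sums over [nat] live in an abstract group that unfolds to the reals; the ring
    tactics need equations stated over the reals themselves. *)
Ltac change_R := match goal with |- @eq _ ?a ?b => change (@eq R a b) end.

Lemma sum_n_S (a : nat -> R) (n : nat) : sum_n a (S n) = sum_n a n + a (S n).
Proof. rewrite sum_Sn. reflexivity. Qed.

Lemma INR_S_pos (k : nat) : 0 < INR (S k).
Proof. apply lt_0_INR; lia. Qed.

Lemma INR_S_ge_1 (n : nat) : 1 <= INR (S n).
Proof. rewrite S_INR. pose proof (pos_INR n). lra. Qed.

Lemma ln_ge_0 (x : R) : 1 <= x -> 0 <= ln x.
Proof. intro H. rewrite <- ln_1. apply Rcomplements.ln_le; lra. Qed.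

Lemma exp_mono (x y : R) : x <= y -> exp x <= exp y.
Proof. intros [h|h]; [left; now apply exp_increasing|right; now rewrite h]. Qed.

Lemma continuous_is_derive (f : R -> R) x l : is_derive f x l -> continuous f x.
Proof. intro H. apply (ex_derive_continuous (V:=R_NormedModule) f). eexists; exact H. Qed.

Ltac auto_continuous := apply (ex_derive_continuous (V:=R_NormedModule)); auto_derive.

Lemma mean_value (f f' : R -> R) (a b : R) : a <= b ->
  (forall x, a <= x <= b -> is_derive f x (f' x)) ->
  exists c, a <= c <= b /\ f b - f a = f' c * (b - a).
Proof.
  intros Hab Hf. destruct (MVT_gen f a b f') as [c Hc].
  - intros x Hx. rewrite Rmin_left, Rmax_right in Hx by lra. apply Hf; lra.
  - intros x Hx. rewrite Rmin_left, Rmax_right in Hx by lra.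
    apply continuity_pt_filterlim. eapply continuous_is_derive, Hf, Hx.
  - rewrite Rmin_left, Rmax_right in Hc by lra. now exists c.
Qed.

Lemma nonincr_of_deriv (h h' : R -> R) (a b : R) : a <= b ->
  (forall t, a <= t <= b -> is_derive h t (h' t)) ->
  (forall t, a <= t <= b -> h' t <= 0) -> h b <= h a.
Proof.
  intros Hab Hh Hneg. destruct (mean_value h h' a b Hab Hh) as [c [Hc E]].
  specialize (Hneg c Hc). nra.
Qed.

Lemma ex_RInt_cont (f : R -> R) a b : a <= b ->
  (forall x, a <= x <= b -> continuous f x) -> ex_RInt f a b.
Proof.
  intros Hab H. apply (ex_RInt_continuous (V:=R_CompleteNormedModule)).
  intros x Hx. rewrite Rmin_left, Rmax_right in Hx by lra. apply H; lra.
Qed.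

Lemma RInt_split (f : R -> R) a b c : a <= b -> b <= c ->
  (forall x, a <= x <= c -> continuous f x) -> RInt f a b + RInt f b c = RInt f a c.
Proof.
  intros Hab Hbc H. apply (RInt_Chasles (V:=R_CompleteNormedModule));
  apply ex_RInt_cont; try lra; intros x Hx; apply H; lra.
Qed.

Lemma RInt_of_derive (f f' : R -> R) a b : a <= b ->
  (forall x, a <= x <= b -> is_derive f x (f' x)) ->
  (forall x, a <= x <= b -> continuous f' x) -> RInt f' a b = f b - f a.
Proof.
  intros Hab H1 H2. apply is_RInt_unique.
  apply (is_RInt_derive (V:=R_CompleteNormedModule)); intros x Hx;
  rewrite Rmin_left, Rmax_right in Hx by lra; [apply H1|apply H2]; lra.
Qed.

Lemma abs_RInt_bound (f : R -> R) a b M : a <= b ->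
  (forall x, a <= x <= b -> continuous f x) ->
  (forall x, a <= x <= b -> Rabs (f x) <= M) -> Rabs (RInt f a b) <= (b - a) * M.
Proof.
  intros Hab Hc HM.
  apply (norm_RInt_le_const (V:=R_NormedModule) f a b); [exact Hab|exact HM|].
  apply (RInt_correct (V:=R_CompleteNormedModule)), ex_RInt_cont; assumption.
Qed.

Lemma abs_RInt_le_RInt (f g : R -> R) a b : a <= b ->
  (forall x, a <= x <= b -> continuous f x) ->
  (forall x, a <= x <= b -> continuous g x) ->
  (forall x, a <= x <= b -> Rabs (f x) <= g x) -> Rabs (RInt f a b) <= RInt g a b.
Proof.
  intros Hab Hc Hg HM.
  apply (norm_RInt_le (V:=R_NormedModule) f g a b); [exact Hab|exact HM| |];
  apply (RInt_correct (V:=R_CompleteNormedModule)), ex_RInt_cont; assumption.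
Qed.

(** * Complex-valued functions of real variables *)

Lemma Ceq (z w : C) : Re z = Re w -> Im z = Im w -> z = w.
Proof. destruct z, w; simpl; intros; subst; reflexivity. Qed.

Lemma re_minus (z w : C) : Re (z - w)%C = Re z - Re w.
Proof. reflexivity. Qed.
Lemma im_minus (z w : C) : Im (z - w)%C = Im z - Im w.
Proof. reflexivity. Qed.
Lemma im_le_Cmod (z : C) : Rabs (Im z) <= Cmod z.
Proof.
  destruct z as [a b]; simpl. unfold Cmod; simpl.
  rewrite <- (sqrt_Rsqr_abs b). apply sqrt_le_1_alt. unfold Rsqr; nra.
Qed.

Lemma Cmod_le_Re_Im (z : C) : Cmod z <= Rabs (Re z) + Rabs (Im z).
Proof.
  destruct z as [a b]; simpl. unfold Cmod; simpl.
  rewrite <- (sqrt_Rsqr (Rabs a + Rabs b)).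
  - apply sqrt_le_1_alt. unfold Rsqr.
    assert (Rabs a * Rabs a = a * a) by (rewrite <- Rabs_mult; apply Rabs_right; nra).
    assert (Rabs b * Rabs b = b * b) by (rewrite <- Rabs_mult; apply Rabs_right; nra).
    pose proof (Rabs_pos a); pose proof (Rabs_pos b). nra.
  - pose proof (Rabs_pos a); pose proof (Rabs_pos b); lra.
Qed.

Lemma Cmod_sqr (z : C) : Cmod z ^ 2 = Re z ^ 2 + Im z ^ 2.
Proof.
  unfold Cmod. rewrite pow2_sqrt; [reflexivity|].
  pose proof (pow2_ge_0 (fst z)); pose proof (pow2_ge_0 (snd z)); lra.
Qed.

Lemma Cexp_plus (z w : C) : Cexp (z + w)%C = (Cexp z * Cexp w)%C.
Proof.
  unfold Cexp; apply Ceq; simpl; rewrite exp_plus, ?cos_plus, ?sin_plus; unfold Re, Im; ring.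
Qed.

Lemma Cexp_real (x : R) : Cexp (RtoC x) = RtoC (exp x).
Proof. unfold Cexp; apply Ceq; simpl; rewrite ?cos_0, ?sin_0; ring. Qed.

Lemma Cexp_0 : Cexp (RtoC 0) = RtoC 1.
Proof. now rewrite Cexp_real, exp_0. Qed.

Lemma Cmod_Cexp (z : C) : Cmod (Cexp z) = exp (Re z).
Proof.
  unfold Cmod, Cexp; simpl.
  replace (_ + _) with ((exp (Re z)) ^ 2 * (Rsqr (sin (Im z)) + Rsqr (cos (Im z))))
    by (unfold Rsqr; ring).
  rewrite sin2_cos2, Rmult_1_r.
  rewrite <- Rsqr_pow2, sqrt_Rsqr; [reflexivity|apply Rlt_le, exp_pos].
Qed.

Lemma Cexp_neq_0 (z : C) : Cexp z <> RtoC 0.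
Proof.
  intro H. assert (H1 := Cmod_Cexp z). rewrite H, Cmod_0 in H1.
  pose proof (exp_pos (Re z)); lra.
Qed.

Lemma Cexp_opp_l (z : C) : (Cexp (- z) * Cexp z)%C = RtoC 1.
Proof.
  rewrite <- Cexp_plus. replace (- z + z)%C with (RtoC 0) by ring. apply Cexp_0.
Qed.

Lemma Cexp_nat_mult (n : nat) (z : C) : Cexp (RtoC (INR n) * z)%C = (Cexp z ^ n)%C.
Proof.
  induction n as [|n IH].
  - simpl. replace (RtoC 0 * z)%C with (RtoC 0) by ring. apply Cexp_0.
  - rewrite S_INR, RtoC_plus.
    replace ((RtoC (INR n) + RtoC 1) * z)%C with (z + RtoC (INR n) * z)%C by ring.
    rewrite Cexp_plus, IH. reflexivity.
Qed.

(** * Derivatives along a real parameter *)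

(** Differentiability of curves is taken componentwise: every function
    differentiated below is explicit, and real calculus then suffices. *)
Definition Cderiv (g : R -> C) (x : R) (l : C) : Prop :=
  is_derive (fun t => Re (g t)) x (Re l) /\ is_derive (fun t => Im (g t)) x (Im l).

Lemma Cderiv_eq g x l l' : Cderiv g x l -> l = l' -> Cderiv g x l'.
Proof. intros H <-; exact H. Qed.

Lemma Cderiv_ext f g x l : (forall t, f t = g t) -> Cderiv f x l -> Cderiv g x l.
Proof.
  intros E [H1 H2]; split.
  - eapply is_derive_ext; [|exact H1]. intros; simpl; now rewrite E.
  - eapply is_derive_ext; [|exact H2]. intros; simpl; now rewrite E.
Qed.

Lemma Cderiv_const c x : Cderiv (fun _ => c) x (RtoC 0).
Proof. split; simpl; apply (is_derive_const (V:=R_NormedModule)). Qed.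

Lemma Cderiv_real (f : R -> R) x l :
  is_derive f x l -> Cderiv (fun t => RtoC (f t)) x (RtoC l).
Proof. intros H; split; simpl; [exact H|apply (is_derive_const (V:=R_NormedModule))]. Qed.

Lemma Cderiv_id x : Cderiv (fun t => RtoC t) x (RtoC 1).
Proof. apply (Cderiv_real (fun t => t)). apply (is_derive_id (K:=R_AbsRing)). Qed.

Lemma Cderiv_plus f g x lf lg :
  Cderiv f x lf -> Cderiv g x lg -> Cderiv (fun t => f t + g t)%C x (lf + lg)%C.
Proof.
  intros [H1 H2] [H3 H4]; split; simpl.
  - apply (is_derive_plus (V:=R_NormedModule)); assumption.
  - apply (is_derive_plus (V:=R_NormedModule)); assumption.
Qed.

Lemma Cderiv_opp f x lf : Cderiv f x lf -> Cderiv (fun t => - f t)%C x (- lf)%C.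
Proof.
  intros [H1 H2]; split; simpl; apply (is_derive_opp (V:=R_NormedModule)); assumption.
Qed.

Lemma Cderiv_minus f g x lf lg :
  Cderiv f x lf -> Cderiv g x lg -> Cderiv (fun t => f t - g t)%C x (lf - lg)%C.
Proof. intros; apply Cderiv_plus; [|apply Cderiv_opp]; assumption. Qed.

Lemma Cderiv_mult f g x lf lg :
  Cderiv f x lf -> Cderiv g x lg ->
  Cderiv (fun t => f t * g t)%C x (lf * g x + f x * lg)%C.
Proof.
  intros [H1 H2] [H3 H4]; split.
  - simpl.
    assert (H := is_derive_minus (V:=R_NormedModule) _ _ _ _ _
      (is_derive_mult _ _ _ _ _ H1 H3 Rmult_comm) (is_derive_mult _ _ _ _ _ H2 H4 Rmult_comm)).
    replace (fst lf * fst (g x) - snd lf * snd (g x) + (fst (f x) * fst lg - snd (f x) * snd lg))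
     with (minus (plus (mult (Re lf) (Re (g x))) (mult (Re (f x)) (Re lg)))
          (plus (mult (Im lf) (Im (g x))) (mult (Im (f x)) (Im lg)))); [exact H|].
    unfold minus, plus, opp, mult, Re, Im; simpl. ring.
  - simpl.
    assert (H := is_derive_plus (V:=R_NormedModule) _ _ _ _ _
      (is_derive_mult _ _ _ _ _ H1 H4 Rmult_comm) (is_derive_mult _ _ _ _ _ H2 H3 Rmult_comm)).
    replace (fst lf * snd (g x) + snd lf * fst (g x) + (fst (f x) * snd lg + snd (f x) * fst lg))
     with (plus (plus (mult (Re lf) (Im (g x))) (mult (Re (f x)) (Im lg)))
          (plus (mult (Im lf) (Re (g x))) (mult (Im (f x)) (Re lg)))); [exact H|].
    unfold minus, plus, opp, mult, Re, Im; simpl. ring.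
Qed.

Lemma Cderiv_scal c f x lf : Cderiv f x lf -> Cderiv (fun t => c * f t)%C x (c * lf)%C.
Proof.
  intro H. eapply Cderiv_eq; [apply Cderiv_mult; [apply Cderiv_const|exact H]|]. cbv beta; ring.
Qed.

Lemma Cderiv_pow f x lf n :
  Cderiv f x lf -> Cderiv (fun t => f t ^ n)%C x (RtoC (INR n) * f x ^ pred n * lf)%C.
Proof.
  intro H; induction n as [|n IH].
  - simpl. eapply Cderiv_eq; [apply Cderiv_const|]. ring.
  - eapply Cderiv_eq; [apply (Cderiv_mult f _ x _ _ H IH)|].
    rewrite S_INR, RtoC_plus. destruct n as [|n]; simpl.
    + ring.
    + ring.
Qed.

Lemma Cderiv_exp f x lf :
  Cderiv f x lf -> Cderiv (fun t => Cexp (f t)) x (lf * Cexp (f x))%C.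
Proof.
  intros [H1 H2].
  assert (He := is_derive_comp (V:=R_NormedModule) exp _ x _ _ (is_derive_exp _) H1).
  assert (Hc := is_derive_comp (V:=R_NormedModule) cos _ x _ _ (is_derive_cos _) H2).
  assert (Hs := is_derive_comp (V:=R_NormedModule) sin _ x _ _ (is_derive_sin _) H2).
  split; unfold Cexp; simpl.
  - eapply is_derive_ext; [|evar_last; [apply (is_derive_mult _ _ _ _ _ He Hc Rmult_comm)|]];
      [reflexivity|].
    unfold Re, Im, plus, mult, scal; simpl; unfold mult; simpl; ring.
  - eapply is_derive_ext; [|evar_last; [apply (is_derive_mult _ _ _ _ _ He Hs Rmult_comm)|]];
      [reflexivity|].
    unfold Re, Im, plus, mult, scal; simpl; unfold mult; simpl; ring.
Qed.

(** The factor 2 comes from treating the two components separately. *)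
Lemma Cderiv_bound (g g' : R -> C) (a b M : R) :
  a <= b ->
  (forall x, a <= x <= b -> Cderiv g x (g' x)) ->
  (forall x, a <= x <= b -> Cmod (g' x) <= M) ->
  Cmod (g b - g a)%C <= 2 * M * (b - a).
Proof.
  intros Hab Hd HM.
  eapply Rle_trans; [apply Cmod_le_Re_Im|].
  assert (H : forall (h h' : R -> R), (forall x, a <= x <= b -> is_derive h x (h' x)) ->
     (forall x, a <= x <= b -> Rabs (h' x) <= M) -> Rabs (h b - h a) <= M * (b - a)).
  { intros h h' Hh HhM. destruct (mean_value h h' a b Hab Hh) as [c [Hc ->]].
    rewrite Rabs_mult, (Rabs_right (b - a)) by lra.
    apply Rmult_le_compat_r; [lra|]. now apply HhM. }
  rewrite re_minus, im_minus.
  assert (H1 := H (fun t => Re (g t)) (fun t => Re (g' t)) (fun x Hx => proj1 (Hd x Hx))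
    (fun x Hx => Rle_trans _ _ _ (re_le_Cmod _) (HM x Hx))).
  assert (H2 := H (fun t => Im (g t)) (fun t => Im (g' t)) (fun x Hx => proj2 (Hd x Hx))
    (fun x Hx => Rle_trans _ _ _ (im_le_Cmod _) (HM x Hx))).
  simpl in H1, H2. lra.
Qed.

(** * Continuity and integrals *)

Definition Ccont (f : R -> C) (x : R) : Prop :=
  continuous (fun t => Re (f t)) x /\ continuous (fun t => Im (f t)) x.

Lemma Cderiv_cont f x l : Cderiv f x l -> Ccont f x.
Proof.
  intros [H1 H2]; split.
  - apply (continuous_is_derive (fun t => Re (f t)) x (Re l) H1).
  - apply (continuous_is_derive (fun t => Im (f t)) x (Im l) H2).
Qed.

Lemma Ccont_ext f g x : (forall t, f t = g t) -> Ccont f x -> Ccont g x.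
Proof.
  intros E [H1 H2]; split.
  - eapply continuous_ext; [|exact H1]. intros; simpl; now rewrite E.
  - eapply continuous_ext; [|exact H2]. intros; simpl; now rewrite E.
Qed.

Lemma Ccont_plus f g x : Ccont f x -> Ccont g x -> Ccont (fun t => f t + g t)%C x.
Proof.
  intros [H1 H2] [H3 H4]; split; simpl;
    apply (continuous_plus (V:=R_NormedModule)); assumption.
Qed.

Lemma Ccont_opp f x : Ccont f x -> Ccont (fun t => - f t)%C x.
Proof.
  intros [H1 H2]; split; simpl; apply (continuous_opp (V:=R_NormedModule)); assumption.
Qed.

Lemma Ccont_mult f g x : Ccont f x -> Ccont g x -> Ccont (fun t => f t * g t)%C x.
Proof.
  intros [H1 H2] [H3 H4]; split; simpl.
  - apply (continuous_minus (V:=R_NormedModule)); apply (continuous_mult (K:=R_AbsRing)); assumption.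
  - apply (continuous_plus (V:=R_NormedModule)); apply (continuous_mult (K:=R_AbsRing)); assumption.
Qed.

Lemma Ccont_const c x : Ccont (fun _ => c) x.
Proof. split; apply continuous_const. Qed.

Definition CInt (f : R -> C) (a b : R) : C :=
  (RInt (fun t => Re (f t)) a b, RInt (fun t => Im (f t)) a b).

Lemma Ccont_ex_Re f a b :
  a <= b -> (forall t, a <= t <= b -> Ccont f t) -> ex_RInt (fun t => Re (f t)) a b.
Proof.
  intros Hab H. apply (ex_RInt_continuous (V:=R_CompleteNormedModule)).
  intros z Hz. rewrite Rmin_left, Rmax_right in Hz by lra. apply H; lra.
Qed.

Lemma Ccont_ex_Im f a b :
  a <= b -> (forall t, a <= t <= b -> Ccont f t) -> ex_RInt (fun t => Im (f t)) a b.
Proof.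
  intros Hab H. apply (ex_RInt_continuous (V:=R_CompleteNormedModule)).
  intros z Hz. rewrite Rmin_left, Rmax_right in Hz by lra. apply H; lra.
Qed.

Lemma CInt_ext f g a b :
  a <= b -> (forall t, a <= t <= b -> f t = g t) -> CInt f a b = CInt g a b.
Proof.
  intros Hab E. unfold CInt. f_equal; apply RInt_ext; intros x Hx;
  rewrite Rmin_left, Rmax_right in Hx by lra; rewrite E; auto; lra.
Qed.

Lemma CInt_plus f g a b :
  a <= b -> (forall t, a <= t <= b -> Ccont f t) -> (forall t, a <= t <= b -> Ccont g t) ->
  CInt (fun t => f t + g t)%C a b = (CInt f a b + CInt g a b)%C.
Proof.
  intros Hab Hf Hg. apply Ceq; simpl.
  - apply (RInt_plus (V:=R_CompleteNormedModule)); apply Ccont_ex_Re; assumption.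
  - apply (RInt_plus (V:=R_CompleteNormedModule)); apply Ccont_ex_Im; assumption.
Qed.

Lemma CInt_scal c f a b :
  a <= b -> (forall t, a <= t <= b -> Ccont f t) ->
  CInt (fun t => c * f t)%C a b = (c * CInt f a b)%C.
Proof.
  intros Hab Hf.
  assert (H1 := Ccont_ex_Re f a b Hab Hf). assert (H2 := Ccont_ex_Im f a b Hab Hf).
  apply Ceq; simpl.
  - rewrite (RInt_minus (V:=R_CompleteNormedModule) (fun t => fst c * fst (f t)) (fun t => snd c * snd (f t))).
    + rewrite (RInt_scal (V:=R_CompleteNormedModule) (fun t => fst (f t))) by exact H1.
      rewrite (RInt_scal (V:=R_CompleteNormedModule) (fun t => snd (f t))) by exact H2. reflexivity.
    + apply (ex_RInt_scal (V:=R_CompleteNormedModule)); exact H1.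
    + apply (ex_RInt_scal (V:=R_CompleteNormedModule)); exact H2.
  - rewrite (RInt_plus (V:=R_CompleteNormedModule) (fun t => fst c * snd (f t)) (fun t => snd c * fst (f t))).
    + rewrite (RInt_scal (V:=R_CompleteNormedModule) (fun t => fst (f t))) by exact H1.
      rewrite (RInt_scal (V:=R_CompleteNormedModule) (fun t => snd (f t))) by exact H2. reflexivity.
    + apply (ex_RInt_scal (V:=R_CompleteNormedModule)); exact H2.
    + apply (ex_RInt_scal (V:=R_CompleteNormedModule)); exact H1.
Qed.

Lemma CInt_bound f M a b :
  a <= b -> (forall t, a <= t <= b -> Ccont f t) ->
  (forall t, a <= t <= b -> Cmod (f t) <= M) -> Cmod (CInt f a b) <= 2 * M * (b - a).
Proof.
  intros Hab Hf HM. eapply Rle_trans; [apply Cmod_le_Re_Im|].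
  assert (H1 : Rabs (Re (CInt f a b)) <= (b - a) * M).
  { apply (norm_RInt_le_const (V:=R_NormedModule) (fun t => Re (f t)) a b); [exact Hab| |].
    - intros x Hx. eapply Rle_trans; [apply re_le_Cmod|apply HM; exact Hx].
    - apply (RInt_correct (V:=R_CompleteNormedModule)). apply Ccont_ex_Re; assumption. }
  assert (H2 : Rabs (Im (CInt f a b)) <= (b - a) * M).
  { apply (norm_RInt_le_const (V:=R_NormedModule) (fun t => Im (f t)) a b); [exact Hab| |].
    - intros x Hx. eapply Rle_trans; [apply im_le_Cmod|apply HM; exact Hx].
    - apply (RInt_correct (V:=R_CompleteNormedModule)). apply Ccont_ex_Im; assumption. }
  lra.
Qed.

Lemma CInt_derive (g g' : R -> C) a b :
  a <= b -> (forall t, a <= t <= b -> Cderiv g t (g' t)) ->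
  (forall t, a <= t <= b -> Ccont g' t) -> CInt g' a b = (g b - g a)%C.
Proof.
  intros Hab Hd Hc. apply Ceq; simpl.
  - apply (is_RInt_unique (V:=R_CompleteNormedModule)).
    apply (is_RInt_derive (V:=R_CompleteNormedModule) (fun t => Re (g t)));
      intros x Hx; rewrite Rmin_left, Rmax_right in Hx by lra; [apply Hd|apply Hc]; lra.
  - apply (is_RInt_unique (V:=R_CompleteNormedModule)).
    apply (is_RInt_derive (V:=R_CompleteNormedModule) (fun t => Im (g t)));
      intros x Hx; rewrite Rmin_left, Rmax_right in Hx by lra; [apply Hd|apply Hc]; lra.
Qed.

(** * Joint continuity and integrals with a parameter *)

Definition cont2 (f : R -> R -> C) (x y : R) : Prop :=
  continuity_2d_pt (fun a b => Re (f a b)) x y /\ continuity_2d_pt (fun a b => Im (f a b)) x y.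

Lemma cont2_const c x y : cont2 (fun _ _ => c) x y.
Proof. split; apply continuity_2d_pt_const. Qed.

Lemma cont2_real f x y : continuity_2d_pt f x y -> cont2 (fun a b => RtoC (f a b)) x y.
Proof. intro H; split; simpl; [exact H|apply continuity_2d_pt_const]. Qed.

Lemma cont2_plus f g x y :
  cont2 f x y -> cont2 g x y -> cont2 (fun a b => f a b + g a b)%C x y.
Proof. intros [H1 H2] [H3 H4]; split; simpl; apply continuity_2d_pt_plus; assumption. Qed.

Lemma cont2_mult f g x y :
  cont2 f x y -> cont2 g x y -> cont2 (fun a b => f a b * g a b)%C x y.
Proof.
  intros [H1 H2] [H3 H4]; split; simpl.
  - apply continuity_2d_pt_minus; apply continuity_2d_pt_mult; assumption.
  - apply continuity_2d_pt_plus; apply continuity_2d_pt_mult; assumption.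
Qed.

Lemma cont2_pow f n x y : cont2 f x y -> cont2 (fun a b => f a b ^ n)%C x y.
Proof.
  intro H; induction n as [|n IH]; simpl; [apply cont2_const|apply cont2_mult; assumption].
Qed.

Lemma cont2_exp f x y : cont2 f x y -> cont2 (fun a b => Cexp (f a b)) x y.
Proof.
  intros [H1 H2]; split; unfold Cexp; simpl; apply continuity_2d_pt_mult.
  - apply (continuity_1d_2d_pt_comp exp); [|exact H1]. apply derivable_continuous_pt, derivable_pt_exp.
  - apply (continuity_1d_2d_pt_comp cos); [|exact H2]. apply continuity_cos.
  - apply (continuity_1d_2d_pt_comp exp); [|exact H1]. apply derivable_continuous_pt, derivable_pt_exp.
  - apply (continuity_1d_2d_pt_comp sin); [|exact H2]. apply continuity_sin.
Qed.

Lemma cont2_y_x x y : cont2 (fun a b => (b, a) : C) x y.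
Proof. split; simpl; [apply continuity_2d_pt_id2|apply continuity_2d_pt_id1]. Qed.

Lemma is_derive_RInt_2d (f f' : R -> R -> R) (a b : R) :
  a <= b ->
  (forall x t, is_derive (fun z => f z t) x (f' x t)) ->
  (forall x t, continuity_2d_pt f' x t) ->
  (forall x t, continuous (fun s => f x s) t) ->
  forall x, is_derive (fun z => RInt (fun t => f z t) a b) x (RInt (fun t => f' x t) a b).
Proof.
  intros Hab Hd Hc Hf x.
  replace (RInt (fun t => f' x t) a b) with (RInt (fun t => Derive (fun u => f u t) x) a b).
  2: { apply RInt_ext; intros t _. apply is_derive_unique, Hd. }
  apply is_derive_RInt_param.
  - apply filter_forall. intros z t _. eexists; apply Hd.
  - intros t _. eapply continuity_2d_pt_ext; [|apply Hc].
    intros u v. simpl. symmetry. apply is_derive_unique, Hd.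
  - apply filter_forall. intros z. apply (ex_RInt_continuous (V:=R_CompleteNormedModule)).
    intros; apply Hf.
Qed.

(** * Stieltjes constants as limits of sums minus integrals *)

Lemma is_series_Re (a : nat -> C) (l : C) :
  is_series (K:=C_AbsRing) (V:=C_NormedModule) a l -> is_series (fun n => Re (a n)) (Re l).
Proof.
  intros H. apply filterlim_ext with (f := fun n => Re (sum_n (G:=C_AbelianGroup) a n)).
  - intros n. induction n as [|n IH].
    + now rewrite !sum_O.
    + rewrite !sum_Sn. simpl. rewrite <- IH. reflexivity.
  - apply filterlim_comp with (1 := H).
    intros P [eps HP]. exists eps. intros y Hy. apply HP.
    apply Hy.
Qed.

(** Dominated convergence for series: a common majorant makes the tails uniformly
    small, and on a finite section the limits may be taken term by term. *)
Lemma is_lim_seq_series (b : nat -> nat -> R) (B M : nat -> R) :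
  (forall n, is_lim_seq (fun N => b N n) (B n)) ->
  (forall N n, Rabs (b N n) <= M n) -> ex_series M ->
  is_lim_seq (fun N => Series (b N)) (Series B).
Proof.
  intros Hlim HM Hs.
  assert (HBM : forall n, Rabs (B n) <= M n).
  { intro n. apply (is_lim_seq_le (fun N => Rabs (b N n)) (fun _ => M n) (Rabs (B n)) (M n)).
    - intro N; apply HM.
    - apply (is_lim_seq_abs _ (B n)), Hlim.
    - apply is_lim_seq_const. }
  assert (Htail : forall (c : nat -> R) K, (forall n, Rabs (c n) <= M n) ->
     Rabs (Series c - sum_n c K) <= Series M - sum_n M K).
  { intros c K Hc.
    assert (Ec : ex_series c) by (apply (ex_series_le (V:=R_CompleteNormedModule) c M Hc Hs)).
    rewrite (Series_incr_n c (S K)), (Series_incr_n M (S K)); try lia; try assumption.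
    simpl pred. rewrite <- !sum_n_Reals.
    replace (_ + _ - _) with (Series (fun k => c (S K + k)%nat)) by ring.
    replace (_ + _ - _) with (Series (fun k => M (S K + k)%nat)) by ring.
    eapply Rle_trans; [apply Series_Rabs|apply Series_le].
    - apply (ex_series_le (V:=R_CompleteNormedModule)) with (b := fun k => M (S K + k)%nat).
      + intro n. change (norm (Rabs (c (S K + n)%nat))) with (Rabs (Rabs (c (S K + n)%nat))).
        rewrite Rabs_Rabsolu. apply Hc.
      + apply (ex_series_incr_n M); exact Hs.
    - intro n; split; [apply Rabs_pos|apply Hc].
    - apply (ex_series_incr_n M); exact Hs. }
  apply is_lim_seq_spec. intros eps. simpl.
  assert (Hm := Series_correct _ Hs).
  assert (Hm' : is_lim_seq (sum_n M) (Series M)) by exact Hm.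
  apply is_lim_seq_spec in Hm'.
  assert (He : 0 < eps / 3) by (destruct eps as [e ?]; simpl; lra).
  destruct (Hm' (mkposreal _ He)) as [K HK]. simpl in HK.
  specialize (HK K (le_n K)).
  assert (Hfin : is_lim_seq (fun N => sum_n (b N) K) (sum_n B K)).
  { clear - Hlim. induction K as [|K IH].
    - rewrite sum_O. eapply is_lim_seq_ext; [|apply (Hlim 0%nat)]. intros; now rewrite sum_O.
    - rewrite sum_Sn. eapply is_lim_seq_ext; [|apply (is_lim_seq_plus' _ _ _ _ IH (Hlim (S K)))].
      intros; now rewrite sum_Sn. }
  apply is_lim_seq_spec in Hfin. destruct (Hfin (mkposreal _ He)) as [N0 HN0]. simpl in HN0.
  exists N0. intros N HN. specialize (HN0 N HN).
  assert (H1 := Htail (b N) K (HM N)). assert (H2 := Htail B K HBM).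
  apply Rabs_def2 in HK. apply Rabs_def2 in HN0.
  apply Rabs_le_between in H1. apply Rabs_le_between in H2.
  apply Rabs_def1; lra.
Qed.

(** Each coefficient is the limit at 0+ of what remains after removing the previous
    ones. *)
Lemma pseries_right_unique (a : nat -> R) (r : R) :
  0 < r -> (forall x, 0 < x < r -> is_series (fun n => a n * x ^ n) 0) ->
  forall n, a n = 0.
Proof.
  intros Hr H.
  assert (step : forall b : nat -> R,
    (forall x, 0 < x < r -> is_series (fun n => b n * x ^ n) 0) ->
    b 0%nat = 0 /\ (forall x, 0 < x < r -> is_series (fun n => b (S n) * x ^ n) 0)).
  { intros b Hb.
    assert (Hp : forall x, 0 < x < r -> is_pseries b x 0).
    { intros x Hx. eapply is_series_ext; [|apply (Hb x Hx)].
      intro n. unfold scal; simpl. unfold mult; simpl.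
      rewrite <- pow_n_pow. apply Rmult_comm. }
    assert (Hcv : Rbar_lt (Rabs 0) (CV_radius b)).
    { rewrite Rabs_R0. apply Rbar_lt_le_trans with (r / 2). { simpl; lra. }
      destruct (Rbar_le_lt_dec (r/2) (CV_radius b)) as [h|h]; [exact h|exfalso].
      assert (Hx : 0 < r / 2 < r) by lra.
      apply (CV_disk_outside b (r/2)).
      - now rewrite Rabs_right by lra.
      - apply ex_series_lim_0. eexists; apply (Hb _ Hx). }
    assert (H0 : b 0%nat = 0).
    { assert (Hc := PSeries_continuity b 0 Hcv).
      assert (E0 : PSeries b 0 = b 0%nat) by apply PSeries_0.
      apply continuity_pt_filterlim in Hc. rewrite E0 in Hc.
      destruct (Req_dec (b 0%nat) 0) as [e|ne]; [exact e|exfalso].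
      assert (Hpos : 0 < Rabs (b 0%nat)) by (apply Rabs_pos_lt; exact ne).
      assert (Hloc : locally (b 0%nat) (fun y => Rabs (y - b 0%nat) < Rabs (b 0%nat))).
      { exists (mkposreal _ Hpos). intros y Hy. exact Hy. }
      destruct (Hc _ Hloc) as [d Hd]. 
      set (x := Rmin (d / 2) (r / 2)).
      assert (Hx : 0 < x < r).
      { unfold x; destruct d as [d Hd0]; simpl. split; [apply Rmin_pos; lra|].
        eapply Rle_lt_trans; [apply Rmin_r|]. lra. }
      assert (Hxd : Rabs (x - 0) < d).
      { rewrite Rminus_0_r, Rabs_right by lra. unfold x. destruct d as [d Hd0]; simpl.
        eapply Rle_lt_trans; [apply Rmin_l|]. lra. }
      specialize (Hd x Hxd). rewrite (is_pseries_unique b x 0 (Hp x Hx)) in Hd.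
      rewrite Rminus_0_l, Rabs_Ropp in Hd. lra. }
    split; [exact H0|]. intros x Hx.
    assert (Hbx : is_series (fun n => b (S n) * x ^ S n) 0).
    { apply (is_series_incr_1 (fun n => b n * x ^ n)).
      evar_last; [apply (Hb x Hx)|]. unfold plus; simpl. rewrite H0; ring. }
    assert (Hk := is_series_scal (/ x) _ _ Hbx).
    eapply is_series_ext; [|evar_last; [exact Hk|]].
    - intro n. unfold scal; simpl; unfold mult; simpl. field. lra.
    - unfold scal; simpl; unfold mult; simpl. ring. }
  assert (G : forall n, a n = 0 /\ (forall x, 0 < x < r -> is_series (fun k => a (S n + k)%nat * x ^ k) 0)).
  { induction n as [|n [_ IH]].
    - destruct (step a H) as [H0 H1]. split; [exact H0|exact H1].
    - destruct (step _ IH) as [H0 H1]. rewrite Nat.add_0_r in H0. split; [exact H0|].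
      intros x Hx. eapply is_series_ext; [|apply (H1 x Hx)].
      intro k. simpl. now replace (n + S k)%nat with (S (n + k)) by lia. }
  intro n; apply G.
Qed.

Lemma is_series_exp (x : R) : is_series (fun n => x ^ n / INR (fact n)) (exp x).
Proof.
  eapply is_series_ext; [|apply (is_exp_Reals x)].
  intro n. rewrite pow_n_pow. unfold scal; simpl; unfold mult; simpl. reflexivity.
Qed.

Lemma pow_le_fact_exp (y : R) (n : nat) : 0 <= y -> y ^ n <= INR (fact n) * exp y.
Proof.
  intro Hy.
  assert (H := is_series_exp y). apply is_series_Reals in H.
  assert (Hf : forall k, 0 < INR (fact k)) by (intro k; apply INR_fact_lt_0).
  assert (Ht : forall k, 0 <= y ^ k / INR (fact k)).
  { intro k. apply Rmult_le_pos; [now apply pow_le|]. apply Rlt_le, Rinv_0_lt_compat, Hf. }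
  assert (H1 := sum_incr _ n _ H Ht).
  assert (H2 : y ^ n / INR (fact n) <= sum_f_R0 (fun k => y ^ k / INR (fact k)) n).
  { destruct n as [|n]; [simpl; lra|]. rewrite tech5.
    assert (0 <= sum_f_R0 (fun k => y ^ k / INR (fact k)) n) by (apply cond_pos_sum; exact Ht).
    lra. }
  apply Rmult_le_reg_l with (/ INR (fact n)); [apply Rinv_0_lt_compat, Hf|].
  rewrite <- Rmult_assoc, Rinv_l, Rmult_1_l by (apply Rgt_not_eq, Hf).
  unfold Rdiv in H2. lra.
Qed.

Definition logpow (n : nat) (x : R) : R := ln x ^ n / x.

Definition stieltjes_sum (n N : nat) : R :=
  sum_n (fun m => logpow n (INR (S m))) N - ln (INR (S N)) ^ S n / INR (S n).

(** The bound [y^n <= n! e^y] at half the logarithm, so that only a square root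
    of [t] is lost. *)
Lemma ln_pow_le (n : nat) (t : R) : 1 <= t -> ln t ^ n <= INR (fact n) * 2 ^ n * sqrt t.
Proof.
  intro Ht.
  assert (H0 : 0 <= ln t) by (apply ln_ge_0; lra).
  assert (H := pow_le_fact_exp (ln t / 2) n ltac:(lra)).
  replace (ln t) with (2 * (ln t / 2)) by field. rewrite Rpow_mult_distr.
  replace (exp (ln t / 2)) with (sqrt t) in H.
  - assert (0 < 2 ^ n) by (apply pow_lt; lra). nra.
  - rewrite <- Rpower_sqrt by lra. unfold Rpower. f_equal. lra.
Qed.

Lemma is_derive_logpow (n : nat) (t : R) : 0 < t ->
  is_derive (logpow n) t ((INR n * ln t ^ pred n - ln t ^ n) / t ^ 2).
Proof.
  intro Ht. unfold logpow.
  evar_last; [auto_derive; [split; [exact Ht|split; [lra|exact I]]|reflexivity]|].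
  field. lra.
Qed.

Lemma logpow_deriv_bound (n : nat) (t : R) : 1 <= t ->
  Rabs ((INR n * ln t ^ pred n - ln t ^ n) / t ^ 2) <= INR (fact n) * 2 ^ n / (t * sqrt t).
Proof.
  intro Ht.
  assert (H0 : 0 <= ln t) by (apply ln_ge_0; lra).
  assert (Hs : 0 < sqrt t) by (apply sqrt_lt_R0; lra).
  assert (Hss : sqrt t * sqrt t = t) by (apply sqrt_sqrt; lra).
  assert (H1 := ln_pow_le n t Ht).
  assert (H2 : INR n * ln t ^ pred n <= INR (fact n) * 2 ^ n * sqrt t).
  { destruct n as [|n]; simpl pred.
    - simpl. nra.
    - assert (H := ln_pow_le n t Ht).
      rewrite fact_simpl, mult_INR.
      pose proof (pos_INR (S n)). pose proof (INR_fact_lt_0 n).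
      assert (0 < 2 ^ n) by (apply pow_lt; lra).
      assert (0 <= INR (S n) * (INR (fact n) * 2 ^ n * sqrt t)).
      { repeat apply Rmult_le_pos; lra. }
      simpl pow. nra. }
  assert (P1 : 0 <= ln t ^ n) by (now apply pow_le).
  assert (P2 : 0 <= INR n * ln t ^ pred n).
  { apply Rmult_le_pos; [apply pos_INR|now apply pow_le]. }
  unfold Rdiv. rewrite Rabs_mult, (Rabs_right (/ t ^ 2)).
  2: { apply Rle_ge, Rlt_le, Rinv_0_lt_compat, pow_lt; lra. }
  replace (INR (fact n) * 2 ^ n * / (t * sqrt t)) with (INR (fact n) * 2 ^ n * sqrt t * / t ^ 2).
  2: { replace (t ^ 2) with (t * (sqrt t * sqrt t)) by (rewrite Hss; ring). field. lra. }
  apply Rmult_le_compat_r.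
  - apply Rlt_le, Rinv_0_lt_compat, pow_lt; lra.
  - apply Rabs_le; lra.
Qed.

(** The derivative is dominated by that of the monotone function [2 n! 2^n / sqrt],
    whose differences telescope. *)
Lemma logpow_variation (n : nat) (x y : R) : 1 <= x <= y ->
  Rabs (logpow n y - logpow n x)
    <= 2 * (INR (fact n) * 2 ^ n) / sqrt x - 2 * (INR (fact n) * 2 ^ n) / sqrt y.
Proof.
  intros [Hx Hxy]. set (c := INR (fact n) * 2 ^ n).
  set (V := fun t => 2 * c / sqrt t).
  assert (HV : forall t, 1 <= t -> is_derive V t (- (c / (t * sqrt t)))).
  { intros t Ht. unfold V.
    assert (0 < sqrt t) by (apply sqrt_lt_R0; lra).
    evar_last; [auto_derive; [split; [lra|split; [lra|exact I]]|reflexivity]|].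
    assert (Hss : sqrt t * sqrt t = t) by (apply sqrt_sqrt; lra).
    replace (c / (t * sqrt t)) with (c / (sqrt t * sqrt t * sqrt t)) by (now rewrite Hss).
    field. lra. }
  assert (Hd := fun t Ht => is_derive_logpow n t (Rlt_le_trans 0 1 t Rlt_0_1 Ht)).
  assert (Hb := logpow_deriv_bound n). fold c in Hb.
  assert (A1 : logpow n y + V y <= logpow n x + V x).
  { apply (nonincr_of_deriv (fun t => logpow n t + V t)
     (fun t => (INR n * ln t ^ pred n - ln t ^ n) / t ^ 2 + - (c / (t * sqrt t)))); [exact Hxy| |].
    - intros t Ht. apply (is_derive_plus (V:=R_NormedModule)); [apply Hd|apply HV]; lra.
    - intros t Ht. specialize (Hb t ltac:(lra)). apply Rabs_le_between in Hb. lra. }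
  assert (A2 : V y - logpow n y <= V x - logpow n x).
  { apply (nonincr_of_deriv (fun t => V t - logpow n t)
     (fun t => - (c / (t * sqrt t)) - (INR n * ln t ^ pred n - ln t ^ n) / t ^ 2)); [exact Hxy| |].
    - intros t Ht. apply (is_derive_minus (V:=R_NormedModule)); [apply HV|apply Hd]; lra.
    - intros t Ht. specialize (Hb t ltac:(lra)). apply Rabs_le_between in Hb. lra. }
  fold (V x) (V y). apply Rabs_le. lra.
Qed.

Lemma is_derive_logpow_primitive (n : nat) (t : R) : 0 < t ->
  is_derive (fun t => ln t ^ S n / INR (S n)) t (logpow n t).
Proof.
  intro Ht. assert (Hn : 0 < INR (S n)) by (apply lt_0_INR; lia). unfold logpow.
  evar_last; [auto_derive; [lra|reflexivity]|]. simpl pred.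
  rewrite S_INR in *. destruct n as [|n]; simpl pow; simpl INR in *; try field; lra.
Qed.

(** By the mean value theorem the integral over a cell is the value of the
    integrand at an interior point, so that a step is a variation inside the
    cell; these variations telescope. *)
Lemma stieltjes_sum_step (n N : nat) :
  Rabs (stieltjes_sum n (S N) - stieltjes_sum n N)
    <= 2 * (INR (fact n) * 2 ^ n) / sqrt (INR (S N))
       - 2 * (INR (fact n) * 2 ^ n) / sqrt (INR (S (S N))).
Proof.
  set (a := INR (S N)). set (b := INR (S (S N))).
  assert (Ha : 1 <= a) by apply INR_S_ge_1.
  assert (Hab : b = a + 1) by (unfold b; rewrite S_INR; reflexivity).
  destruct (mean_value (fun t => ln t ^ S n / INR (S n)) (logpow n) a b ltac:(lra)) as [c [Hc E]].
  { intros z Hz. apply is_derive_logpow_primitive; lra. }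
  replace (stieltjes_sum n (S N) - stieltjes_sum n N) with (logpow n b - logpow n c).
  - eapply Rle_trans; [apply logpow_variation; lra|].
    assert (0 <= 2 * (INR (fact n) * 2 ^ n)).
    { pose proof (INR_fact_lt_0 n). assert (0 < 2 ^ n) by (apply pow_lt; lra). nra. }
    assert (/ sqrt c <= / sqrt a).
    { apply Rinv_le_contravar; [apply sqrt_lt_R0; lra|apply sqrt_le_1_alt; lra]. }
    unfold Rdiv. nra.
  - unfold stieltjes_sum. rewrite sum_n_S. fold a b. replace (b - a) with 1 in E by lra. lra.
Qed.

Lemma stieltjes_sum_bound (n N : nat) :
  Rabs (stieltjes_sum n N) <= 1 + 2 * (INR (fact n) * 2 ^ n).
Proof.
  assert (Hc : 0 <= 2 * (INR (fact n) * 2 ^ n)).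
  { pose proof (INR_fact_lt_0 n). assert (0 < 2 ^ n) by (apply pow_lt; lra). nra. }
  set (c := 2 * (INR (fact n) * 2 ^ n)) in *.
  assert (H0 : Rabs (stieltjes_sum n 0) <= 1).
  { unfold stieltjes_sum. rewrite sum_O. simpl INR at 1 2. rewrite ln_1. unfold logpow.
    rewrite ln_1. simpl (0 ^ S n). rewrite Rmult_0_l. unfold Rdiv. rewrite Rmult_0_l, Rminus_0_r, Rinv_1, Rmult_1_r.
    destruct n; simpl; [rewrite Rabs_R1; lra|]. rewrite Rmult_0_l, Rabs_R0; lra. }
  assert (H : Rabs (stieltjes_sum n N) <= 1 + c / sqrt 1 - c / sqrt (INR (S N))).
  { induction N as [|N IH]; [simpl INR; lra|].
    assert (H1 := stieltjes_sum_step n N). fold c in H1.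
    replace (stieltjes_sum n (S N)) with (stieltjes_sum n N + (stieltjes_sum n (S N) - stieltjes_sum n N)) by ring.
    eapply Rle_trans; [apply Rabs_triang|]. lra. }
  rewrite sqrt_1 in H. 
  assert (0 <= c / sqrt (INR (S N))).
  { apply Rmult_le_pos; [exact Hc|]. apply Rlt_le, Rinv_0_lt_compat, sqrt_lt_R0, lt_0_INR. lia. }
  lra.
Qed.

Lemma stieltjes_sum_lim (n : nat) : exists g : R, is_lim_seq (stieltjes_sum n) g.
Proof.
  assert (Hc : 0 <= 2 * (INR (fact n) * 2 ^ n)).
  { pose proof (INR_fact_lt_0 n). assert (0 < 2 ^ n) by (apply pow_lt; lra). nra. }
  set (c := 2 * (INR (fact n) * 2 ^ n)) in *.
  set (V := fun N => c / sqrt (INR (S N))).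
  assert (HV0 : forall N, 0 <= V N).
  { intro N. apply Rmult_le_pos; [exact Hc|]. apply Rlt_le, Rinv_0_lt_compat, sqrt_lt_R0, lt_0_INR. lia. }
  assert (HS := stieltjes_sum_step n). fold c in HS.
  assert (HV : forall N, V (S N) <= V N).
  { intro N. pose proof (Rle_trans _ _ _ (Rabs_pos _) (HS N)). unfold V; lra. }
  destruct (ex_finite_lim_seq_decr V 0 HV HV0) as [lV HlV].
  destruct (ex_finite_lim_seq_decr (fun N => stieltjes_sum n N + V N) (- (1 + c))) as [l Hl].
  - intro N. specialize (HS N). apply Rabs_le_between in HS. unfold V; lra.
  - intro N. assert (H := stieltjes_sum_bound n N). fold c in H.
    apply Rabs_le_between in H. specialize (HV0 N). lra.
  - exists (l - lV). eapply is_lim_seq_ext; [|apply (is_lim_seq_minus' _ _ _ _ Hl HlV)].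
    intro N; simpl; ring.
Qed.

Lemma is_lim_seq_exp_ln (x : R) : 0 < x ->
  is_lim_seq (fun N => exp (- x * ln (INR (S N)))) 0.
Proof.
  intro Hx.
  assert (H1 : is_lim_seq (fun N => INR (S N)) p_infty).
  { apply (is_lim_seq_incr_1 INR). apply is_lim_seq_INR. }
  assert (H2 : is_lim_seq (fun N => ln (INR (S N))) p_infty).
  { apply (filterlim_comp _ _ _ (fun N => INR (S N)) ln eventually (Rbar_locally p_infty)); [exact H1|exact is_lim_ln_p]. }
  assert (H3 : is_lim_seq (fun N => - x * ln (INR (S N))) m_infty).
  { evar_last; [apply (is_lim_seq_scal_l _ (- x) p_infty H2)|].
    simpl. destruct (Rle_dec 0 (- x)) as [h|h]; [exfalso; lra|reflexivity]. }
  apply (filterlim_comp _ _ _ _ exp eventually (Rbar_locally m_infty)); [exact H3|exact is_lim_exp_m].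
Qed.

(** Expanding [m^(-x)] and [N^(-x)] as exponential series in [x] turns the
    truncated Dirichlet series into the generating function of the truncated
    Stieltjes sums. *)
Lemma truncated_zeta_series (x : R) (N : nat) : 0 < x ->
  is_series (fun n => (- x) ^ n / INR (fact n) * stieltjes_sum n N)
    (sum_n (fun m => exp (- (1 + x) * ln (INR (S m)))) N
     - (1 - exp (- x * ln (INR (S N)))) / x).
Proof.
  intro Hx.
  assert (Hf : forall k, INR (fact k) <> 0) by (intro k; apply INR_fact_neq_0).
  assert (H1 : is_series (fun n => (- x) ^ n / INR (fact n) *
     sum_n (fun m => logpow n (INR (S m))) N) (sum_n (fun m => exp (- (1 + x) * ln (INR (S m)))) N)).
  { assert (Hm : forall m, is_series (fun n => (- x) ^ n / INR (fact n) * logpow n (INR (S m)))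
                  (exp (- (1 + x) * ln (INR (S m))))).
    { intro m. set (M := INR (S m)). assert (HM : 0 < M) by (apply lt_0_INR; lia).
      assert (H := is_series_scal (/ M) _ _ (is_series_exp (- x * ln M))).
      eapply is_series_ext; [|evar_last; [exact H|]].
      - intro n. unfold scal; simpl; unfold mult; simpl. unfold logpow.
        rewrite (Rpow_mult_distr (- x)). field. split; [lra|apply Hf].
      - unfold scal; simpl; unfold mult; simpl.
        replace (- (1 + x) * ln M) with (- ln M + - x * ln M) by ring.
        rewrite exp_plus, exp_Ropp, exp_ln by exact HM. reflexivity. }
    induction N as [|N IH].
    - rewrite sum_O. eapply is_series_ext; [|apply (Hm 0%nat)]. intro n. now rewrite sum_O.
    - rewrite sum_Sn. assert (H := is_series_plus _ _ _ _ IH (Hm (S N))).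
      eapply is_series_ext; [|exact H]. intro n. rewrite sum_Sn.
      unfold plus; simpl. ring. }
  assert (H2 : is_series (fun n => (- x) ^ n / INR (fact n) * (ln (INR (S N)) ^ S n / INR (S n)))
     ((1 - exp (- x * ln (INR (S N)))) / x)).
  { set (L := ln (INR (S N))).
    assert (H := is_series_exp (- x * L)).
    assert (H' : is_series (fun k => (- x * L) ^ S k / INR (fact (S k))) (exp (- x * L) - 1)).
    { apply (is_series_incr_1 (fun k => (- x * L) ^ k / INR (fact k))).
      evar_last; [exact H|]. unfold plus; simpl. field. }
    assert (H'' := is_series_scal (- / x) _ _ H').
    eapply is_series_ext; [|evar_last; [exact H''|]].
    - intro n. unfold scal; simpl; unfold mult; simpl.
      change (fact n + n * fact n)%nat with (fact (S n)). rewrite fact_simpl, mult_INR.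
      change (match n with O => 1 | S _ => INR n + 1 end) with (INR (S n)).
      rewrite (Rpow_mult_distr (- x)). 
      assert (INR (S n) <> 0) by (apply not_0_INR; lia).
      field. repeat split; try lra; try apply Hf; assumption.
    - unfold scal; simpl; unfold mult; simpl. field. lra. }
  assert (H := is_series_minus _ _ _ _ H1 H2).
  eapply is_series_ext; [|exact H]. intro n. unfold stieltjes_sum, minus, plus, opp; simpl. ring.
Qed.

(** Both expansions are compared for [s = 1 + x] with small [x > 0].  The
    truncated sums are bounded by a multiple of [n! 2^n] uniformly in the cutoff,
    so that the generating function converges for [2 x < 1] and the limit may be
    taken inside. *)
Lemma stieltjes_limit (zeta : C -> C) (gamma : nat -> R) :
  is_riemann_zeta zeta -> is_stieltjes zeta gamma ->
  forall n, is_lim_seq (stieltjes_sum n) (gamma n).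
Proof.
  intros [_ Hz] [r [Hr Hg]].
  set (g := fun n => real (Lim_seq (stieltjes_sum n))).
  assert (Hlim : forall n, is_lim_seq (stieltjes_sum n) (g n)).
  { intro n. apply Lim_seq_correct'. destruct (stieltjes_sum_lim n) as [l Hl]. exists l; exact Hl. }
  assert (Hf : forall k, INR (fact k) <> 0) by (intro k; apply INR_fact_neq_0).
  assert (Heq : forall n, (-1) ^ n / INR (fact n) * (gamma n - g n) = 0).
  { (* any bound below 1/2 makes the majorant [(2 x)^n] summable *)
    apply (pseries_right_unique _ (Rmin r (1 / 4))); [apply Rmin_pos; lra|].
    intros x [Hx0 Hx].
    assert (Hxr : x < r) by (eapply Rlt_le_trans; [exact Hx|apply Rmin_l]).
    assert (Hx4 : x < 1 / 4) by (eapply Rlt_le_trans; [exact Hx|apply Rmin_r]).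
    set (s := RtoC (1 + x)).
    assert (Es : (s - 1)%C = RtoC x) by (unfold s; apply Ceq; simpl; ring).
    assert (Z : is_series (fun m => exp (- (1 + x) * ln (INR (S m)))) (Re (zeta s))).
    { assert (H := is_series_Re _ _ (Hz s ltac:(simpl; lra))).
      eapply is_series_ext; [|exact H]. intro m. unfold Cexp, s; cbn -[INR].
      replace (- (1 + x) * 0 + - 0 * ln (INR (S m))) with 0 by ring.
      rewrite cos_0, Rmult_1_r. f_equal. ring. }
    assert (Lau : is_series (fun n => (-1) ^ n / INR (fact n) * gamma n * x ^ n) (Re (zeta s) - 1 / x)).
    { assert (H : 0 < Cmod (s - 1) < r).
      { rewrite Es, Cmod_R, Rabs_right; lra. }
      assert (H' := is_series_Re _ _ (Hg s H)). rewrite Es in H'.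
      replace (Re (zeta s - 1 / RtoC x)%C) with (Re (zeta s) - 1 / x) in H'.
      - eapply is_series_ext; [|exact H']. intro n. simpl.
        rewrite <- RtoC_pow. simpl. ring.
      - rewrite <- RtoC_div, re_minus. { reflexivity. } { lra. } }
    set (B := fun n => (- x) ^ n / INR (fact n) * g n).
    set (M := fun n => 3 * (2 * x) ^ n).
    assert (HM : ex_series M).
    { apply (ex_series_scal (V:=R_NormedModule) 3). apply ex_series_geom. rewrite Rabs_right; lra. }
    assert (HbM : forall N n, Rabs ((- x) ^ n / INR (fact n) * stieltjes_sum n N) <= M n).
    { intros N n. unfold M. rewrite Rabs_mult. unfold Rdiv. rewrite Rabs_mult, <- RPow_abs, Rabs_Ropp, (Rabs_right x) by lra.
      rewrite Rabs_inv, (Rabs_right (INR (fact n))) by (apply Rle_ge, pos_INR).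
      assert (Hs := stieltjes_sum_bound n N). pose proof (INR_fact_lt_0 n) as Hfp.
      assert (H1f : 1 <= INR (fact n)) by (apply (le_INR 1); apply lt_O_fact).
      assert (H2n : 1 <= 2 ^ n) by (apply pow_R1_Rle; lra).
      rewrite Rpow_mult_distr. assert (Hxn : 0 < x ^ n) by (apply pow_lt; lra).
      replace (3 * (2 ^ n * x ^ n)) with (x ^ n * / INR (fact n) * (3 * (INR (fact n) * 2 ^ n))) by (field; apply Hf).
      apply Rmult_le_compat_l.
      - apply Rmult_le_pos; [lra|]. apply Rlt_le, Rinv_0_lt_compat; lra.
      - nra. }
    assert (HlimS : is_lim_seq (fun N => Series (fun n => (- x) ^ n / INR (fact n) * stieltjes_sum n N)) (Series B)).
    { apply (is_lim_seq_series _ _ M); [|exact HbM|exact HM].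
      intro n. unfold B. apply (is_lim_seq_scal_l _ _ (g n)). apply Hlim. }
    assert (HlimZ : is_lim_seq (fun N => Series (fun n => (- x) ^ n / INR (fact n) * stieltjes_sum n N))
                      (Re (zeta s) - 1 / x)).
    { eapply is_lim_seq_ext.
      - intro N. symmetry. apply is_series_unique. apply truncated_zeta_series; lra.
      - apply is_lim_seq_minus'; [exact Z|].
        replace (1 / x) with ((1 - 0) / x) by (field; lra).
        apply (is_lim_seq_scal_r _ (/ x) (1 - 0)).
        apply is_lim_seq_minus'; [apply is_lim_seq_const|]. apply is_lim_seq_exp_ln; lra. }
    assert (E : Series B = Re (zeta s) - 1 / x).
    { apply is_lim_seq_unique in HlimS. apply is_lim_seq_unique in HlimZ.
      rewrite HlimS in HlimZ. now inversion HlimZ. }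
    assert (HB : is_series B (Re (zeta s) - 1 / x)).
    { rewrite <- E. apply Series_correct.
      apply (ex_series_le (V:=R_CompleteNormedModule) B M); [|exact HM].
      intro n. unfold norm; simpl; unfold abs; simpl.
      apply (is_lim_seq_le (fun N => Rabs ((- x) ^ n / INR (fact n) * stieltjes_sum n N)) (fun _ => M n) (Rabs (B n)) (M n)).
      - intro N; apply HbM.
      - apply (is_lim_seq_abs _ (B n)). apply (is_lim_seq_scal_l _ _ (g n)). apply Hlim.
      - apply is_lim_seq_const. }
    assert (H := is_series_minus _ _ _ _ Lau HB).
    eapply is_series_ext; [|evar_last; [exact H|]].
    - intro n. unfold minus, plus, opp, B; simpl.
      replace (- x) with (-1 * x) by ring. rewrite Rpow_mult_distr. field. apply Hf.
    - unfold minus, plus, opp; simpl. ring. }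
  intro n. replace (gamma n) with (g n); [apply Hlim|].
  specialize (Heq n).
  assert (Hne : (-1) ^ n / INR (fact n) <> 0).
  { apply Rmult_integral_contrapositive_currified; [apply pow_nonzero; lra|apply Rinv_neq_0_compat, Hf]. }
  apply Rmult_integral in Heq. destruct Heq; [contradiction|lra].
Qed.

(** * Fourier inversion on a unit cell *)


Lemma PI_gt_3 : 3 < PI.
Proof. pose proof PI2_3_2. unfold PI2 in *. lra. Qed.

Lemma sin_ge_third (y : R) : 0 <= y <= PI / 2 -> y / 3 <= sin y.
Proof.
  intros [H0 H1]. pose proof PI_4 as P4. pose proof PI_gt_3 as P3.
  destruct (SIN y H0 ltac:(lra)) as [H _]. eapply Rle_trans; [|exact H].
  unfold sin_lb, sin_approx, sin_term. simpl. 
  assert (Hy : y <= 2) by lra.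
  assert (y ^ 2 <= 4) by nra.
  replace (_ + _) with (y - y ^ 3 / 6 + y ^ 5 / 120 * (1 - y ^ 2 / 42)) by (simpl; field).
  assert (0 <= y ^ 5) by (apply pow_le; exact H0).
  assert (0 <= y ^ 5 / 120 * (1 - y ^ 2 / 42)) by (apply Rmult_le_pos; lra).
  assert (y ^ 3 <= 4 * y) by (replace (y ^ 3) with (y ^ 2 * y) by ring; apply Rmult_le_compat_r; lra).
  lra.
Qed.

Definition dirichlet (K : nat) (x : R) : R :=
  1 + 2 * sum_n (fun k => cos (2 * PI * INR (S k) * x)) K.

(** The primitive of the Dirichlet kernel that vanishes at 1/2; it is what
    remains of a sawtooth after subtracting a partial Fourier sum. *)
Definition sawtooth_tail (K : nat) (x : R) : R :=
  x - 1 / 2 + sum_n (fun k => sin (2 * PI * INR (S k) * x) / (PI * INR (S k))) K.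

Lemma is_derive_sawtooth (K : nat) (x : R) :
  is_derive (sawtooth_tail K) x (dirichlet K x).
Proof.
  unfold sawtooth_tail, dirichlet.
  apply (is_derive_plus (V:=R_NormedModule) (fun x => x - 1 / 2)
    (fun x => sum_n (fun k => sin (2 * PI * INR (S k) * x) / (PI * INR (S k))) K)).
  - auto_derive; [exact I|ring].
  - replace (2 * sum_n (fun k => cos (2 * PI * INR (S k) * x)) K)
      with (sum_n (fun k => 2 * cos (2 * PI * INR (S k) * x)) K)
      by (apply (sum_n_mult_l (K:=R_AbsRing) 2)).
    apply (is_derive_sum_n (fun k x => sin (2 * PI * INR (S k) * x) / (PI * INR (S k)))).
    intros k _. pose proof (INR_S_pos k). pose proof PI_RGT_0.
    set (c := INR (S k)) in *. auto_derive; [exact I|]. field. lra.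
Qed.

Lemma dirichlet_sin (K : nat) (x : R) :
  dirichlet K x * sin (PI * x) = sin ((2 * INR K + 3) * PI * x).
Proof.
  unfold dirichlet.
  assert (P : forall k, 2 * cos (2 * PI * INR (S k) * x) * sin (PI * x)
     = sin ((2 * INR k + 3) * PI * x) - sin ((2 * INR k + 1) * PI * x)).
  { intro k. rewrite S_INR.
    replace ((2 * INR k + 3) * PI * x) with (2 * PI * (INR k + 1) * x + PI * x) by ring.
    replace ((2 * INR k + 1) * PI * x) with (2 * PI * (INR k + 1) * x - PI * x) by ring.
    rewrite sin_plus, sin_minus. ring. }
  induction K as [|K IH].
  - rewrite sum_O. specialize (P 0%nat). simpl INR in *.
    replace ((2 * 0 + 1) * PI * x) with (PI * x) in P by ring. lra.
  - rewrite sum_n_S. specialize (P (S K)). 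
    replace (2 * INR (S K) + 1) with (2 * INR K + 3) in P by (rewrite S_INR; ring). lra.
Qed.

Lemma dirichlet_bound (K : nat) (x : R) : Rabs (dirichlet K x) <= 2 * INR K + 3.
Proof.
  unfold dirichlet. induction K as [|K IH].
  - rewrite sum_O. simpl INR. pose proof (COS_bound (2 * PI * 1 * x)). apply Rabs_le; lra.
  - rewrite sum_n_S, (S_INR K). pose proof (COS_bound (2 * PI * INR (S (S K)) * x)).
    apply Rabs_le_between in IH. apply Rabs_le; lra.
Qed.

Lemma sin_PI_INR (k : nat) : sin (PI * INR k) = 0.
Proof.
  induction k as [|k IH]; [simpl; rewrite Rmult_0_r; apply sin_0|].
  rewrite S_INR, Rmult_plus_distr_l, Rmult_1_r, neg_sin, IH. ring.
Qed.

Lemma sawtooth_half (K : nat) : sawtooth_tail K (1 / 2) = 0.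
Proof.
  unfold sawtooth_tail. replace (sum_n _ K) with 0; [lra|].
  induction K as [|K IH]; [rewrite sum_O|rewrite sum_n_S, <- IH];
  match goal with |- context [sin (2 * PI * INR ?k * (1 / 2))] =>
    replace (2 * PI * INR k * (1 / 2)) with (PI * INR k) by field; rewrite sin_PI_INR end;
  unfold Rdiv; ring.
Qed.

Lemma sawtooth_0 (K : nat) : sawtooth_tail K 0 = - (1 / 2).
Proof.
  unfold sawtooth_tail. replace (sum_n _ K) with 0; [lra|].
  induction K as [|K IH]; [rewrite sum_O|rewrite sum_n_S, <- IH];
  rewrite Rmult_0_r, sin_0; unfold Rdiv; ring.
Qed.

Lemma sawtooth_sym (K : nat) (x : R) : sawtooth_tail K (1 - x) = - sawtooth_tail K x.
Proof.
  unfold sawtooth_tail.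
  assert (P : forall k, sin (2 * PI * INR k * (1 - x)) = - sin (2 * PI * INR k * x)).
  { intro k. replace (2 * PI * INR k * (1 - x)) with (- (2 * PI * INR k * x) + 2 * INR k * PI) by ring.
    rewrite sin_period. apply sin_neg. }
  assert (H : sum_n (fun k => sin (2 * PI * INR (S k) * (1 - x)) / (PI * INR (S k))) K
     = - sum_n (fun k => sin (2 * PI * INR (S k) * x) / (PI * INR (S k))) K).
  { induction K as [|K IH]; [rewrite !sum_O|rewrite !sum_n_S, IH]; rewrite P; change_R; unfold Rdiv; ring. }
  rewrite H. field.
Qed.

(** With [l = 2 K + 3] the derivative is [sin (l PI x) / sin (PI x)].
    Integrating the oscillating factor once leaves a term of size
    [1 / (l sin (PI x))] and a remainder dominated by the derivative of
    [cot (PI x) / l]. *)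
Lemma sawtooth_decay (K : nat) (x : R) : 0 < x <= 1 / 2 ->
  Rabs (sawtooth_tail K x) <= 1 / ((2 * INR K + 3) * x).
Proof.
  intros [H0 H1]. set (l := 2 * INR K + 3).
  assert (Hl : 3 <= l) by (unfold l; pose proof (pos_INR K); lra).
  pose proof PI_gt_3 as P3.
  set (lam := l * PI).
  assert (Hlam : 9 < lam) by (unfold lam; nra).
  set (D := fun t => - cos (lam * t) * (PI * cos (PI * t)) / (lam * sin (PI * t) ^ 2)).
  assert (Hsin : forall t, x <= t <= 1 / 2 -> 0 < sin (PI * t)).
  { intros t Ht. apply sin_gt_0; nra. }
  assert (HPhi : forall t, x <= t <= 1 / 2 ->
     is_derive (fun t => sawtooth_tail K t + cos (lam * t) / (lam * sin (PI * t))) t (D t)).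
  { intros t Ht. specialize (Hsin t Ht).
    assert (Hd := is_derive_sawtooth K t).
    assert (Hk := dirichlet_sin K t). fold l in Hk. fold lam in Hk.
    evar_last. 
    - apply (is_derive_plus (V:=R_NormedModule) (sawtooth_tail K) (fun t => cos (lam * t) / (lam * sin (PI * t)))).
      + exact Hd.
      + auto_derive; [|reflexivity]. apply Rgt_not_eq. apply Rmult_lt_0_compat; lra.
    - unfold D, plus; simpl. replace (dirichlet K t) with (sin (lam * t) / sin (PI * t)).
      + field. split; lra.
      + rewrite <- Hk. field. lra. }
  assert (HC : forall t, x <= t <= 1 / 2 ->
     is_derive (fun t => cos (PI * t) / (lam * sin (PI * t))) t (- (PI / (lam * sin (PI * t) ^ 2)))).
  { intros t Ht. specialize (Hsin t Ht). evar_last.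
    - auto_derive; [|reflexivity]. apply Rgt_not_eq. apply Rmult_lt_0_compat; lra.
    - pose proof (sin2_cos2 (PI * t)) as Hsc. unfold Rsqr in Hsc.
      field_simplify; [|split; lra|split; lra].
      replace (cos (PI * t) ^ 2) with (1 - sin (PI * t) ^ 2) by (simpl; lra). field. split; lra. }
  assert (HD : forall t, x <= t <= 1 / 2 -> Rabs (D t) <= PI / (lam * sin (PI * t) ^ 2)).
  { intros t Ht. specialize (Hsin t Ht). unfold D, Rdiv. rewrite Rabs_mult.
    assert (0 < / (lam * sin (PI * t) ^ 2)).
    { apply Rinv_0_lt_compat. apply Rmult_lt_0_compat; [lra|]. apply pow_lt; lra. }
    rewrite (Rabs_right (/ _)) by lra. apply Rmult_le_compat_r; [lra|].
    pose proof (COS_bound (lam * t)). pose proof (COS_bound (PI * t)).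
    rewrite Rabs_mult, Rabs_mult, (Rabs_right PI), Rabs_Ropp by lra.
    assert (Rabs (cos (lam * t)) <= 1) by (apply Rabs_le; lra).
    assert (Rabs (cos (PI * t)) <= 1) by (apply Rabs_le; lra).
    pose proof (Rabs_pos (cos (lam * t))). pose proof (Rabs_pos (cos (PI * t))).
    assert (PI * Rabs (cos (PI * t)) <= PI) by nra.
    assert (0 <= PI * Rabs (cos (PI * t))) by nra. nra. }
  assert (Hh : cos (PI * (1 / 2)) = 0) by (replace (PI * (1 / 2)) with (PI / 2) by field; apply cos_PI2).
  assert (Hhl : cos (lam * (1 / 2)) = 0).
  { unfold lam, l. replace ((2 * INR K + 3) * PI * (1 / 2)) with (PI / 2 + PI * INR (S K)) by (rewrite S_INR; field).
    rewrite cos_plus, cos_PI2, sin_PI_INR. ring. }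
  set (Phi := fun t => sawtooth_tail K t + cos (lam * t) / (lam * sin (PI * t))) in *.
  set (Ct := fun t => cos (PI * t) / (lam * sin (PI * t))) in *.
  assert (HPh : Phi (1 / 2) = 0).
  { unfold Phi. rewrite sawtooth_half, Hhl. unfold Rdiv; ring. }
  assert (HCh : Ct (1 / 2) = 0).
  { unfold Ct. rewrite Hh. unfold Rdiv; ring. }
  assert (A1 : Phi (1 / 2) + Ct (1 / 2) <= Phi x + Ct x).
  { apply (nonincr_of_deriv (fun t => Phi t + Ct t) (fun t => D t + - (PI / (lam * sin (PI * t) ^ 2)))); [lra| |].
    - intros t Ht. apply (is_derive_plus (V:=R_NormedModule)); [apply HPhi|apply HC]; exact Ht.
    - intros t Ht. specialize (HD t Ht). apply Rabs_le_between in HD. lra. }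
  assert (A2 : Ct (1 / 2) - Phi (1 / 2) <= Ct x - Phi x).
  { apply (nonincr_of_deriv (fun t => Ct t - Phi t) (fun t => - (PI / (lam * sin (PI * t) ^ 2)) - D t)); [lra| |].
    - intros t Ht. apply (is_derive_minus (V:=R_NormedModule)); [apply HC|apply HPhi]; exact Ht.
    - intros t Ht. specialize (HD t Ht). apply Rabs_le_between in HD. lra. }
  rewrite HPh, HCh in A1, A2.
  specialize (Hsin x ltac:(lra)).
  assert (Hsx : x <= sin (PI * x)).
  { eapply Rle_trans; [|apply sin_ge_third; nra]. nra. }
  assert (Hq : / (lam * sin (PI * x)) <= / (3 * (l * x))).
  { apply Rinv_le_contravar; [nra|]. unfold lam. 
    assert (3 * (l * x) <= PI * (l * sin (PI * x))); [|lra].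
    apply Rmult_le_compat; try nra. }
  set (q := / (lam * sin (PI * x))) in *.
  assert (0 < q) by (apply Rinv_0_lt_compat; nra).
  assert (B1 : Rabs (Ct x) <= q).
  { unfold Ct, Rdiv. fold q. rewrite Rabs_mult, (Rabs_right q) by lra.
    pose proof (COS_bound (PI * x)). assert (Rabs (cos (PI * x)) <= 1) by (apply Rabs_le; lra). nra. }
  assert (B2 : Rabs (Phi x - sawtooth_tail K x) <= q).
  { unfold Phi. replace (_ - _) with (cos (lam * x) * q) by (unfold q, Rdiv; ring).
    rewrite Rabs_mult, (Rabs_right q) by lra.
    pose proof (COS_bound (lam * x)). assert (Rabs (cos (lam * x)) <= 1) by (apply Rabs_le; lra). nra. }
  replace (1 / (l * x)) with (3 * / (3 * (l * x))) by (field; split; lra).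
  apply Rabs_le_between in B1. apply Rabs_le_between in B2. apply Rabs_le. lra.
Qed.

Lemma sawtooth_bound_half (K : nat) (x : R) : 0 <= x <= 1 / 2 ->
  Rabs (sawtooth_tail K x) <= 3 / (1 + (2 * INR K + 3) * x).
Proof.
  intros [H0 H1]. assert (Hl : 3 <= 2 * INR K + 3) by (pose proof (pos_INR K); lra).
  assert (Hn : Rabs (sawtooth_tail K x) <= 1 / 2 + (2 * INR K + 3) * x).
  { destruct (mean_value (sawtooth_tail K) (dirichlet K) 0 x H0) as [c [_ E]].
    { intros; apply is_derive_sawtooth. }
    rewrite sawtooth_0, Rminus_0_r in E.
    replace (sawtooth_tail K x) with (- (1 / 2) + dirichlet K c * x) by lra.
    eapply Rle_trans; [apply Rabs_triang|].
    rewrite Rabs_Ropp, Rabs_right, Rabs_mult, (Rabs_right x) by lra.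
    pose proof (dirichlet_bound K c). nra. }
  set (l := 2 * INR K + 3) in *.
  apply Rmult_le_reg_r with (1 + l * x); [nra|].
  unfold Rdiv. rewrite Rmult_assoc, Rinv_l, Rmult_1_r by nra.
  pose proof (Rabs_pos (sawtooth_tail K x)). assert (0 <= l * x) by nra.
  destruct (Rle_lt_dec (l * x) 1) as [h|h].
  { apply Rle_trans with (3 / 2 * 2); [|lra]. apply Rmult_le_compat; lra. }
  assert (Hx : 0 < x) by nra.
  assert (Hsd := sawtooth_decay K x ltac:(lra)). fold l in Hsd.
  apply Rle_trans with (1 / (l * x) * (1 + l * x)).
  - apply Rmult_le_compat_r; nra.
  - replace (1 / (l * x) * (1 + l * x)) with (/ (l * x) + 1) by (field; lra).
    assert (/ (l * x) <= / 1) by (apply Rinv_le_contravar; lra). lra.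
Qed.

(** Near the two endpoints the tail is only bounded, elsewhere it is of size
    [1 / K]; one rational expression covers both and has mean [O (ln K / K)]. *)
Lemma sawtooth_bound (K : nat) (x : R) : 0 <= x <= 1 ->
  Rabs (sawtooth_tail K x)
    <= 3 / (1 + (2 * INR K + 3) * x) + 3 / (1 + (2 * INR K + 3) * (1 - x)).
Proof.
  intros [H0 H1]. assert (Hl : 3 <= 2 * INR K + 3) by (pose proof (pos_INR K); lra).
  assert (0 < 3 / (1 + (2 * INR K + 3) * x)) by (apply Rdiv_lt_0_compat; nra).
  assert (0 < 3 / (1 + (2 * INR K + 3) * (1 - x))) by (apply Rdiv_lt_0_compat; nra).
  destruct (Rle_lt_dec x (1 / 2)) as [h|h].
  - assert (Hb := sawtooth_bound_half K x ltac:(lra)). lra.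
  - assert (Hb := sawtooth_bound_half K (1 - x) ltac:(lra)).
    rewrite sawtooth_sym, Rabs_Ropp in Hb. lra.
Qed.

Lemma sawtooth_integral (K : nat) :
  RInt (fun x => Rabs (sawtooth_tail K x)) 0 1
    <= 12 * (ln (1 + (2 * INR K + 3)) / (1 + (2 * INR K + 3))).
Proof.
  set (l := 2 * INR K + 3).
  assert (Hl : 3 <= l) by (unfold l; pose proof (pos_INR K); lra).
  set (g := fun x => 3 / (1 + l * x) + 3 / (1 + l * (1 - x))).
  set (G := fun x => 3 / l * ln (1 + l * x) - 3 / l * ln (1 + l * (1 - x))).
  assert (HG : forall x, 0 <= x <= 1 -> is_derive G x (g x)).
  { intros x Hx. unfold G, g. auto_derive; [repeat split; nra|]. field. repeat split; nra. }
  assert (Hg : forall x, 0 <= x <= 1 -> continuous g x).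
  { intros x Hx. unfold g. auto_continuous. repeat split; nra. }
  apply Rle_trans with (RInt g 0 1).
  - apply RInt_le; [lra| | |].
    + apply ex_RInt_cont; [lra|]. intros x _.
      apply continuous_comp with (g := Rabs); [|apply continuous_Rabs].
      eapply continuous_is_derive, is_derive_sawtooth.
    + apply ex_RInt_cont; [lra|exact Hg].
    + intros x Hx. apply sawtooth_bound; lra.
  - rewrite (RInt_of_derive G g) by (try lra; assumption). unfold G.
    replace (1 + l * 1) with (1 + l) by ring. replace (1 + l * (1 - 1)) with 1 by ring.
    replace (1 + l * 0) with 1 by ring. replace (1 + l * (1 - 0)) with (1 + l) by ring.
    rewrite ln_1.
    assert (0 < ln (1 + l)) by (rewrite <- ln_1; apply ln_increasing; lra).
    replace (3 / l * ln (1 + l) - 3 / l * 0 - (3 / l * 0 - 3 / l * ln (1 + l))) with (ln (1 + l) * (6 / l)) by (field; lra).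
    replace (12 * (ln (1 + l) / (1 + l))) with (ln (1 + l) * (12 / (1 + l))) by (field; lra).
    apply Rmult_le_compat_l; [lra|].
    apply Rmult_le_reg_r with (l * (1 + l)); [nra|].
    replace (6 / l * (l * (1 + l))) with (6 * (1 + l)) by (field; lra).
    replace (12 / (1 + l) * (l * (1 + l))) with (12 * l) by (field; lra). lra.
Qed.

Lemma dirichlet_periodic (K m : nat) (x : R) : dirichlet K (x - INR m) = dirichlet K x.
Proof.
  assert (P : forall k, cos (2 * PI * INR k * (x - INR m)) = cos (2 * PI * INR k * x)).
  { intro k. rewrite <- (cos_period (2 * PI * INR k * (x - INR m)) (k * m)).
    f_equal. rewrite mult_INR. ring. }
  unfold dirichlet. f_equal. f_equal.
  induction K as [|K IH]; [rewrite !sum_O|rewrite !sum_n_S, IH]; rewrite P; reflexivity.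
Qed.

Lemma dirichlet_continuous (K : nat) (x : R) : continuous (dirichlet K) x.
Proof.
  unfold dirichlet. apply (continuous_plus (V:=R_NormedModule)); [apply continuous_const|].
  apply (continuous_scal_r (K:=R_AbsRing) (V:=R_NormedModule) 2).
  eapply continuous_is_derive.
  apply (is_derive_sum_n (fun k x => cos (2 * PI * INR (S k) * x)) K x
    (fun k => (2 * PI * INR (S k)) * - sin (2 * PI * INR (S k) * x))).
  intros k _. set (c := INR (S k)). auto_derive; [exact I|]. ring.
Qed.

Lemma RInt_mult_dirichlet (f : R -> R) (a b : R) (K : nat) : a <= b ->
  (forall x, a <= x <= b -> continuous f x) ->
  RInt (fun x => f x * dirichlet K x) a b
    = RInt f a b + sum_n (fun k => 2 * RInt (fun x => f x * cos (2 * PI * INR (S k) * x)) a b) K.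
Proof.
  intros Hab Hf.
  assert (Hc : forall k, ex_RInt (fun x => f x * cos (2 * PI * INR (S k) * x)) a b).
  { intro k. apply ex_RInt_cont; [exact Hab|]. intros x Hx.
    apply (continuous_mult (K:=R_AbsRing)); [now apply Hf|].
    auto_continuous. exact I. }
  assert (Hc2 : forall k, ex_RInt (fun x => 2 * (f x * cos (2 * PI * INR (S k) * x))) a b).
  { intro k. apply (ex_RInt_scal (V:=R_CompleteNormedModule)), Hc. }
  assert (Hi : is_RInt (fun x => f x * dirichlet K x) a b
    (RInt f a b + sum_n (fun k => 2 * RInt (fun x => f x * cos (2 * PI * INR (S k) * x)) a b) K)).
  { assert (Hf0 : is_RInt f a b (RInt f a b)) by (apply (RInt_correct (V:=R_CompleteNormedModule)), ex_RInt_cont; assumption).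
    assert (Hk : forall k, is_RInt (fun x => 2 * (f x * cos (2 * PI * INR (S k) * x))) a b
       (2 * RInt (fun x => f x * cos (2 * PI * INR (S k) * x)) a b)).
    { intro k. apply (is_RInt_scal (V:=R_NormedModule)).
      apply (RInt_correct (V:=R_CompleteNormedModule)), Hc. }
    unfold dirichlet. induction K as [|K IH].
    - rewrite sum_O. eapply is_RInt_ext; [|apply (is_RInt_plus (V:=R_NormedModule) _ _ _ _ _ _ Hf0 (Hk 0%nat))].
      intros x _. simpl. rewrite sum_O. unfold plus; simpl. ring.
    - rewrite sum_n_S, <- Rplus_assoc.
      eapply is_RInt_ext; [|apply (is_RInt_plus (V:=R_NormedModule) _ _ _ _ _ _ IH (Hk (S K)))].
      intros x _. rewrite sum_n_S. unfold plus; simpl. ring. }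
  apply is_RInt_unique; exact Hi.
Qed.

Lemma is_lim_seq_ln_div : is_lim_seq (fun K => ln (1 + (2 * INR K + 3)) / (1 + (2 * INR K + 3))) 0.
Proof.
  apply (filterlim_comp _ _ _ (fun K => 1 + (2 * INR K + 3)) (fun y => ln y / y) eventually (Rbar_locally p_infty));
  [|exact is_lim_div_ln_p].
  apply (is_lim_seq_le_p_loc INR); [|apply is_lim_seq_INR].
  exists 0%nat. intros n _. pose proof (pos_INR n). lra.
Qed.

(** Integration by parts against [sawtooth_tail], whose mean modulus over a
    period tends to 0. *)
Lemma dirichlet_cell (f f' : R -> R) (m : nat) :
  (forall x, INR m <= x <= INR m + 1 -> is_derive f x (f' x)) ->
  (forall x, INR m <= x <= INR m + 1 -> continuous f' x) ->
  is_lim_seq (fun K => RInt (fun x => f x * dirichlet K x) (INR m) (INR m + 1))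
    ((f (INR m) + f (INR m + 1)) / 2).
Proof.
  intros Hd Hc. set (a := INR m) in *.
  assert (HM : exists M, forall x, a <= x <= a + 1 -> Rabs (f' x) <= M).
  { destruct (continuity_ab_maj (fun x => Rabs (f' x)) a (a + 1)) as [x0 [Hx0 _]]; [lra| |].
    - intros x Hx. apply continuity_pt_filterlim.
      apply continuous_comp with (g := Rabs); [now apply Hc|apply continuous_Rabs].
    - exists (Rabs (f' x0)). exact Hx0. }
  destruct HM as [M HM].
  assert (HM0 : 0 <= M) by (eapply Rle_trans; [apply Rabs_pos|apply (HM a); lra]).
  set (s := fun K x => sawtooth_tail K (x - a)).
  assert (Hs : forall K x, is_derive (s K) x (dirichlet K x)).
  { intros K x. unfold s. rewrite <- (dirichlet_periodic K m x). fold a.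
    evar_last; [apply (is_derive_comp (V:=R_NormedModule) (sawtooth_tail K) (fun x => x - a))|].
    - apply is_derive_sawtooth.
    - auto_derive; [exact I|reflexivity].
    - unfold scal; simpl; unfold mult; simpl. ring. }
  assert (HcA : forall K x, continuous (fun x => Rabs (s K x)) x).
  { intros K x. apply continuous_comp with (g := Rabs); [|apply continuous_Rabs].
    eapply continuous_is_derive, Hs. }
  assert (Hcf : forall K x, a <= x <= a + 1 -> continuous (fun x => f' x * s K x) x).
  { intros K x Hx. apply (continuous_mult (K:=R_AbsRing)); [now apply Hc|]. eapply continuous_is_derive, Hs. }
  assert (Habs : forall K, RInt (fun x => Rabs (s K x)) a (a + 1) = RInt (fun x => Rabs (sawtooth_tail K x)) 0 1).
  { intro K.
    assert (H := RInt_comp_lin (V:=R_CompleteNormedModule) (fun x => Rabs (sawtooth_tail K x)) 1 (- a) a (a + 1)).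
    replace (1 * a + - a) with 0 in H by ring. replace (1 * (a + 1) + - a) with 1 in H by ring.
    rewrite <- H.
    - apply RInt_ext. intros x _. unfold s, scal; simpl; unfold mult; simpl.
      replace (1 * x + - a) with (x - a) by ring. ring.
    - apply ex_RInt_cont; [lra|]. intros x _.
      apply continuous_comp with (g := Rabs); [|apply continuous_Rabs].
      eapply continuous_is_derive, is_derive_sawtooth. }
  assert (Hpart : forall K, RInt (fun x => f x * dirichlet K x) a (a + 1)
     = (f a + f (a + 1)) / 2 - RInt (fun x => f' x * s K x) a (a + 1)).
  { intro K.
    assert (C1 := Hcf K).
    assert (C2 : forall x, a <= x <= a + 1 -> continuous (fun x => f x * dirichlet K x) x).
    { intros x Hx. apply (continuous_mult (K:=R_AbsRing)); [|apply dirichlet_continuous].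
      eapply continuous_is_derive, Hd, Hx. }
    assert (E := RInt_of_derive (fun x => f x * s K x) (fun x => f' x * s K x + f x * dirichlet K x) a (a + 1) ltac:(lra)).
    rewrite (RInt_plus (V:=R_CompleteNormedModule)) in E; [|apply ex_RInt_cont; [lra|assumption]|apply ex_RInt_cont; [lra|assumption]].
    unfold plus in E; simpl in E. 
    assert (E1 : s K a = - (1 / 2)) by (unfold s; replace (a - a) with 0 by ring; apply sawtooth_0).
    assert (E2 : s K (a + 1) = 1 / 2).
    { unfold s; replace (a + 1 - a) with (1 - 0) by ring. rewrite sawtooth_sym, sawtooth_0. lra. }
    rewrite E1, E2 in E.
    assert (E' : RInt (fun x => f' x * s K x) a (a + 1) + RInt (fun x => f x * dirichlet K x) a (a + 1) =
      f (a + 1) * (1 / 2) - f a * - (1 / 2)).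
    { apply E.
      - intros x Hx. apply (is_derive_mult (K:=R_AbsRing)); [now apply Hd|apply Hs|apply Rmult_comm].
      - intros x Hx. apply (continuous_plus (V:=R_NormedModule)); [apply C1|apply C2]; exact Hx. }
    lra. }
  eapply is_lim_seq_ext; [intro K; symmetry; apply Hpart|].
  evar_last; [apply is_lim_seq_minus'; [apply is_lim_seq_const|]|apply f_equal, Rminus_0_r].
  apply is_lim_seq_abs_0.
  apply (is_lim_seq_le_le (fun _ => 0) _ (fun K => M * 12 * (ln (1 + (2 * INR K + 3)) / (1 + (2 * INR K + 3))))).
  - intro K. split; [apply Rabs_pos|].
    eapply Rle_trans.
    { apply abs_RInt_le; [lra|]. apply ex_RInt_cont; [lra|apply Hcf]. }
    apply Rle_trans with (RInt (fun x => M * Rabs (s K x)) a (a + 1)).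
    + apply RInt_le; [lra| | |].
      * apply ex_RInt_cont; [lra|]. intros x Hx.
        apply continuous_comp with (g := Rabs); [|apply continuous_Rabs].
        now apply Hcf.
      * apply ex_RInt_cont; [lra|]. intros x Hx.
        apply (continuous_scal_r (K:=R_AbsRing) (V:=R_NormedModule) M), HcA.
      * intros x Hx. rewrite Rabs_mult. apply Rmult_le_compat_r; [apply Rabs_pos|]. apply HM; lra.
    + rewrite (RInt_scal (V:=R_CompleteNormedModule) (fun x => Rabs (s K x))).
      * rewrite Habs. unfold scal; simpl; unfold mult; simpl. rewrite Rmult_assoc.
        apply Rmult_le_compat_l; [exact HM0|]. apply sawtooth_integral.
      * apply ex_RInt_cont; [lra|]. intros x Hx.
        apply HcA.
  - apply is_lim_seq_const.
  - evar_last; [apply (is_lim_seq_scal_l _ (M * 12) 0), is_lim_seq_ln_div|]. simpl. f_equal. ring.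
Qed.

(** * Fourier expansion of the Stieltjes constants *)

Lemma logpow_continuous_deriv (n : nat) (x : R) : 0 < x ->
  continuous (fun t => (INR n * ln t ^ pred n - ln t ^ n) / t ^ 2) x.
Proof.
  intro Hx. auto_continuous.
  repeat split; try lra. apply Rgt_not_eq. nra.
Qed.

Lemma logpow_continuous (n : nat) (x : R) : 0 < x -> continuous (logpow n) x.
Proof. intro Hx. eapply continuous_is_derive, is_derive_logpow, Hx. Qed.

Lemma RInt_logpow (n N : nat) :
  RInt (logpow n) 1 (INR (S N)) = ln (INR (S N)) ^ S n / INR (S n).
Proof.
  assert (HN := INR_S_ge_1 N).
  assert (Hn := INR_S_pos n).
  rewrite (RInt_of_derive (fun t => ln t ^ S n / INR (S n)) (logpow n)).
  - rewrite ln_1. simpl (0 ^ S n). change_R. unfold Rdiv. ring.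
  - exact HN.
  - intros z Hz. apply is_derive_logpow_primitive; lra.
  - intros z Hz. apply logpow_continuous. lra.
Qed.

(** Summing over the cells, interior integers collect one half from each side,
    while the two ends are counted once. *)
Lemma stieltjes_sum_fourier (n N : nat) :
  is_lim_seq (fun K => sum_n (fun k => 2 * RInt (fun x => logpow n x * cos (2 * PI * INR (S k) * x)) 1 (INR (S N))) K)
    (stieltjes_sum n N - (logpow n 1 + logpow n (INR (S N))) / 2).
Proof.
  assert (HN := INR_S_ge_1 N).
  assert (Hdc : forall K x, 0 < x -> continuous (fun x => logpow n x * dirichlet K x) x).
  { intros K x Hx. apply (continuous_mult (K:=R_AbsRing)); [now apply logpow_continuous|apply dirichlet_continuous]. }
  assert (H : is_lim_seq (fun K => RInt (fun x => logpow n x * dirichlet K x) 1 (INR (S N)))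
     (sum_n (fun m => logpow n (INR (S m))) N - (logpow n 1 + logpow n (INR (S N))) / 2)).
  { clear HN. induction N as [|N IH].
    - rewrite sum_O. simpl INR. replace (logpow n 1 - (logpow n 1 + logpow n 1) / 2) with 0 by field.
      eapply is_lim_seq_ext; [|apply is_lim_seq_const].
      intro K. symmetry. apply (RInt_point (V:=R_CompleteNormedModule)).
    - assert (Hp := INR_S_ge_1 N).
      assert (Hcell := dirichlet_cell (logpow n) _ (S N)
        (fun x Hx => is_derive_logpow n x (Rlt_le_trans 0 1 x Rlt_0_1 (Rle_trans _ _ _ Hp (proj1 Hx))))
        (fun x Hx => logpow_continuous_deriv n x (Rlt_le_trans 0 1 x Rlt_0_1 (Rle_trans _ _ _ Hp (proj1 Hx))))).
      rewrite <- (S_INR (S N)) in Hcell.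
      assert (Hs := is_lim_seq_plus' _ _ _ _ IH Hcell).
      rewrite sum_n_S.
      evar_last; [eapply is_lim_seq_ext; [|exact Hs]|].
      + intro K. assert (Hq : INR (S N) <= INR (S (S N))) by (rewrite (S_INR (S N)); lra).
        cbv beta.
        refine (RInt_split (fun x => logpow n x * dirichlet K x) 1 (INR (S N)) (INR (S (S N))) Hp Hq _).
        intros x Hx; apply Hdc; lra.
      + f_equal. field. }
  assert (E : forall K, RInt (fun x => logpow n x * dirichlet K x) 1 (INR (S N)) - RInt (logpow n) 1 (INR (S N))
    = sum_n (fun k => 2 * RInt (fun x => logpow n x * cos (2 * PI * INR (S k) * x)) 1 (INR (S N))) K).
  { intro K. rewrite RInt_mult_dirichlet; [ring|exact HN|]. intros x Hx. apply logpow_continuous; lra. }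
  eapply is_lim_seq_ext; [exact E|].
  unfold stieltjes_sum. rewrite <- RInt_logpow.
  evar_last; [apply is_lim_seq_minus'; [exact H|apply is_lim_seq_const]|]. f_equal. ring.
Qed.

Lemma RInt_logpow_cos (n N : nat) (c : R) :
  RInt (fun x => logpow n x * cos (c * x)) 1 (INR (S N))
    = RInt (fun t => t ^ n * cos (c * exp t)) 0 (ln (INR (S N))).
Proof.
  assert (HN := INR_S_ge_1 N).
  assert (HL : 0 <= ln (INR (S N))) by (apply ln_ge_0; lra).
  assert (H := RInt_comp (V:=R_CompleteNormedModule) (fun x => logpow n x * cos (c * x)) exp exp 0 (ln (INR (S N)))).
  rewrite exp_0, exp_ln in H by lra. rewrite <- H.
  - apply RInt_ext. intros t _. unfold logpow. rewrite ln_exp.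
    unfold scal; simpl; unfold mult; simpl. field. apply Rgt_not_eq, exp_pos.
  - intros x Hx. apply (continuous_mult (K:=R_AbsRing)).
    + apply logpow_continuous, exp_pos.
    + auto_continuous. exact I.
  - intros x Hx. split; [apply is_derive_exp|]. apply continuous_is_derive with (l := exp x), is_derive_exp.
Qed.

Lemma logpow_vanishes (n : nat) : is_lim_seq (fun N => logpow n (INR (S N))) 0.
Proof.
  apply (is_lim_seq_le_le (fun _ => 0) _ (fun N => INR (fact n) * 2 ^ n * exp (- (1 / 2) * ln (INR (S N))))).
  - intro N.
    assert (HN := INR_S_ge_1 N).
    assert (HL : 0 <= ln (INR (S N))) by (apply ln_ge_0; lra).
    unfold logpow, Rdiv. set (M := INR (S N)) in *. split.
    + apply Rmult_le_pos; [now apply pow_le|]. apply Rlt_le, Rinv_0_lt_compat; lra.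
    + replace (exp (- (1 * / 2) * ln M)) with (sqrt M * / M).
      * rewrite <- Rmult_assoc. apply Rmult_le_compat_r; [apply Rlt_le, Rinv_0_lt_compat; lra|]. now apply ln_pow_le.
      * rewrite <- Rpower_sqrt by lra. unfold Rpower.
        replace (/ M) with (exp (- ln M)) by (rewrite exp_Ropp, exp_ln; lra).
        rewrite <- exp_plus. f_equal. field.
  - apply is_lim_seq_const.
  - evar_last; [apply (is_lim_seq_scal_l _ (INR (fact n) * 2 ^ n) 0), is_lim_seq_exp_ln; lra|].
    simpl. f_equal. ring.
Qed.

(** The form in which the Fourier expansion is used: an approximation of the
    truncated cosine integrals that is uniform in the number of harmonics is an
    approximation of the Stieltjes constant. *)
Lemma stieltjes_fourier_approx (n : nat) (g Main E : R) (rho : nat -> R) :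
  (0 < n)%nat -> is_lim_seq (stieltjes_sum n) g -> is_lim_seq rho 0 ->
  (exists N0, forall N K, (N0 <= N)%nat ->
    Rabs (sum_n (fun k => 2 * RInt (fun t => t ^ n * cos (2 * PI * INR (S k) * exp t)) 0 (ln (INR (S N)))) K - Main)
      <= E + rho N) ->
  Rabs (g - Main) <= E.
Proof.
  intros Hn Hg Hrho [N0 H].
  assert (H1 : forall N, (N0 <= N)%nat ->
     Rabs (stieltjes_sum n N - (logpow n 1 + logpow n (INR (S N))) / 2 - Main) <= E + rho N).
  { intros N HN.
    assert (Hl := is_lim_seq_abs _ _ (is_lim_seq_minus' _ _ _ _ (stieltjes_sum_fourier n N) (is_lim_seq_const Main))).
    refine (is_lim_seq_le _ (fun _ => E + rho N) _ (E + rho N) _ Hl (is_lim_seq_const _)).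
    intro K. eapply Rle_trans; [|apply (H N K HN)]. right. cbv beta. f_equal. f_equal.
    apply sum_n_ext. intro k. now rewrite RInt_logpow_cos. }
  assert (E0 : logpow n 1 = 0).
  { unfold logpow. rewrite ln_1. destruct n; [lia|]. simpl. field. }
  assert (Hl : is_lim_seq (fun N => Rabs (stieltjes_sum n N - (logpow n 1 + logpow n (INR (S N))) / 2 - Main)) (Rabs (g - Main))).
  { apply (is_lim_seq_abs _ (g - Main)).
    apply is_lim_seq_minus'; [|apply is_lim_seq_const].
    replace g with (g - (0 + 0) * / 2) by field. rewrite E0.
    apply is_lim_seq_minus'; [exact Hg|].
    apply (is_lim_seq_scal_r _ (/ 2) (0 + 0)).
    apply is_lim_seq_plus'; [apply is_lim_seq_const|apply logpow_vanishes]. }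
  apply (is_lim_seq_le_loc
    (fun N => Rabs (stieltjes_sum n N - (logpow n 1 + logpow n (INR (S N))) / 2 - Main))
    (fun N => E + rho N) (Rabs (g - Main)) E).
  - exists N0. exact H1.
  - exact Hl.
  - replace (Finite E) with (Finite (E + 0)) by (f_equal; ring).
    apply is_lim_seq_plus'; [apply is_lim_seq_const|exact Hrho].
Qed.

(** * Moving the path of integration *)

(** Cauchy's theorem on a rectangle: the integral over a horizontal side,
    as a function of the height, has a derivative that integrates to the
    difference of the values on the vertical sides. *)
Lemma Cauchy_rectangle (F F' : R -> R -> C) (X Y : R) : 0 <= X -> 0 <= Y ->
  (forall x y, Cderiv (fun s => F s y) x (F' x y)) ->
  (forall x y, Cderiv (fun s => F x s) y (Ci * F' x y)%C) ->
  (forall x y, cont2 (fun b a => F' a b) y x) ->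
  RInt (fun x => Re (F x 0)) 0 X
    = RInt (fun x => Re (F x Y)) 0 X
      + RInt (fun y => Im (F X y)) 0 Y - RInt (fun y => Im (F 0 y)) 0 Y.
Proof.
  intros HX HY Hx Hy Hc.
  assert (Hcx : forall y x, continuous (fun s => Re (F s y)) x) by (intros y x; apply (Cderiv_cont _ _ _ (Hx x y))).
  assert (HcxI : forall x y, continuous (fun s => Im (F x s)) y) by (intros x y; apply (Cderiv_cont _ _ _ (Hy x y))).
  assert (Hci : forall x y, continuous (fun s => - Im (F' s y)) x).
  { intros x y. apply continuity_pt_filterlim. apply continuity_pt_opp.
    apply continuity_pt_filterlim.
    destruct (Hc x y) as [_ H]. apply continuity_2d_pt_filterlim in H.
    apply (filterlim_comp _ _ _ (fun s => (y, s)) (fun p => Im (F' (snd p) (fst p))) (locally x) (locally (y, x))); [|exact H].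
    intros P [eps HP]. exists eps. intros s Hs. apply HP. split; [apply ball_center|exact Hs]. }
  assert (Hd : forall y, is_derive (fun y => RInt (fun x => Re (F x y)) 0 X) y
             (RInt (fun x => - Im (F' x y)) 0 X)).
  { apply (is_derive_RInt_2d (fun y x => Re (F x y)) (fun y x => - Im (F' x y)) 0 X HX).
    - intros y x. assert (H := proj1 (Hy x y)). evar_last; [exact H|]. simpl. unfold Im. ring.
    - intros y x. apply continuity_2d_pt_opp. apply (Hc x y).
    - intros y x. apply Hcx. }
  assert (E1 : forall y, RInt (fun x => - Im (F' x y)) 0 X = Im (F 0 y) - Im (F X y)).
  { intro y. replace (Im (F 0 y) - Im (F X y)) with ((- Im (F X y)) - (- Im (F 0 y))) by ring.
    apply (RInt_of_derive (fun x => - Im (F x y)) _ 0 X HX).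
    - intros x _. apply (is_derive_opp (V:=R_NormedModule)). apply (Hx x y).
    - intros x _. apply Hci. }
  assert (E2 := RInt_of_derive (fun y => RInt (fun x => Re (F x y)) 0 X) (fun y => Im (F 0 y) - Im (F X y)) 0 Y HY).
  rewrite (RInt_minus (V:=R_CompleteNormedModule) (fun y => Im (F 0 y)) (fun y => Im (F X y))) in E2
    by (apply ex_RInt_cont; [exact HY|intros; apply HcxI]).
  unfold minus, plus, opp in E2; simpl in E2.
  assert (E3 : RInt (fun y => Im (F 0 y)) 0 Y + - RInt (fun y => Im (F X y)) 0 Y =
     RInt (fun x => Re (F x Y)) 0 X - RInt (fun x => Re (F x 0)) 0 X).
  { apply E2.
    - intros y _. rewrite <- E1. apply Hd.
    - intros y _. apply (continuous_minus (V:=R_NormedModule)); apply HcxI. }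
  lra.
Qed.

(** [t^n exp (i c e^t)]; with [c = 2 PI k] its integral over the positive
    half-line carries the k-th harmonic. *)
Definition harmonic (n : nat) (c : R) (t : C) : C :=
  (t ^ n * Cexp (Ci * RtoC c * Cexp t))%C.

Definition harmonic' (n : nat) (c : R) (t : C) : C :=
  ((RtoC (INR n) * t ^ pred n + t ^ n * (Ci * RtoC c * Cexp t)) * Cexp (Ci * RtoC c * Cexp t))%C.

Lemma Cderiv_harmonic n c (g : R -> C) x l : Cderiv g x l ->
  Cderiv (fun s => harmonic n c (g s)) x (l * harmonic' n c (g x))%C.
Proof.
  intro H. unfold harmonic, harmonic'. eapply Cderiv_eq.
  - apply Cderiv_mult; [apply Cderiv_pow; exact H|].
    apply Cderiv_exp. apply Cderiv_scal. apply Cderiv_exp. exact H.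
  - cbv beta. ring.
Qed.

Lemma Cderiv_horizontal x y : Cderiv (fun s => (s, y) : C) x (RtoC 1).
Proof. split; simpl; auto_derive; trivial. Qed.

Lemma Cderiv_vertical x y : Cderiv (fun s => (x, s) : C) y Ci.
Proof. split; simpl; auto_derive; trivial. Qed.

Lemma cont2_harmonic' n c x y : cont2 (fun b a => harmonic' n c (a, b)) y x.
Proof.
  unfold harmonic'. apply cont2_mult; [apply cont2_plus|].
  - apply cont2_mult; [apply cont2_const|apply cont2_pow, cont2_y_x].
  - apply cont2_mult; [apply cont2_pow, cont2_y_x|].
    apply cont2_mult; [apply cont2_const|apply cont2_exp, cont2_y_x].
  - apply cont2_exp. apply cont2_mult; [apply cont2_const|apply cont2_exp, cont2_y_x].
Qed.

Lemma Cpow_real (x : R) (n : nat) : (((x, 0) : C) ^ n)%C = RtoC (x ^ n).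
Proof. change ((x, 0) : C) with (RtoC x). now rewrite <- RtoC_pow. Qed.

Lemma Re_harmonic_real n c x : Re (harmonic n c (x, 0)) = x ^ n * cos (c * exp x).
Proof.
  unfold harmonic. rewrite Cpow_real. unfold Cexp; simpl. rewrite cos_0, sin_0.
  replace ((0 * c - 1 * 0) * (exp x * 1) - (0 * 0 + 1 * c) * (exp x * 0)) with 0 by ring.
  rewrite exp_0. replace ((0 * c - 1 * 0) * (exp x * 0) + (0 * 0 + 1 * c) * (exp x * 1)) with (c * exp x) by ring.
  ring.
Qed.

Lemma harmonic_polar n c x y :
  harmonic n c (x, y) = (((x, y) : C) ^ n
     * (RtoC (exp (- (c * exp x * sin y))) * (cos (c * exp x * cos y), sin (c * exp x * cos y)))%C)%C.
Proof.
  unfold harmonic. f_equal. unfold Cexp; apply Ceq; simpl;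
  replace ((0 * c - 1 * 0) * (exp x * cos y) - (0 * 0 + 1 * c) * (exp x * sin y)) with (- (c * exp x * sin y)) by ring;
  replace ((0 * c - 1 * 0) * (exp x * sin y) + (0 * 0 + 1 * c) * (exp x * cos y)) with (c * exp x * cos y) by ring; ring.
Qed.

Lemma Cmod_unit a : Cmod (cos a, sin a) = 1.
Proof.
  unfold Cmod; simpl. replace (_ + _) with (Rsqr (sin a) + Rsqr (cos a)) by (unfold Rsqr; ring).
  rewrite sin2_cos2. apply sqrt_1.
Qed.

Lemma Cmod_harmonic n c x y :
  Cmod (harmonic n c (x, y)) = Cmod (x, y) ^ n * exp (- (c * exp x * sin y)).
Proof.
  rewrite harmonic_polar, !Cmod_mult, Cmod_unit, Cmod_R, Rabs_right, Cmod_pow; [ring|].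
  apply Rle_ge, Rlt_le, exp_pos.
Qed.

Lemma shift_harmonic n c X Y : 0 <= X -> 0 <= Y ->
  RInt (fun t => t ^ n * cos (c * exp t)) 0 X
    = RInt (fun x => Re (harmonic n c (x, Y))) 0 X
      + RInt (fun y => Im (harmonic n c (X, y))) 0 Y - RInt (fun y => Im (harmonic n c (0, y))) 0 Y.
Proof.
  intros HX HY.
  rewrite <- (Cauchy_rectangle (fun x y => harmonic n c (x, y)) (fun x y => harmonic' n c (x, y)) X Y HX HY).
  - apply RInt_ext. intros x _. now rewrite Re_harmonic_real.
  - intros x y. eapply Cderiv_eq; [apply (Cderiv_harmonic n c (fun s => (s, y)) x _ (Cderiv_horizontal x y))|]. ring.
  - intros x y. apply (Cderiv_harmonic n c (fun s => (x, s)) y _ (Cderiv_vertical x y)).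
  - intros x y. apply cont2_harmonic'.
Qed.

(** * The vertical sides *)

Lemma exp_ge_sqr (z : R) : 0 <= z -> z ^ 2 * exp (- z) <= 2.
Proof.
  intro Hz. assert (H := pow_le_fact_exp z 2 Hz). simpl INR in H. simpl fact in H.
  rewrite exp_Ropp. pose proof (exp_pos z).
  apply Rmult_le_reg_r with (exp z); [lra|]. rewrite Rmult_assoc, Rinv_l by lra.
  simpl INR in H. lra.
Qed.

Lemma continuous_Im_vertical n c x y : continuous (fun s => Im (harmonic n c (x, s))) y.
Proof. apply (Cderiv_cont _ _ _ (Cderiv_harmonic n c (fun s => (x, s)) y _ (Cderiv_vertical x y))). Qed.

Lemma continuous_Re_horizontal n c x y : continuous (fun s => Re (harmonic n c (s, y))) x.
Proof. apply (Cderiv_cont _ _ _ (Cderiv_harmonic n c (fun s => (s, y)) x _ (Cderiv_horizontal x y))). Qed.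

(** The frequency [2 PI k] is at least [6 k], and [sin y >= y / 3]. *)
Lemma frequency_sin k y : 0 <= y <= PI / 2 -> 2 * INR (S k) * y <= 2 * PI * INR (S k) * sin y.
Proof.
  intro Hy. assert (H := sin_ge_third y Hy). pose proof PI_gt_3. pose proof (INR_S_pos k).
  apply Rle_trans with (2 * 3 * INR (S k) * (y / 3)); [lra|].
  apply Rmult_le_compat; nra.
Qed.

(** Two of the factors of [y^n] compensate the slow decay in [y] and make the
    bound summable over the harmonics. *)
Lemma left_side n k v : (2 <= n)%nat -> 0 <= v <= PI / 2 ->
  Rabs (RInt (fun y => Im (harmonic n (2 * PI * INR (S k)) (0, y))) 0 v) <= 2 ^ n / 4 / INR (S k) ^ 2.
Proof.
  intros Hn Hv. pose proof PI_4. pose proof (INR_S_pos k) as Hk.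
  assert (H2 : 0 < 2 ^ (n - 2)) by (apply pow_lt; lra).
  assert (H2n : 2 ^ n = 4 * 2 ^ (n - 2)) by (replace n with (2 + (n - 2))%nat at 1 by lia; rewrite pow_add; simpl; ring).
  eapply Rle_trans; [apply (abs_RInt_bound _ 0 v (2 ^ (n - 2) / (2 * INR (S k) ^ 2))); [lra| |]|].
  - intros; apply continuous_Im_vertical.
  - intros y Hy. eapply Rle_trans; [apply im_le_Cmod|]. rewrite Cmod_harmonic.
    assert (Hfs := frequency_sin k y ltac:(lra)).
    rewrite exp_0, Rmult_1_r.
    replace (Cmod (0, y)) with y.
    2: { unfold Cmod; simpl. replace (0 * (0 * 1) + y * (y * 1)) with (Rsqr y) by (unfold Rsqr; ring). rewrite sqrt_Rsqr; lra. }
    replace n with (2 + (n - 2))%nat at 1 by lia. rewrite pow_add.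
    assert (Hp : y ^ (n - 2) <= 2 ^ (n - 2)) by (apply pow_incr; lra).
    assert (Hp0 : 0 <= y ^ (n - 2)) by (apply pow_le; lra).
    assert (He : exp (- (2 * PI * INR (S k) * sin y)) <= exp (- (2 * INR (S k) * y))) by (apply exp_mono; lra).
    assert (Hz := exp_ge_sqr (2 * INR (S k) * y) ltac:(nra)).
    assert (Hz' : y ^ 2 * exp (- (2 * INR (S k) * y)) <= 1 / (2 * INR (S k) ^ 2)).
    { apply Rmult_le_reg_l with (4 * INR (S k) ^ 2); [nra|].
      replace (4 * INR (S k) ^ 2 * (1 / (2 * INR (S k) ^ 2))) with 2 by (field; lra).
      eapply Rle_trans; [|exact Hz]. right. ring. }
    pose proof (exp_pos (- (2 * PI * INR (S k) * sin y))). 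
    pose proof (pow2_ge_0 y).
    apply Rle_trans with (2 ^ (n - 2) * (1 / (2 * INR (S k) ^ 2))).
    + replace (y ^ 2 * y ^ (n - 2) * exp (- (2 * PI * INR (S k) * sin y)))
        with (y ^ (n - 2) * (y ^ 2 * exp (- (2 * PI * INR (S k) * sin y)))) by ring.
      apply Rmult_le_compat; [exact Hp0| |exact Hp|].
      * apply Rmult_le_pos; lra.
      * eapply Rle_trans; [|exact Hz']. apply Rmult_le_compat_l; lra.
    + right; field; lra.
  - rewrite H2n, Rminus_0_r.
    replace (4 * 2 ^ (n - 2) / 4 / INR (S k) ^ 2) with (2 * (2 ^ (n - 2) / (2 * INR (S k) ^ 2))) by (field; lra).
    apply Rmult_le_compat_r; [|lra]. apply Rlt_le, Rdiv_lt_0_compat; nra.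
Qed.

Lemma Cpow_imag_bound (X y : R) (n : nat) : 0 <= X -> 0 <= y <= 2 ->
  Rabs (Re (((X, y) : C) ^ n)%C) <= (X + 2) ^ n /\ Rabs (Im (((X, y) : C) ^ n)%C) <= INR n * y * (X + 2) ^ n.
Proof.
  intros HX Hy.
  assert (Hm : Cmod (X, y) <= X + 2).
  { eapply Rle_trans; [apply Cmod_le_Re_Im|]. simpl. rewrite !Rabs_right by lra. lra. }
  split.
  - eapply Rle_trans; [apply re_le_Cmod|]. rewrite Cmod_pow. apply pow_incr. split; [apply Cmod_ge_0|exact Hm].
  - assert (HR : forall k, Rabs (Re (((X, y) : C) ^ k)%C) <= (X + 2) ^ k).
    { intro k. eapply Rle_trans; [apply re_le_Cmod|]. rewrite Cmod_pow. apply pow_incr. split; [apply Cmod_ge_0|exact Hm]. }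
    induction n as [|n IH]; [simpl; rewrite Rabs_R0; lra|].
    rewrite S_INR. change (((X, y) : C) ^ S n)%C with ((X, y) * ((X, y) : C) ^ n)%C.
    rewrite im_mult. simpl Re. simpl Im. simpl ((X + 2) ^ S n).
    eapply Rle_trans; [apply Rabs_triang|]. rewrite !Rabs_mult, (Rabs_right X), (Rabs_right y) by lra.
    specialize (HR n). pose proof (pos_INR n). assert (0 < (X + 2) ^ n) by (apply pow_lt; lra).
    set (P := (X + 2) ^ n) in *. unfold Re, Im in *.
    apply Rle_trans with (X * (INR n * y * P) + y * P); [apply Rplus_le_compat; apply Rmult_le_compat_l; lra|].
    assert (0 <= INR n * y * P) by (repeat apply Rmult_le_pos; lra).
    assert (0 <= y * P) by (apply Rmult_le_pos; lra). nra.
Qed.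

Lemma RInt_y_exp (b v : R) : 0 < b -> 0 <= v -> RInt (fun y => y * exp (- (b * y))) 0 v <= / b ^ 2.
Proof.
  intros Hb Hv.
  rewrite (RInt_of_derive (fun y => - (y / b + / b ^ 2) * exp (- (b * y)))); [|exact Hv| |].
  - rewrite Rmult_0_r, Ropp_0, exp_0.
    assert (0 < / b ^ 2) by (apply Rinv_0_lt_compat, pow_lt; exact Hb).
    assert (0 <= v / b) by (apply Rmult_le_pos; [lra|apply Rlt_le, Rinv_0_lt_compat, Hb]).
    pose proof (exp_pos (- (b * v))).
    assert (0 <= (v / b + / b ^ 2) * exp (- (b * v))) by (apply Rmult_le_pos; lra).
    unfold Rdiv at 2. lra.
  - intros y _. auto_derive; [exact I|]. field. lra.
  - intros y _. auto_continuous. exact I.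
Qed.

(** The upper end of the path is the logarithm of an integer, so that the
    harmonic is real there and its imaginary part starts with a multiple of [y].
    This yields [O (1 / k^2)] instead of [O (1 / k)] after integration, hence a
    bound uniform in the number of harmonics. *)
Lemma right_side n k v N : 0 <= v <= PI / 2 ->
  Rabs (RInt (fun y => Im (harmonic n (2 * PI * INR (S k)) (ln (INR (S N)), y))) 0 v)
    <= (ln (INR (S N)) + 2) ^ n * (INR n + 4) / INR (S N) ^ 2 / INR (S k) ^ 2.
Proof.
  intros Hv. pose proof PI_4. pose proof (INR_S_pos k) as Hk.
  assert (HN := INR_S_ge_1 N).
  assert (HX : 0 <= ln (INR (S N))) by (apply ln_ge_0; lra).
  assert (HeX : exp (ln (INR (S N))) = INR (S N)) by (apply exp_ln; lra).
  (* 2 PI times an integer is a period, so the phase counts from [cos y = 1] *)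
  assert (Hper : forall y, sin (2 * PI * INR (S k) * INR (S N) * cos y)
     = - sin (2 * PI * INR (S k) * INR (S N) * (1 - cos y))).
  { intro y. rewrite <- sin_neg.
    rewrite <- (sin_period (- (2 * PI * INR (S k) * INR (S N) * (1 - cos y))) (S k * S N)).
    rewrite mult_INR. f_equal. ring. }
  set (M := INR (S N)) in *. set (X := ln M) in *. set (kap := INR (S k)) in *.
  set (R0 := (X + 2) ^ n).
  assert (HR0 : 0 < R0) by (apply pow_lt; lra).
  pose proof (pos_INR n) as Hn0.
  set (g := fun y => R0 * (INR n + 4) * (y * exp (- (kap * M * y)))).
  assert (Hg : forall y, continuous g y).
  { intro y. unfold g. auto_continuous. exact I. }
  eapply Rle_trans; [apply (abs_RInt_le_RInt _ g 0 v); [lra| | |]|].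
  - intros; apply continuous_Im_vertical.
  - intros; apply Hg.
  - intros y Hy. rewrite harmonic_polar, HeX.
    destruct (Cpow_imag_bound X y n HX ltac:(lra)) as [HRe HIm]. fold R0 in HRe, HIm.
    assert (Hfs := frequency_sin k y ltac:(lra)). fold kap in Hfs.
    set (P := (((X, y) : C) ^ n)%C) in *.
    set (q := 2 * PI * kap * M) in *.
    assert (Hq : 0 <= q <= 8 * (kap * M)).
    { unfold q. pose proof PI_RGT_0. split; [assert (0 < kap * M) by nra; replace (2 * PI * kap * M) with (2 * PI * (kap * M)) by ring; nra|].
      replace (8 * (kap * M)) with (2 * 4 * kap * M) by ring.
      repeat (apply Rmult_le_compat_r; [lra|]). lra. }
    assert (Hs : Rabs (sin (q * cos y)) <= 4 * (kap * M) * y ^ 2).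
    { unfold q. rewrite Hper. fold q. rewrite Rabs_Ropp.
      assert (Hc : 0 <= 1 - cos y <= y ^ 2 / 2).
      { pose proof (COS_bound y). split; [lra|].
        destruct (COS y) as [Hcl _]; [lra|lra|].
        unfold cos_lb, cos_approx, cos_term in Hcl. simpl in Hcl.
        assert (y ^ 2 <= 4) by nra.
        assert (0 <= y ^ 4 / 24 * (1 - y ^ 2 / 30)).
        { apply Rmult_le_pos; [|lra]. assert (0 <= y ^ 4) by (apply pow_le; lra). lra. }
        simpl in *. lra. }
      assert (Hq1 : 0 <= q * (1 - cos y)) by (apply Rmult_le_pos; lra).
      assert (Hsq : Rabs (sin (q * (1 - cos y))) <= q * (1 - cos y)).
      { destruct (Req_dec (q * (1 - cos y)) 0) as [e|ne]; [rewrite e, sin_0, Rabs_R0; lra|].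
        assert (Hab : forall z, 0 < z -> Rabs (sin z) <= z).
        { intros z Hz. apply Rabs_le. split; [|apply Rlt_le, sin_lt_x; exact Hz].
          destruct (Rle_lt_dec z PI) as [h|h].
          - pose proof (sin_ge_0 z ltac:(lra) h). lra.
          - pose proof (SIN_bound z). pose proof PI_gt_3. lra. }
        apply Hab. lra. }
      eapply Rle_trans; [exact Hsq|].
      replace (4 * (kap * M) * y ^ 2) with (8 * (kap * M) * (y ^ 2 / 2)) by field.
      apply Rmult_le_compat; lra. }
    assert (Hexp : exp (- (q * sin y)) <= exp (- (2 * (kap * M) * y))).
    { apply exp_mono. unfold q. nra. }
    rewrite im_mult. unfold Re at 1. 
    replace (2 * PI * kap * exp X * sin y) with (q * sin y) by (unfold q; rewrite HeX; ring).
    set (e := exp (- (q * sin y))) in *.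
    assert (He : 0 < e) by apply exp_pos.
    change (fst P) with (Re P).
    assert (Er : Re (RtoC e * (cos (q * cos y), sin (q * cos y)))%C = e * cos (q * cos y)) by (simpl; ring).
    assert (Ei : Im (RtoC e * (cos (q * cos y), sin (q * cos y)))%C = e * sin (q * cos y)) by (simpl; ring).
    rewrite Er, Ei.
    eapply Rle_trans; [apply Rabs_triang|]. rewrite !Rabs_mult, (Rabs_right e) by lra.
    assert (Hcb : Rabs (cos (q * cos y)) <= 1) by (pose proof (COS_bound (q * cos y)); apply Rabs_le; lra).
    set (b := kap * M) in *. assert (Hb : 0 < b) by (unfold b; apply Rmult_lt_0_compat; lra).
    apply Rle_trans with (e * (R0 * (4 * b * y ^ 2) + INR n * y * R0 * 1)).
    { rewrite Rmult_plus_distr_l. apply Rplus_le_compat.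
      - replace (Rabs (Re P) * (e * Rabs (sin (q * cos y)))) with (e * (Rabs (Re P) * Rabs (sin (q * cos y)))) by ring.
        apply Rmult_le_compat_l; [lra|]. apply Rmult_le_compat; try apply Rabs_pos; assumption.
      - replace (Rabs (Im P) * (e * Rabs (cos (q * cos y)))) with (e * (Rabs (Im P) * Rabs (cos (q * cos y)))) by ring.
        apply Rmult_le_compat_l; [lra|]. apply Rmult_le_compat; try apply Rabs_pos; assumption. }
    unfold g. fold b.
    assert (Hsplit : exp (- (2 * b * y)) = exp (- (b * y)) * exp (- (b * y))) by (rewrite <- exp_plus; f_equal; ring).
    set (w := exp (- (b * y))) in *.
    assert (Hw : 0 < w) by apply exp_pos.
    assert (Hw1 : w <= 1) by (unfold w; rewrite <- exp_0; apply exp_mono; nra).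
    assert (Hbw : b * y * w <= 1).
    { unfold w. rewrite exp_Ropp. pose proof (exp_pos (b * y)). pose proof (exp_ineq1_le (b * y)).
      apply Rmult_le_reg_r with (exp (b * y)); [lra|]. rewrite Rmult_assoc, Rinv_l by lra. lra. }
    assert (Hby : 0 <= b * y) by nra.
    replace (e * (R0 * (4 * b * y ^ 2) + INR n * y * R0 * 1)) with (R0 * y * (e * (4 * (b * y) + INR n))) by ring.
    replace (R0 * (INR n + 4) * (y * w)) with (R0 * y * (w * (4 + INR n))) by ring.
    apply Rmult_le_compat_l; [nra|].
    apply Rle_trans with (w * w * (4 * (b * y) + INR n)); [apply Rmult_le_compat_r; lra|].
    rewrite Rmult_assoc. apply Rmult_le_compat_l; [lra|].
    assert (w * INR n <= INR n) by nra. lra.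
  - unfold g.
    assert (Hb : 0 < kap * M) by (apply Rmult_lt_0_compat; lra).
    rewrite (RInt_scal (V:=R_CompleteNormedModule) (fun y => y * exp (- (kap * M * y)))).
    + unfold scal; simpl; unfold mult; simpl.
      assert (H2 := RInt_y_exp (kap * M) v Hb ltac:(lra)).
      replace (R0 * (INR n + 4) / (M * (M * 1)) / (kap * (kap * 1))) with (R0 * (INR n + 4) * / (kap * M) ^ 2) by (field; lra).
      apply Rmult_le_compat_l; [apply Rmult_le_pos; lra|exact H2].
    + apply ex_RInt_cont; [lra|]. intros y _.
      auto_continuous. exact I.
Qed.

Lemma sum_inv_sqr (K : nat) : sum_n (fun k => / INR (S k) ^ 2) K <= 2.
Proof.
  assert (H : sum_n (fun k => / INR (S k) ^ 2) K <= 2 - / INR (S K)).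
  { induction K as [|K IH].
    - rewrite sum_O. simpl. lra.
    - rewrite sum_n_S. rewrite (S_INR (S K)). pose proof (INR_S_pos K). set (a := INR (S K)) in *.
      assert (/ (a + 1) ^ 2 <= / a - / (a + 1)); [|lra].
      replace (/ a - / (a + 1)) with (/ (a * (a + 1))) by (field; lra).
      apply Rinv_le_contravar; nra. }
  pose proof (Rinv_0_lt_compat _ (INR_S_pos K)). lra.
Qed.

Lemma sum_half_pow (K : nat) : sum_n (fun k => (1 / 2) ^ k) K <= 2.
Proof.
  assert (H : sum_n (fun k => (1 / 2) ^ k) K = 2 - (1 / 2) ^ K).
  { induction K as [|K IH]; [rewrite sum_O; simpl; change_R; lra|].
    rewrite sum_n_S, IH. simpl. change_R. field. }
  rewrite H. assert (0 < (1 / 2) ^ K) by (apply pow_lt; lra). lra.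
Qed.

Lemma sum_n_abs_le (a b : nat -> R) (c B : R) (K : nat) :
  (forall k, Rabs (a k) <= c * b k) -> 0 <= c -> sum_n b K <= B -> Rabs (sum_n a K) <= c * B.
Proof.
  intros H Hc HB. apply Rle_trans with (c * sum_n b K); [|now apply Rmult_le_compat_l].
  clear HB. induction K as [|K IH].
  - rewrite !sum_O. apply H.
  - rewrite !sum_n_S. eapply Rle_trans; [apply Rabs_triang|]. specialize (H (S K)). lra.
Qed.

Lemma sum_n_sub (a b : nat -> R) K : sum_n a K - sum_n b K = sum_n (fun k => a k - b k) K.
Proof.
  induction K as [|K IH]; [rewrite !sum_O; reflexivity|]. rewrite !sum_n_S, <- IH. ring.
Qed.

Lemma shift_harmonics n N K v : (2 <= n)%nat -> 0 <= v <= PI / 2 ->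
  Rabs (sum_n (fun k => 2 * RInt (fun t => t ^ n * cos (2 * PI * INR (S k) * exp t)) 0 (ln (INR (S N)))) K
        - sum_n (fun k => 2 * RInt (fun x => Re (harmonic n (2 * PI * INR (S k)) (x, v))) 0 (ln (INR (S N)))) K)
    <= 2 ^ n + 4 * ((ln (INR (S N)) + 2) ^ n * (INR n + 4) / INR (S N) ^ 2).
Proof.
  intros Hn Hv.
  assert (HN := INR_S_ge_1 N).
  assert (HX : 0 <= ln (INR (S N))) by (apply ln_ge_0; lra).
  rewrite sum_n_sub.
  set (rho := (ln (INR (S N)) + 2) ^ n * (INR n + 4) / INR (S N) ^ 2).
  assert (Hrho : 0 <= rho).
  { unfold rho. apply Rmult_le_pos; [apply Rmult_le_pos|].
    - apply pow_le; lra.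
    - pose proof (pos_INR n); lra.
    - apply Rlt_le, Rinv_0_lt_compat, pow_lt; lra. }
  assert (H2 : 0 < 2 ^ n) by (apply pow_lt; lra).
  replace (2 ^ n + 4 * rho) with ((2 * (2 ^ n / 4 + rho)) * 2) by field.
  apply (sum_n_abs_le _ (fun k => / INR (S k) ^ 2)); [|lra|apply sum_inv_sqr].
  intro k. rewrite (shift_harmonic n _ _ v HX (proj1 Hv)).
  assert (Hl := left_side n k v Hn Hv). assert (Hr := right_side n k v N Hv).
  fold rho in Hr. unfold Rdiv in Hl at 1. unfold Rdiv in Hr at 1.
  apply Rabs_le_between in Hl. apply Rabs_le_between in Hr. apply Rabs_le. lra.
Qed.

Lemma right_side_vanishes n :
  is_lim_seq (fun N => 4 * ((ln (INR (S N)) + 2) ^ n * (INR n + 4) / INR (S N) ^ 2)) 0.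
Proof.
  pose proof (pos_INR n) as Hn. pose proof (INR_fact_lt_0 n) as Hf. pose proof (exp_pos 2) as He.
  set (c := 4 * (INR (fact n) * exp 2 * (INR n + 4))).
  apply (is_lim_seq_le_le (fun _ => 0) _ (fun N => c * exp (- 1 * ln (INR (S N))))).
  - intro N.
    assert (HN := INR_S_ge_1 N).
    assert (HX : 0 <= ln (INR (S N))) by (apply ln_ge_0; lra).
    assert (H := pow_le_fact_exp (ln (INR (S N)) + 2) n ltac:(lra)).
    rewrite exp_plus, exp_ln in H by lra.
    replace (-1 * ln (INR (S N))) with (- ln (INR (S N))) by ring. rewrite exp_Ropp, exp_ln by lra.
    set (M := INR (S N)) in *. set (L := ln M) in *.
    assert (HP : 0 <= (L + 2) ^ n) by (apply pow_le; lra).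
    assert (HM : 0 < / M ^ 2) by (apply Rinv_0_lt_compat, pow_lt; lra).
    split.
    + unfold Rdiv. repeat apply Rmult_le_pos; lra.
    + unfold c. replace (4 * (INR (fact n) * exp 2 * (INR n + 4)) * / M)
        with (4 * ((INR (fact n) * (M * exp 2)) * (INR n + 4) / M ^ 2)) by (field; lra).
      apply Rmult_le_compat_l; [lra|]. unfold Rdiv. apply Rmult_le_compat_r; [lra|].
      apply Rmult_le_compat_r; lra.
  - apply is_lim_seq_const.
  - evar_last; [apply (is_lim_seq_scal_l _ c 0), (is_lim_seq_exp_ln 1), Rlt_0_1|]. simpl. f_equal. ring.
Qed.

(** * The horizontal line through the saddle point *)

Lemma exp_quadratic_lower (s : R) : 0 <= s -> s ^ 2 / 2 <= exp s - 1 - s.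
Proof.
  intro Hs.
  assert (H := nonincr_of_deriv (fun t => 1 + t + t ^ 2 / 2 - exp t) (fun t => 1 + t - exp t) 0 s Hs).
  cbv beta in H. rewrite exp_0 in H. cut (1 + s + s ^ 2 / 2 - exp s <= 1 + 0 + 0 ^ 2 / 2 - 1); [lra|].
  apply H.
  - intros t _. auto_derive; [exact I|]. field.
  - intros t _. pose proof (exp_ineq1_le t). lra.
Qed.

(** A rational bound is needed because it is used up to [r = u], where a
    quadratic one fails. *)
Lemma exp_neg_lower (r : R) : 0 <= r -> r ^ 2 / (2 + r) <= exp (- r) - 1 + r.
Proof.
  intro Hr.
  (* equivalent to 2 - r <= (2 + r) exp (- r) *)
  assert (H := nonincr_of_deriv (fun t => (2 - t) - (2 + t) * exp (- t)) (fun t => - 1 + (1 + t) * exp (- t)) 0 r Hr).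
  cbv beta in H. rewrite Ropp_0, exp_0 in H.
  assert (H1 : (2 - r) - (2 + r) * exp (- r) <= (2 - 0) - (2 + 0) * 1).
  { apply H.
    - intros t _. auto_derive; [exact I|]. ring.
    - intros t _. rewrite exp_Ropp. pose proof (exp_ineq1_le t). pose proof (exp_pos t).
      assert ((1 + t) * / exp t <= 1); [|lra].
      apply Rmult_le_reg_r with (exp t); [lra|]. rewrite Rmult_assoc, Rinv_l by lra. lra. }
  apply Rmult_le_reg_l with (2 + r); [lra|].
  replace ((2 + r) * (r ^ 2 / (2 + r))) with (r ^ 2) by (field; lra). nra.
Qed.

(** The convexity of the double exponential outweighs the growth of [|t|^n]: the
    former gains [u (e^s - 1 - s)], at least [2 s^2 / 3] down to the imaginary axis,
    and the latter loses [s^2 / 2], both in units of [n / |t|^2]. *)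
Lemma harmonic_gaussian_decay (n : nat) (u v s : R) :
  4 <= u -> 0 < v ->
  INR n * u / (u ^ 2 + v ^ 2) = 2 * PI * exp u * sin v ->
  - u <= s ->
  Cmod (harmonic n (2 * PI) (u + s, v))
    <= Cmod (harmonic n (2 * PI) (u, v)) * exp (- (INR n * s ^ 2 / (6 * (u ^ 2 + v ^ 2)))).
Proof.
  intros Hu Hv HS Hs. rewrite !Cmod_harmonic.
  set (D := u ^ 2 + v ^ 2) in *.
  assert (HD : 0 < D) by (unfold D; nra).
  set (m := Cmod (u, v)).
  assert (Hm2 : m ^ 2 = D) by (unfold m; rewrite Cmod_sqr; reflexivity).
  assert (Hm : 0 <= m) by apply Cmod_ge_0.
  set (y := (2 * u * s + s ^ 2) / D).
  assert (H1 : Cmod (u + s, v) <= m * exp (y / 2)).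
  { apply Rsqr_incr_0.
    - unfold Rsqr. replace (Cmod (u + s, v) * Cmod (u + s, v)) with (Cmod (u + s, v) ^ 2) by ring.
      rewrite Cmod_sqr. simpl Re. simpl Im.
      replace (m * exp (y / 2) * (m * exp (y / 2))) with (m ^ 2 * (exp (y / 2) * exp (y / 2))) by ring.
      rewrite <- exp_plus. replace (y / 2 + y / 2) with y by field. rewrite Hm2.
      replace ((u + s) ^ 2 + v ^ 2) with (D * (1 + y)) by (unfold y, D; field; fold D; lra).
      apply Rmult_le_compat_l; [lra|apply exp_ineq1_le].
    - apply Cmod_ge_0.
    - apply Rmult_le_pos; [exact Hm|apply Rlt_le, exp_pos]. }
  assert (H2 : Cmod (u + s, v) ^ n <= m ^ n * exp (INR n * (y / 2))).
  { apply Rle_trans with ((m * exp (y / 2)) ^ n).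
    - apply pow_incr. split; [apply Cmod_ge_0|exact H1].
    - rewrite Rpow_mult_distr. right. f_equal.
      clear. induction n as [|n IH]; [simpl; rewrite Rmult_0_l, exp_0; reflexivity|].
      rewrite S_INR. simpl pow. rewrite IH, <- exp_plus. f_equal. ring. }
  rewrite exp_plus.
  replace (2 * PI * (exp u * exp s) * sin v) with (INR n * u / D * exp s) by (rewrite HS; ring).
  rewrite <- HS.
  apply Rle_trans with (m ^ n * exp (INR n * (y / 2)) * exp (- (INR n * u / D * exp s))).
  { apply Rmult_le_compat_r; [apply Rlt_le, exp_pos|exact H2]. }
  rewrite !Rmult_assoc. apply Rmult_le_compat_l; [apply pow_le; exact Hm|].
  rewrite <- !exp_plus. apply exp_mono.
  assert (Hkey : s ^ 2 / 2 + s ^ 2 / 6 <= u * (exp s - 1 - s)).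
  { destruct (Rle_lt_dec 0 s) as [h|h].
    - assert (H := exp_quadratic_lower s h). nra.
    - assert (H := exp_neg_lower (- s) ltac:(lra)). rewrite Ropp_involutive in H.
      replace ((- s) ^ 2) with (s ^ 2) in H by ring.
      apply Rle_trans with (u * (s ^ 2 / (2 + - s))); [|apply Rmult_le_compat_l; lra].
      replace (s ^ 2 / 2 + s ^ 2 / 6) with (s ^ 2 * (2 / 3)) by field.
      replace (u * (s ^ 2 / (2 + - s))) with (s ^ 2 * (u / (2 + - s))) by (field; lra).
      apply Rmult_le_compat_l; [apply pow2_ge_0|].
      apply Rmult_le_reg_r with (2 + - s); [lra|].
      replace (u / (2 + - s) * (2 + - s)) with u by (field; lra). lra. }
  replace (INR n * (y / 2)) with (INR n / D * (u * s + s ^ 2 / 2)) by (unfold y; field; lra).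
  replace (INR n * u / D * exp s) with (INR n / D * (u * exp s)) by (field; lra).
  replace (INR n * u / D) with (INR n / D * u) by (field; lra).
  replace (INR n * s ^ 2 / (6 * D)) with (INR n / D * (s ^ 2 / 6)) by (field; lra).
  assert (HnD : 0 <= INR n / D) by (apply Rmult_le_pos; [apply pos_INR|apply Rlt_le, Rinv_0_lt_compat, HD]).
  replace (INR n / D * (u * s + s ^ 2 / 2) + - (INR n / D * (u * exp s)))
    with (INR n / D * (u * s + s ^ 2 / 2 - u * exp s)) by ring.
  replace (- (INR n / D * u) + - (INR n / D * (s ^ 2 / 6))) with (INR n / D * (- u - s ^ 2 / 6)) by ring.
  apply Rmult_le_compat_l; [exact HnD|]. lra.
Qed.

Lemma exp_INR_mult (k : nat) (a : R) : exp (INR k * a) = exp a ^ k.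
Proof.
  induction k as [|k IH]; [simpl; rewrite Rmult_0_l; apply exp_0|].
  rewrite S_INR. simpl pow. rewrite <- IH, <- exp_plus. f_equal. ring.
Qed.

(** Multiplying the frequency multiplies the modulus of the exponential factor,
    which gives geometric decay. *)
Lemma higher_harmonic_bound n k x v q : 1 / 2 <= sin v -> 
  exp (- (PI * exp x)) <= q ->
  Cmod (harmonic n (2 * PI * INR (S k)) (x, v)) <= Cmod (harmonic n (2 * PI) (x, v)) * q ^ k.
Proof.
  intros Hv Hq. rewrite !Cmod_harmonic, (Rmult_assoc _ _ (q ^ k)).
  apply Rmult_le_compat_l; [apply pow_le, Cmod_ge_0|].
  rewrite S_INR.
  replace (- (2 * PI * (INR k + 1) * exp x * sin v))
    with (- (2 * PI * exp x * sin v) + INR k * (- (2 * PI * exp x * sin v))) by ring.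
  rewrite exp_plus, exp_INR_mult. apply Rmult_le_compat_l; [apply Rlt_le, exp_pos|].
  apply pow_incr. split; [apply Rlt_le, exp_pos|]. eapply Rle_trans; [|exact Hq].
  apply exp_mono. pose proof PI_RGT_0. pose proof (exp_pos x).
  assert (0 < PI * exp x) by nra. nra.
Qed.

Lemma exp_neg_PI_exp_half (x : R) : 0 <= x -> exp (- (PI * exp x)) <= 1 / 2.
Proof.
  intro Hx. pose proof PI_gt_3. pose proof (exp_ineq1_le x). rewrite exp_Ropp.
  pose proof (exp_ineq1_le (PI * exp x)).
  replace (1 / 2) with (/ 2) by field. apply Rinv_le_contravar; nra.
Qed.

Section Line.

Context (n : nat) (u v w : R).
Hypothesis Hu : 4 <= u.
Hypothesis Hv : 0 < v <= PI / 2.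
Hypothesis Hsin : 1 / 2 <= sin v.
Hypothesis HS : INR n * u / (u ^ 2 + v ^ 2) = 2 * PI * exp u * sin v.
Hypothesis Hw : 0 < w <= 1.
Let H := Cmod (harmonic n (2 * PI) (u, v)).
Let beta := INR n * w / (6 * (u ^ 2 + v ^ 2)).
Hypothesis Hbeta : 1 <= beta.

Local Lemma D_pos : 0 < u ^ 2 + v ^ 2.
Proof. nra. Qed.

Local Lemma H_pos : 0 <= H.
Proof. apply Cmod_ge_0. Qed.

Local Lemma outer_pointwise k x : 0 <= x -> w <= Rabs (x - u) ->
  Rabs (Re (harmonic n (2 * PI * INR (S k)) (x, v)))
    <= (1 / 2) ^ k * H * exp (- (beta * Rabs (x - u))).
Proof.
  intros Hx Hout. pose proof D_pos as HD.
  eapply Rle_trans; [apply re_le_Cmod|].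
  eapply Rle_trans; [apply (higher_harmonic_bound n k x v (1 / 2) Hsin (exp_neg_PI_exp_half x Hx))|].
  rewrite Rmult_comm, Rmult_assoc. apply Rmult_le_compat_l; [apply pow_le; lra|].
  assert (Hd := harmonic_gaussian_decay n u v (x - u) Hu (proj1 Hv) HS ltac:(lra)).
  replace (u + (x - u)) with x in Hd by ring.
  eapply Rle_trans; [exact Hd|]. apply Rmult_le_compat_l; [apply H_pos|]. apply exp_mono.
  apply Ropp_le_contravar. unfold beta.
  rewrite <- (pow2_abs (x - u)). set (a := Rabs (x - u)) in *.
  replace (INR n * w / (6 * (u ^ 2 + v ^ 2)) * a) with (INR n / (6 * (u ^ 2 + v ^ 2)) * (w * a)) by (field; lra).
  replace (INR n * a ^ 2 / (6 * (u ^ 2 + v ^ 2))) with (INR n / (6 * (u ^ 2 + v ^ 2)) * a ^ 2) by (field; lra).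
  apply Rmult_le_compat_l; [|nra].
  apply Rmult_le_pos; [apply pos_INR|apply Rlt_le, Rinv_0_lt_compat; lra].
Qed.

Local Lemma outer_left k :
  Rabs (RInt (fun x => Re (harmonic n (2 * PI * INR (S k)) (x, v))) 0 (u - w))
    <= (1 / 2) ^ k * (H * (u * exp (- (beta * w)))).
Proof.
  pose proof H_pos as H0. assert (Hp : 0 < (1 / 2) ^ k) by (apply pow_lt; lra).
  pose proof (exp_pos (- (beta * w))).
  eapply Rle_trans.
  - apply (abs_RInt_bound _ 0 (u - w) ((1 / 2) ^ k * H * exp (- (beta * w)))); [lra| |].
    + intros; apply continuous_Re_horizontal.
    + intros x Hx. eapply Rle_trans.
      * apply outer_pointwise; [lra|]. rewrite Rabs_left1; lra.
      * apply Rmult_le_compat_l; [nra|]. apply exp_mono. rewrite Rabs_left1 by lra. nra.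
  - set (e := exp (- (beta * w))) in *. 
    replace ((1 / 2) ^ k * (H * (u * e))) with (u * ((1 / 2) ^ k * H * e)) by ring.
    apply Rmult_le_compat_r; [|lra]. apply Rmult_le_pos; nra.
Qed.

Local Lemma outer_right k X : u + w <= X ->
  Rabs (RInt (fun x => Re (harmonic n (2 * PI * INR (S k)) (x, v))) (u + w) X)
    <= (1 / 2) ^ k * (H * exp (- (beta * w))).
Proof.
  intro HX. pose proof H_pos as H0. assert (Hp : 0 < (1 / 2) ^ k) by (apply pow_lt; lra).
  set (g := fun x => (1 / 2) ^ k * H * exp (- (beta * (x - u)))).
  assert (Hg : forall x, continuous g x).
  { intro x. unfold g. auto_continuous. exact I. }
  eapply Rle_trans.
  - apply (abs_RInt_le_RInt _ g (u + w) X HX).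
    + intros; apply continuous_Re_horizontal.
    + intros; apply Hg.
    + intros x Hx. unfold g. rewrite <- (Rabs_right (x - u)) by lra.
      apply outer_pointwise; [lra|]. rewrite Rabs_right; lra.
  - rewrite (RInt_of_derive (fun x => - ((1 / 2) ^ k * H / beta * exp (- (beta * (x - u))))) g); [|exact HX| |].
    + replace (u + w - u) with w by ring.
      pose proof (exp_pos (- (beta * w))). pose proof (exp_pos (- (beta * (X - u)))).
      assert (Hib : 0 < / beta <= 1).
      { split; [apply Rinv_0_lt_compat; lra|]. rewrite <- Rinv_1. apply Rinv_le_contravar; lra. }
      assert (Hc : 0 <= (1 / 2) ^ k * H) by nra.
      assert (Hcb : 0 <= (1 / 2) ^ k * H / beta <= (1 / 2) ^ k * H) by (unfold Rdiv at 1 3; split; [apply Rmult_le_pos; lra|nra]).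
      rewrite <- Rmult_assoc. nra.
    + intros x _. unfold g. clearbody beta H. auto_derive; [exact I|]. unfold Rminus. field. lra.
    + intros; apply Hg.
Qed.

Local Lemma window_higher k :
  Rabs (RInt (fun x => Re (harmonic n (2 * PI * INR (S (S k))) (x, v))) (u - w) (u + w))
    <= (1 / 2) ^ k * (H * (2 * w * exp (- (PI * exp (u - w))))).
Proof.
  pose proof H_pos as H0. set (q := exp (- (PI * exp (u - w)))).
  assert (Hq0 : 0 < q) by apply exp_pos.
  assert (Hq2 : q <= 1 / 2) by (apply exp_neg_PI_exp_half; lra).
  eapply Rle_trans.
  - apply (abs_RInt_bound _ (u - w) (u + w) (H * (q * (1 / 2) ^ k))); [lra| |].
    + intros; apply continuous_Re_horizontal.
    + intros x Hx. eapply Rle_trans; [apply re_le_Cmod|].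
      eapply Rle_trans; [apply (higher_harmonic_bound n (S k) x v q Hsin)|].
      * apply exp_mono. pose proof PI_RGT_0. assert (exp (u - w) <= exp x) by (apply exp_mono; lra). nra.
      * apply Rmult_le_compat; [apply Cmod_ge_0|apply pow_le; lra| |].
        -- assert (Hd := harmonic_gaussian_decay n u v (x - u) Hu (proj1 Hv) HS ltac:(lra)).
           replace (u + (x - u)) with x in Hd by ring. fold H in Hd.
           eapply Rle_trans; [exact Hd|]. rewrite <- (Rmult_1_r H) at 2. apply Rmult_le_compat_l; [exact H0|].
           apply Rle_trans with (exp 0); [apply exp_mono|rewrite exp_0; lra].
           assert (0 <= INR n * (x - u) ^ 2 / (6 * (u ^ 2 + v ^ 2))); [|lra].
           pose proof D_pos. apply Rmult_le_pos; [apply Rmult_le_pos; [apply pos_INR|apply pow2_ge_0]|].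
           apply Rlt_le, Rinv_0_lt_compat; lra.
        -- simpl. apply Rmult_le_compat_l; [lra|]. apply pow_incr; lra.
  - right. ring.
Qed.

(** What is discarded: all harmonics outside the window, where the first one is
    below its Gaussian bound and the others form a geometric series of ratio
    [1 / 2], and the higher harmonics inside it. *)
Lemma line_reduction N K : u + w <= ln (INR (S N)) ->
  Rabs (sum_n (fun k => 2 * RInt (fun x => Re (harmonic n (2 * PI * INR (S k)) (x, v))) 0 (ln (INR (S N)))) K
        - 2 * RInt (fun x => Re (harmonic n (2 * PI) (x, v))) (u - w) (u + w))
    <= H * (4 * (u + 1) * exp (- (beta * w)) + 16 * w * exp (- (PI * exp (u - w)))).
Proof.
  intro HX. set (X := ln (INR (S N))) in *. pose proof H_pos as H0.
  set (W := 2 * RInt (fun x => Re (harmonic n (2 * PI) (x, v))) (u - w) (u + w)).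
  assert (E : forall m, sum_n (fun k => match k with O => W | S _ => 0 end) m = W).
  { induction m as [|m IH]; [apply sum_O|]. rewrite sum_n_S, IH. change_R. ring. }
  rewrite <- (E K). rewrite sum_n_sub.
  set (e := exp (- (beta * w))). set (q := exp (- (PI * exp (u - w)))).
  assert (He : 0 < e) by apply exp_pos. assert (Hq : 0 < q) by apply exp_pos.
  replace (H * (4 * (u + 1) * e + 16 * w * q)) with ((H * (2 * (u + 1) * e + 8 * w * q)) * 2) by ring.
  apply (sum_n_abs_le _ (fun k => (1 / 2) ^ k)); [| |apply sum_half_pow].
  2: { apply Rmult_le_pos; [exact H0|]. nra. }
  intro k.
  set (f := fun x => Re (harmonic n (2 * PI * INR (S k)) (x, v))).
  assert (Hc : forall x, continuous f x) by (intro x; apply continuous_Re_horizontal).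
  assert (Hsplit : RInt f 0 X = RInt f 0 (u - w) + RInt f (u - w) (u + w) + RInt f (u + w) X).
  { rewrite (RInt_split f 0 (u - w) (u + w)), (RInt_split f 0 (u + w) X); try lra; intros; apply Hc. }
  rewrite Hsplit.
  assert (Hl := outer_left k). assert (Hr := outer_right k X HX). fold f in Hl, Hr. fold e in Hl, Hr.
  assert (Hp : 0 < (1 / 2) ^ k) by (apply pow_lt; lra).
  assert (Hmid : Rabs (2 * RInt f (u - w) (u + w) - match k with O => W | S _ => 0 end)
     <= (1 / 2) ^ k * (H * (8 * w * q))).
  { destruct k as [|k].
    - unfold W, f. simpl INR. rewrite Rmult_1_r, Rminus_diag, Rabs_R0.
      apply Rmult_le_pos; [lra|]. apply Rmult_le_pos; [exact H0|]. nra.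
    - rewrite Rminus_0_r, Rabs_mult, (Rabs_right 2) by lra.
      assert (Hh := window_higher k). fold q in Hh. unfold f.
      replace ((1 / 2) ^ S k * (H * (8 * w * q))) with (2 * ((1 / 2) ^ k * (H * (2 * w * q)))) by (simpl; field).
      lra. }
  apply Rabs_le_between in Hl. apply Rabs_le_between in Hr. apply Rabs_le_between in Hmid.
  replace (H * (2 * (u + 1) * e + 8 * w * q) * (1 / 2) ^ k)
    with (2 * ((1 / 2) ^ k * (H * (u * e))) + 2 * ((1 / 2) ^ k * (H * e)) + (1 / 2) ^ k * (H * (8 * w * q))) by ring.
  set (A1 := (1 / 2) ^ k * (H * (u * e))) in *. set (A2 := (1 / 2) ^ k * (H * e)) in *.
  set (A3 := (1 / 2) ^ k * (H * (8 * w * q))) in *. clearbody A1 A2 A3.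
  set (m := match k with O => W | S _ => 0 end) in *.
  change (Rabs (2 * (RInt f 0 (u - w) + RInt f (u - w) (u + w) + RInt f (u + w) X) - m) <= 2 * A1 + 2 * A2 + A3).
  clearbody m f. apply Rabs_le. lra.
Qed.

(** Collects the paths that were moved, the parts of the line that were discarded
    and the limit in the cutoff. *)
Lemma stieltjes_window (g : R) : (2 <= n)%nat -> is_lim_seq (stieltjes_sum n) g ->
  Rabs (g - 2 * RInt (fun x => Re (harmonic n (2 * PI) (x, v))) (u - w) (u + w))
    <= 2 ^ n + H * (4 * (u + 1) * exp (- (beta * w)) + 16 * w * exp (- (PI * exp (u - w)))).
Proof.
  intros Hn Hg.
  apply (stieltjes_fourier_approx n _ _ _ _ ltac:(lia) Hg (right_side_vanishes n)).
  destruct (archimed (exp (u + w))) as [Ha _].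
  exists (Z.to_nat (up (exp (u + w)))). intros N K HN.
  assert (HX : u + w <= ln (INR (S N))).
  { rewrite <- (ln_exp (u + w)). apply Rcomplements.ln_le; [apply exp_pos|].
    apply Rle_trans with (IZR (up (exp (u + w)))); [lra|].
    rewrite INR_IZR_INZ. apply IZR_le. lia. }
  assert (H1 := shift_harmonics n N K v Hn ltac:(lra)).
  assert (H2 := line_reduction N K HX).
  apply Rabs_le_between in H1. apply Rabs_le_between in H2. apply Rabs_le. lra.
Qed.

End Line.

(** * Gaussian integrals with a complex parameter *)

Lemma Cderiv_CInt_2d (H H' : R -> R -> C) (a b x : R) : a <= b ->
  (forall x t, Cderiv (fun z => H z t) x (H' x t)) ->
  (forall x t, cont2 H' x t) -> (forall x t, Ccont (H x) t) ->
  Cderiv (fun z => CInt (H z) a b) x (CInt (H' x) a b).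
Proof.
  intros Hab Hd Hc Hf. split; simpl.
  - apply (is_derive_RInt_2d (fun z t => Re (H z t)) (fun z t => Re (H' z t)) a b Hab);
      intros; [apply Hd|apply Hc|apply Hf].
  - apply (is_derive_RInt_2d (fun z t => Im (H z t)) (fun z t => Im (H' z t)) a b Hab);
      intros; [apply Hd|apply Hc|apply Hf].
Qed.

Lemma is_derive_RInt_sym (f : R -> R) (x : R) : (forall t, continuous f t) ->
  is_derive (fun z => RInt f (- z) z) x (f x + f (- x)).
Proof.
  intro Hf.
  evar_last.
  - apply (is_derive_RInt_bound_comp (V:=R_NormedModule) f (fun a b => RInt f a b) (fun z => - z) (fun z => z) (- 1) 1 x).
    + apply filter_forall. intros [a b]. apply (RInt_correct (V:=R_CompleteNormedModule)).
      apply (ex_RInt_continuous (V:=R_CompleteNormedModule)). intros; apply Hf.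
    + apply Hf.
    + apply Hf.
    + auto_derive; [exact I|ring].
    + apply (is_derive_id (K:=R_AbsRing)).
  - unfold minus, plus, opp, scal; simpl; unfold mult; simpl. ring.
Qed.

Lemma RInt_sym_scale (f : R -> R) (x : R) : (forall t, continuous f t) ->
  RInt f (- x) x = x * RInt (fun t => f (x * t)) (-1) 1.
Proof.
  intro Hf.
  assert (H := RInt_comp_lin (V:=R_CompleteNormedModule) f x 0 (-1) 1).
  replace (x * -1 + 0) with (- x) in H by ring. replace (x * 1 + 0) with x in H by ring.
  rewrite <- H.
  - rewrite <- (RInt_scal (V:=R_CompleteNormedModule) (fun t => f (x * t))).
    + apply RInt_ext. intros t _. now rewrite Rplus_0_r.
    + apply (ex_RInt_continuous (V:=R_CompleteNormedModule)). intros t _.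
      apply (continuous_comp (fun t => x * t) f); [|apply Hf].
      apply (continuous_scal_r (K:=R_AbsRing) (V:=R_NormedModule) x), continuous_id.
  - apply (ex_RInt_continuous (V:=R_CompleteNormedModule)). intros; apply Hf.
Qed.

Definition gauss (q : C) (t : R) : C := Cexp (- q * RtoC (t ^ 2))%C.

Lemma gauss_even q x : gauss q (- x) = gauss q x.
Proof. unfold gauss. now replace ((- x) ^ 2) with (x ^ 2) by ring. Qed.

Lemma Cderiv_gauss q x : Cderiv (gauss q) x (- (2 * q * RtoC x) * gauss q x)%C.
Proof.
  eapply Cderiv_eq.
  - apply Cderiv_exp. apply Cderiv_scal. apply Cderiv_real.
    assert (H : is_derive (fun t : R => t ^ 2) x (2 * x)) by (auto_derive; [exact I|ring]). exact H.
  - unfold gauss. rewrite RtoC_mult. ring.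
Qed.

Lemma Ccont_gauss q x : Ccont (gauss q) x.
Proof. eapply Cderiv_cont, Cderiv_gauss. Qed.

Lemma Cmod_gauss q x : Cmod (gauss q x) = exp (- (Re q * x ^ 2)).
Proof. unfold gauss. rewrite Cmod_Cexp. f_equal. rewrite re_mult, re_opp. cbn [Re Im RtoC fst snd]. ring. Qed.

Lemma CInt_gauss_scale (q : C) (z : R) :
  CInt (gauss q) (- z) z = (RtoC z * CInt (fun t => gauss q (z * t)) (-1) 1)%C.
Proof.
  assert (H1 := RInt_sym_scale (fun t => Re (gauss q t)) z (fun t => proj1 (Ccont_gauss q t))).
  assert (H2 := RInt_sym_scale (fun t => Im (gauss q t)) z (fun t => proj2 (Ccont_gauss q t))).
  apply Ceq.
  - rewrite re_mult. cbn [Re Im RtoC fst snd CInt]. etransitivity; [exact H1|]. cbv beta. ring.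
  - rewrite im_mult. cbn [Re Im RtoC fst snd CInt]. etransitivity; [exact H2|]. cbv beta. ring.
Qed.

Definition gauss_tail (q : C) (x : R) : C :=
  CInt (fun t => gauss q x * gauss (q * RtoC (x ^ 2))%C t * RtoC (/ (1 + t ^ 2)))%C (-1) 1.

Lemma one_plus_sqr_neq_0 (t : R) : 1 + t ^ 2 <> 0.
Proof. pose proof (pow2_ge_0 t). lra. Qed.

(** The classical device: both terms are differentiable in [x] with opposite
    derivatives, and the second one tends to 0.  With a complex [q] it gives the
    square of the integral; the sign is settled separately. *)
Lemma gauss_integral_sqr (q : C) (x : R) :
  (q * (CInt (gauss q) (- x) x * CInt (gauss q) (- x) x) + 2 * gauss_tail q x = RtoC PI)%C.
Proof.
  set (Phi := fun x => (q * (CInt (gauss q) (- x) x * CInt (gauss q) (- x) x) + 2 * gauss_tail q x)%C).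
  assert (HA : forall x, Cderiv (fun x => CInt (gauss q) (- x) x) x (2 * gauss q x)%C).
  { intro z.
    eapply Cderiv_eq with (l := (gauss q z + gauss q (- z))%C); [|rewrite gauss_even; ring].
    split; simpl; apply is_derive_RInt_sym; intro t; apply (Ccont_gauss q t). }
  assert (HK : forall x, Cderiv (gauss_tail q) x (- (2 * q) * gauss q x * CInt (gauss q) (- x) x)%C).
  { intro z.
    assert (HG : forall x t, (gauss q x * gauss (q * RtoC (x ^ 2)) t)%C = Cexp (- q * (RtoC (x ^ 2) * RtoC (1 + t ^ 2)))%C).
    { intros x0 t. unfold gauss. rewrite <- Cexp_plus. f_equal. rewrite RtoC_plus. ring. }
    set (H' := fun x t => (- (2 * q) * gauss q x * (RtoC x * gauss q (x * t)))%C).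
    eapply Cderiv_eq.
    - apply (Cderiv_CInt_2d _ H' (-1) 1 z ltac:(lra)).
      + intros x0 t. unfold H'.
        apply (Cderiv_ext (fun s => Cexp (- q * (RtoC (s ^ 2) * RtoC (1 + t ^ 2))) * RtoC (/ (1 + t ^ 2)))%C);
          [intro s; now rewrite HG|].
        eapply Cderiv_eq.
        * apply Cderiv_mult; [|apply Cderiv_const]. apply Cderiv_exp. apply Cderiv_scal.
          apply Cderiv_mult; [|apply Cderiv_const]. apply Cderiv_real.
          assert (Hd : is_derive (fun t : R => t ^ 2) x0 (2 * x0)) by (auto_derive; [exact I|ring]). exact Hd.
        * cbv beta.
          replace (gauss q x0 * (RtoC x0 * gauss q (x0 * t)))%C with (RtoC x0 * (gauss q x0 * gauss (q * RtoC (x0 ^ 2)) t))%C.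
          2: { replace (gauss (q * RtoC (x0 ^ 2)) t) with (gauss q (x0 * t)); [ring|].
               unfold gauss. f_equal. rewrite Rpow_mult_distr, !RtoC_mult. ring. }
          replace (- (2 * q) * gauss q x0 * (RtoC x0 * gauss q (x0 * t)))%C
             with (- (2 * q) * RtoC x0 * (gauss q x0 * gauss (q * RtoC (x0 ^ 2)) t))%C.
          2: { replace (gauss (q * RtoC (x0 ^ 2)) t) with (gauss q (x0 * t)); [ring|].
               unfold gauss. f_equal. rewrite Rpow_mult_distr, !RtoC_mult. ring. }
          rewrite HG, RtoC_inv by apply one_plus_sqr_neq_0. rewrite RtoC_mult.
          assert (Hne : RtoC (1 + t ^ 2) <> RtoC 0).
          { intro h. apply RtoC_inj in h. now apply (one_plus_sqr_neq_0 t). }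
          field. exact Hne.
      + intros x0 t. unfold H', gauss. repeat apply cont2_mult; try apply cont2_const.
        * apply cont2_exp, cont2_mult; [apply cont2_const|]. apply cont2_real.
          apply (continuity_2d_pt_mult (fun a _ => a) (fun a _ => a * 1)); [apply continuity_2d_pt_id1|].
          apply continuity_2d_pt_mult; [apply continuity_2d_pt_id1|apply continuity_2d_pt_const].
        * apply cont2_real, continuity_2d_pt_id1.
        * apply cont2_exp, cont2_mult; [apply cont2_const|]. apply cont2_real.
          assert (Hp : continuity_2d_pt (fun a b => a * b) x0 t)
            by (apply continuity_2d_pt_mult; [apply continuity_2d_pt_id1|apply continuity_2d_pt_id2]).
          apply (continuity_2d_pt_mult (fun a b => a * b) (fun a b => a * b * 1)); [exact Hp|].
          apply continuity_2d_pt_mult; [exact Hp|apply continuity_2d_pt_const].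
      + intros x0 t. apply Ccont_mult; [apply Ccont_mult; [apply Ccont_const|apply Ccont_gauss]|].
        eapply Cderiv_cont, Cderiv_real. auto_derive; [|reflexivity]. apply one_plus_sqr_neq_0.
    - unfold H'. rewrite CInt_scal; [|lra|].
      2: { intros t _. apply Ccont_mult; [apply Ccont_const|].
           eapply Cderiv_cont. unfold gauss. apply Cderiv_exp. apply Cderiv_scal. apply Cderiv_real.
           assert (Hd : is_derive (fun s : R => (z * s) ^ 2) t (2 * z * z * t)) by (auto_derive; [exact I|ring]). exact Hd. }
      f_equal. rewrite CInt_scal; [|lra|].
      2: { intros t _. 
           eapply Cderiv_cont. unfold gauss. apply Cderiv_exp. apply Cderiv_scal. apply Cderiv_real.
           assert (Hd : is_derive (fun s : R => (z * s) ^ 2) t (2 * z * z * t)) by (auto_derive; [exact I|ring]). exact Hd. }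
      symmetry. apply CInt_gauss_scale. }
  assert (HP : forall x, Cderiv Phi x (RtoC 0)).
  { intro z. unfold Phi. eapply Cderiv_eq.
    - apply Cderiv_plus; [apply Cderiv_scal, Cderiv_mult; apply HA|apply Cderiv_scal, HK].
    - cbv beta. ring. }
  assert (H0 : Phi 0 = RtoC PI).
  { unfold Phi.
    assert (E1 : CInt (gauss q) (- 0) 0 = RtoC 0).
    { rewrite Ropp_0. apply Ceq; apply (RInt_point (V:=R_CompleteNormedModule)). }
    rewrite E1.
    assert (E2 : gauss_tail q 0 = RtoC (PI / 2)).
    { unfold gauss_tail.
      assert (E3 : forall t, (gauss q 0 * gauss (q * RtoC (0 ^ 2)) t * RtoC (/ (1 + t ^ 2)))%C = RtoC (/ (1 + t ^ 2))).
      { intro t. unfold gauss. replace (0 ^ 2) with 0 by ring.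
        replace (- q * RtoC 0)%C with (RtoC 0) by ring.
        replace (- (q * RtoC 0) * RtoC (t ^ 2))%C with (RtoC 0) by ring. rewrite Cexp_0. ring. }
      rewrite (CInt_ext _ (fun t => RtoC (/ (1 + t ^ 2))) (-1) 1); [|lra|intros; apply E3].
      rewrite (CInt_derive (fun t => RtoC (atan t)) (fun t => RtoC (/ (1 + t ^ 2))) (-1) 1); [|lra| |].
      - rewrite <- RtoC_minus. f_equal. replace (-1) with (- (1)) by ring. rewrite atan_opp, atan_1. field.
      - intros t _. apply Cderiv_real. auto_derive; [exact I|]. field. apply Rgt_not_eq; nra.
      - intros t _. eapply Cderiv_cont, Cderiv_real. auto_derive; [|reflexivity]. apply one_plus_sqr_neq_0. }
    rewrite E2. apply Ceq; simpl; field. }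
  fold (Phi x). rewrite <- H0.
  assert (HB : forall a b, a <= b -> Phi b = Phi a).
  { intros a b Hab.
    assert (Hb := Cderiv_bound Phi (fun _ => RtoC 0) a b 0 Hab (fun z _ => HP z)
      (fun z _ => Req_le _ _ (eq_trans (Cmod_R 0) Rabs_R0))).
    assert (Hz : (Phi b - Phi a)%C = RtoC 0).
    { apply Cmod_eq_0. pose proof (Cmod_ge_0 (Phi b - Phi a)%C). lra. }
    replace (Phi b) with (Phi a + (Phi b - Phi a))%C by ring. rewrite Hz. ring. }
  destruct (Rle_lt_dec 0 x); [apply HB; lra|symmetry; apply HB; lra].
Qed.

Lemma gauss_tail_bound (q : C) (x : R) : 0 <= Re q ->
  Cmod (gauss_tail q x) <= 4 * exp (- (Re q * x ^ 2)).
Proof.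
  intro Hq. unfold gauss_tail.
  replace (4 * exp (- (Re q * x ^ 2))) with (2 * exp (- (Re q * x ^ 2)) * (1 - -1)) by ring.
  apply CInt_bound; [lra| |].
  - intros t _. apply Ccont_mult; [apply Ccont_mult; [apply Ccont_const|apply Ccont_gauss]|].
    eapply Cderiv_cont, Cderiv_real. auto_derive; [|reflexivity]. apply one_plus_sqr_neq_0.
  - intros t _. rewrite !Cmod_mult, !Cmod_gauss, Cmod_R.
    assert (Ht : Rabs (/ (1 + t ^ 2)) <= 1).
    { pose proof (pow2_ge_0 t). rewrite Rabs_right.
      - rewrite <- Rinv_1. apply Rinv_le_contravar; lra.
      - apply Rle_ge, Rlt_le, Rinv_0_lt_compat; lra. }
    assert (He : exp (- (Re (q * RtoC (x ^ 2)) * t ^ 2)) <= 1).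
    { rewrite <- exp_0. apply exp_mono.
      replace (Re (q * RtoC (x ^ 2))%C) with (Re q * x ^ 2) by (rewrite re_mult; cbn [Re Im RtoC fst snd]; ring).
      pose proof (pow2_ge_0 t). pose proof (pow2_ge_0 x).
      assert (0 <= Re q * x ^ 2 * t ^ 2) by (apply Rmult_le_pos; [apply Rmult_le_pos|]; lra). lra. }
    pose proof (exp_pos (- (Re q * x ^ 2))). pose proof (exp_pos (- (Re (q * RtoC (x ^ 2)) * t ^ 2))).
    pose proof (Rabs_pos (/ (1 + t ^ 2))).
    set (e1 := exp (- (Re q * x ^ 2))) in *. set (e2 := exp (- (Re (q * RtoC (x ^ 2)) * t ^ 2))) in *.
    assert (e1 * e2 <= e1) by nra. assert (0 <= e1 * e2) by nra. nra.
Qed.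

Lemma cos_ge_quadratic (x : R) : 1 - x ^ 2 / 2 <= cos x.
Proof.
  assert (Hpos : forall y, 0 <= y -> 1 - y ^ 2 / 2 <= cos y).
  { intros y Hy.
    assert (H := nonincr_of_deriv (fun t => 1 - t ^ 2 / 2 - cos t) (fun t => - t + sin t) 0 y Hy).
    cbv beta in H. rewrite cos_0 in H. cut (1 - y ^ 2 / 2 - cos y <= 1 - 0 ^ 2 / 2 - 1); [lra|].
    apply H.
    - intros t _. auto_derive; [exact I|]. field.
    - intros t [Ht _]. destruct Ht as [Ht|Ht]; [pose proof (sin_lt_x t Ht); lra|].
      rewrite <- Ht, sin_0. lra. }
  destruct (Rle_lt_dec 0 x) as [h|h]; [now apply Hpos|].
  rewrite <- cos_neg. replace (x ^ 2) with ((- x) ^ 2) by ring. apply Hpos. lra.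
Qed.

Lemma Re_gauss (q : C) (t : R) :
  Re (gauss q t) = exp (- (Re q * t ^ 2)) * cos (Im q * t ^ 2).
Proof.
  unfold gauss, Cexp.
  replace (Re (- q * RtoC (t ^ 2))%C) with (- (Re q * t ^ 2)) by (rewrite re_mult, re_opp; cbn [Re Im RtoC fst snd]; ring).
  replace (Im (- q * RtoC (t ^ 2))%C) with (- (Im q * t ^ 2)) by (rewrite im_mult, im_opp; cbn [Re Im RtoC fst snd]; ring).
  rewrite cos_neg. reflexivity.
Qed.

(** When the phase of [q] is at most PI / 4 the Gaussian weight dominates the
    oscillation: the integrand is at least a positive multiple of the derivative
    of an increasing expression. *)
Lemma gauss_Re_pos (q : C) (w : R) : 0 < w -> 0 < Re q -> Rabs (Im q) <= Re q ->
  0 < Re (CInt (gauss q) (- w) w).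
Proof.
  intros Hw Ha Hb. set (al := Re q) in *. simpl.
  set (F := fun t => al ^ 2 / 2 * ((t ^ 3 / (2 * al) + 3 * t / (4 * al ^ 2)) * exp (- (al * t ^ 2)))).
  set (f := fun t => exp (- (al * t ^ 2)) * (3 / 8 - al ^ 2 * t ^ 4 / 2)).
  assert (Hf : forall t, continuous f t).
  { intro t. unfold f. auto_continuous. exact I. }
  apply Rlt_le_trans with (RInt f (- w) w).
  - rewrite (RInt_of_derive F f); [|lra| |intros; apply Hf].
    + unfold F. pose proof (exp_pos (- (al * w ^ 2))).
      replace ((- w) ^ 2) with (w ^ 2) by ring. set (e := exp (- (al * w ^ 2))) in *.
      replace (_ - _) with (al ^ 2 * (w ^ 3 / (2 * al) + 3 * w / (4 * al ^ 2)) * e) by (field; lra).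
      repeat apply Rmult_lt_0_compat; try nra.
      assert (0 < w ^ 3 / (2 * al)) by (apply Rdiv_lt_0_compat; [apply pow_lt|]; lra).
      assert (0 < 3 * w / (4 * al ^ 2)) by (apply Rdiv_lt_0_compat; nra). lra.
    + intros t _. unfold F, f. clearbody al. auto_derive; [exact I|].
      set (e := exp (- (al * (t * (t * 1))))). replace (exp (- (al * t ^ 2))) with e by reflexivity. field. lra.
  - apply RInt_le; [lra| | |].
    + apply ex_RInt_cont; [lra|intros; apply Hf].
    + apply ex_RInt_cont; [lra|]. intros t _; exact (proj1 (Ccont_gauss q t)).
    + intros t _. change (f t <= Re (gauss q t)). rewrite Re_gauss. unfold f. fold al.
      apply Rmult_le_compat_l; [apply Rlt_le, exp_pos|].
      eapply Rle_trans; [|apply cos_ge_quadratic].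
      assert (Im q ^ 2 <= al ^ 2).
      { rewrite <- (pow2_abs (Im q)). apply pow_incr. split; [apply Rabs_pos|exact Hb]. }
      replace ((Im q * t ^ 2) ^ 2) with (Im q ^ 2 * t ^ 4) by ring.
      assert (0 <= t ^ 4) by (replace (t ^ 4) with ((t ^ 2) ^ 2) by ring; apply pow2_ge_0). nra.
Qed.

(** [gauss_integral_sqr] determines the integral up to its sign.  As the integral
    and [g] both have positive real part, their sum stays away from 0, and the
    difference of the squares controls that of the values. *)
Lemma gauss_value (q g : C) (w : R) : 0 < w -> 0 < Re q -> Rabs (Im q) <= Re q ->
  (q * (g * g) = RtoC PI)%C -> Cmod g / 2 <= Re g ->
  Cmod (CInt (gauss q) (- w) w - g)%C <= 6 * Cmod g * exp (- (Re q * w ^ 2)).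
Proof.
  intros Hw Hq Hi Hg Hr.
  assert (Hp := gauss_Re_pos q w Hw Hq Hi). assert (Hs := gauss_integral_sqr q w).
  assert (Ht := gauss_tail_bound q w (Rlt_le _ _ Hq)).
  set (M := CInt (gauss q) (- w) w) in *. set (b := exp (- (Re q * w ^ 2))) in *.
  assert (Hb : 0 < b) by apply exp_pos.
  assert (E : (q * ((M - g) * (M + g)) = - (2 * gauss_tail q w))%C).
  { replace (q * ((M - g) * (M + g)))%C with (q * (M * M) + 2 * gauss_tail q w - q * (g * g) - 2 * gauss_tail q w)%C by ring.
    rewrite Hs, Hg. ring. }
  assert (E1 := f_equal Cmod E). rewrite Cmod_opp, !Cmod_mult in E1.
  assert (E2 := f_equal Cmod Hg). rewrite !Cmod_mult in E2.
  rewrite Cmod_R, Rabs_right in E2 by (pose proof PI_RGT_0; lra).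
  replace (Cmod 2) with 2 in E1.
  2: { rewrite Cmod_R, Rabs_right; lra. }
  assert (Hsum : Cmod g / 2 <= Cmod (M + g)%C).
  { eapply Rle_trans; [|apply re_le_Cmod]. rewrite re_plus. eapply Rle_trans; [|apply Rle_abs]. lra. }
  pose proof PI_gt_3. pose proof (Cmod_ge_0 q). pose proof (Cmod_ge_0 (M - g)%C).
  set (x := Cmod (M - g)%C) in *. set (y := Cmod (M + g)%C) in *. set (G := Cmod g) in *. set (Q := Cmod q) in *.
  assert (HG : 0 < G).
  { destruct (Rle_lt_dec G 0) as [h|h]; [|exact h]. exfalso.
    assert (G = 0) by (pose proof (Cmod_ge_0 g); unfold G in *; lra). nra. }
  assert (HQx : Q * (x * (G / 2)) <= 8 * b).
  { apply Rle_trans with (Q * (x * y)); [|lra].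
    apply Rmult_le_compat_l; [lra|]. apply Rmult_le_compat_l; lra. }
  (* multiply by [2 G] and use [Q G^2 = PI] *)
  assert (x * PI <= 16 * b * G).
  { rewrite <- E2. replace (x * (Q * (G * G))) with (Q * (x * (G / 2)) * (2 * G)) by field.
    apply Rle_trans with (8 * b * (2 * G)); [apply Rmult_le_compat_r; lra|lra]. }
  assert (x * 3 <= x * PI) by (apply Rmult_le_compat_l; lra).
  assert (0 < b * G) by (apply Rmult_lt_0_compat; lra). nra.
Qed.

(** * Moments *)

Definition gauss_moment (q : C) (w : R) (j : nat) : C :=
  CInt (fun t => RtoC (t ^ j) * gauss q t)%C (- w) w.

Lemma Ccont_pow_gauss q j t : Ccont (fun t => RtoC (t ^ j) * gauss q t)%C t.
Proof.
  apply Ccont_mult; [|apply Ccont_gauss].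
  eapply Cderiv_cont, Cderiv_real. auto_derive; [exact I|reflexivity].
Qed.

Lemma is_derive_pow_nat (j : nat) (t : R) : is_derive (fun t => t ^ j) t (INR j * t ^ pred j).
Proof. evar_last; [auto_derive; [exact I|reflexivity]|]. ring. Qed.

(** Integration by parts. *)
Lemma gauss_moment_step (q : C) (w : R) (j : nat) : 0 <= w ->
  (2 * q * gauss_moment q w (S (S j)) = RtoC (INR (S j)) * gauss_moment q w j
     - RtoC (w ^ S j - (- w) ^ S j) * gauss q w)%C.
Proof.
  intro Hw.
  assert (E := CInt_derive (fun t => RtoC (t ^ S j) * gauss q t)%C
    (fun t => RtoC (INR (S j)) * (RtoC (t ^ j) * gauss q t) + - (2 * q) * (RtoC (t ^ S (S j)) * gauss q t))%C (- w) w ltac:(lra)).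
  rewrite CInt_plus in E; [|lra| |].
  2, 3: intros t _; apply Ccont_mult; [apply Ccont_const|apply Ccont_pow_gauss].
  rewrite !CInt_scal in E; try lra; try (intros; apply Ccont_pow_gauss).
  fold (gauss_moment q w j) in E. fold (gauss_moment q w (S (S j))) in E.
  rewrite gauss_even in E.
  assert (E' : (RtoC (INR (S j)) * gauss_moment q w j + - (2 * q) * gauss_moment q w (S (S j)) =
     RtoC (w ^ S j) * gauss q w - RtoC ((- w) ^ S j) * gauss q w)%C).
  { apply E.
    - intros t _. eapply Cderiv_eq.
      + apply Cderiv_mult; [apply Cderiv_real, is_derive_pow_nat|apply Cderiv_gauss].
      + cbv beta. simpl pred. rewrite RtoC_mult. change (t ^ S (S j)) with (t * t ^ S j). rewrite (RtoC_mult t). ring.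
    - intros t _. apply Ccont_plus; apply Ccont_mult; try apply Ccont_const; apply Ccont_pow_gauss. }
  rewrite RtoC_minus.
  replace (2 * q * gauss_moment q w (S (S j)))%C with (RtoC (INR (S j)) * gauss_moment q w j -
    (RtoC (INR (S j)) * gauss_moment q w j + - (2 * q) * gauss_moment q w (S (S j))))%C by ring.
  rewrite E'. ring.
Qed.

Lemma gauss_moment_odd (q : C) (w : R) (j : nat) : 0 <= w -> q <> RtoC 0 ->
  gauss_moment q w (S (2 * j)) = RtoC 0.
Proof.
  intros Hw Hq.
  assert (H2q : (2 * q)%C <> RtoC 0).
  { apply Cmult_neq_0; [|exact Hq]. intro h. apply RtoC_inj in h. lra. }
  assert (Hc : forall z, (2 * q * z)%C = RtoC 0 -> z = RtoC 0).
  { intros z Hz. replace z with (/ (2 * q) * (2 * q * z))%C by (field; exact Hq).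
    rewrite Hz. ring. }
  induction j as [|j IH].
  - apply Hc. assert (E := CInt_derive (gauss q) (fun t => - (2 * q) * (RtoC (t ^ 1) * gauss q t))%C (- w) w ltac:(lra)).
    rewrite CInt_scal in E; [|lra|intros; apply Ccont_pow_gauss].
    fold (gauss_moment q w 1) in E.
    rewrite gauss_even in E. change (S (2 * 0)) with 1%nat.
    replace (2 * q * gauss_moment q w 1)%C with (- (- (2 * q) * gauss_moment q w 1))%C by ring. rewrite E; [ring| |].
    + intros t _. eapply Cderiv_eq; [apply Cderiv_gauss|]. simpl pow. rewrite Rmult_1_r. ring.
    + intros t _. apply Ccont_mult; [apply Ccont_const|apply Ccont_pow_gauss].
  - replace (S (2 * S j)) with (S (S (S (2 * j)))) by lia. apply Hc.
    rewrite gauss_moment_step by exact Hw. rewrite IH.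
    replace ((- w) ^ S (S (2 * j))) with (w ^ S (S (2 * j))).
    + rewrite Rminus_diag. ring.
    + replace (S (S (2 * j))) with (2 * S j)%nat by lia. rewrite !pow_mult. f_equal. ring.
Qed.

Fixpoint double_fact (j : nat) : R :=
  match j with O => 1 | S j => (2 * INR j + 1) * double_fact j end.

(** Accumulated boundary terms of the recurrence. *)
Fixpoint moment_err (j : nat) : R :=
  match j with O => 0 | S j => (2 * INR j + 1) * moment_err j + 2 end.

Lemma gauss_moment_even (q : C) (w : R) (j : nat) : 0 <= w <= 1 -> 1 <= Cmod (2 * q)%C ->
  Cmod (gauss_moment q w (2 * j)%nat - RtoC (double_fact j) / (2 * q) ^ j * gauss_moment q w 0)%C
    <= moment_err j * exp (- (Re q * w ^ 2)).
Proof.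
  intros Hw Hq.
  assert (Hne : (2 * q)%C <> RtoC 0) by (intro h; rewrite h, Cmod_0 in Hq; lra).
  induction j as [|j IH].
  - simpl. replace (_ - _)%C with (RtoC 0) by (field; intro h; apply RtoC_inj in h; lra).
    rewrite Cmod_0. lra.
  - replace (2 * S j)%nat with (S (S (2 * j))) by lia.
    assert (E := gauss_moment_step q w (2 * j) (proj1 Hw)).
    set (P := (2 * q)%C) in *. set (m := gauss_moment q w (S (S (2 * j)))) in *.
    assert (HI : RtoC (INR (S (2 * j))) = RtoC (2 * INR j + 1)) by (f_equal; rewrite S_INR, mult_INR; simpl; ring).
    rewrite HI in E.
    assert (HPj : (P ^ j)%C <> RtoC 0) by (apply Cpow_nz; exact Hne).
    replace (m - RtoC (double_fact (S j)) / P ^ S j * gauss_moment q w 0)%C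
      with (/ P * (RtoC (2 * INR j + 1) * (gauss_moment q w (2 * j)%nat - RtoC (double_fact j) / P ^ j * gauss_moment q w 0)
             - RtoC (w ^ S (2 * j) - (- w) ^ S (2 * j)) * gauss q w))%C.
    2: { change (double_fact (S j)) with ((2 * INR j + 1) * double_fact j). rewrite (RtoC_mult (2 * INR j + 1)).
         replace m with (/ P * (P * m))%C by (field; exact Hne). rewrite E. simpl Cpow. field. split; assumption. }
    rewrite Cmod_mult, Cmod_inv by exact Hne.
    assert (Hinv : 0 < / Cmod P <= 1).
    { split; [apply Rinv_0_lt_compat; lra|]. rewrite <- Rinv_1. apply Rinv_le_contravar; lra. }
    set (b := exp (- (Re q * w ^ 2))) in *.
    assert (Hb : 0 < b) by apply exp_pos.
    apply Rle_trans with (1 * ((2 * INR j + 1) * (moment_err j * b) + 2 * b)).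
    2: { right. simpl. ring. }
    apply Rmult_le_compat; [lra|apply Cmod_ge_0|lra|].
    unfold Cminus at 1. eapply Rle_trans; [apply Cmod_triangle|]. rewrite Cmod_opp, !Cmod_mult, !Cmod_R, Cmod_gauss.
    fold b. pose proof (pos_INR j).
    apply Rplus_le_compat.
    + rewrite Rabs_right by lra. apply Rmult_le_compat_l; [lra|exact IH].
    + apply Rmult_le_compat_r; [lra|].
      assert (Hp : Rabs (w ^ S (2 * j)) <= 1).
      { rewrite Rabs_right by (apply Rle_ge, pow_le; lra). rewrite <- (pow1 (S (2 * j))). apply pow_incr; lra. }
      assert (Hp' : Rabs ((- w) ^ S (2 * j)) <= 1).
      { rewrite <- RPow_abs, Rabs_Ropp, RPow_abs. exact Hp. }
      unfold Rminus. eapply Rle_trans; [apply Rabs_triang|]. rewrite Rabs_Ropp. lra.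
Qed.

(** * Local expansion at the saddle point *)

Lemma Cmod_plus_le (x y : C) (A B : R) : Cmod x <= A -> Cmod y <= B -> Cmod (x + y)%C <= A + B.
Proof. intros; eapply Rle_trans; [apply Cmod_triangle|lra]. Qed.

Lemma Cmod_minus_le (x y : C) (A B : R) : Cmod x <= A -> Cmod y <= B -> Cmod (x - y)%C <= A + B.
Proof. intros; apply Cmod_plus_le; [|rewrite Cmod_opp]; assumption. Qed.

Lemma Cmod_mult_le (x y : C) (A B : R) : Cmod x <= A -> Cmod y <= B -> Cmod (x * y)%C <= A * B.
Proof. intros; rewrite Cmod_mult; apply Rmult_le_compat; try apply Cmod_ge_0; assumption. Qed.

Lemma Cmod_RtoC_le (x A : R) : - A <= x <= A -> Cmod (RtoC x) <= A.
Proof. intros; rewrite Cmod_R; now apply Rabs_le. Qed.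

Fixpoint Ctaylor (m : nat) (z : C) : C :=
  match m with
  | O => 1
  | S m' => Ctaylor m' z + z ^ (S m') * RtoC (/ INR (fact (S m')))
  end%C.

Lemma Cderiv_ray (z : C) (m : nat) (r : R) :
  Cderiv (fun r => (RtoC r * z) ^ S m * RtoC (/ INR (fact (S m))))%C r
    (z * ((RtoC r * z) ^ m * RtoC (/ INR (fact m))))%C.
Proof.
  eapply Cderiv_eq.
  - apply Cderiv_mult; [|apply Cderiv_const]. apply Cderiv_pow.
    apply Cderiv_mult; [apply Cderiv_id|apply Cderiv_const].
  - cbv beta. simpl pred. rewrite fact_simpl, mult_INR, Rinv_mult, !RtoC_mult.
    assert (E : (RtoC (INR (S m)) * RtoC (/ INR (S m)))%C = RtoC 1).
    { rewrite <- RtoC_mult, Rinv_r; [reflexivity|]. apply not_0_INR; lia. }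
    set (P := ((RtoC r * z) ^ m)%C). set (f := RtoC (/ INR (fact m))).
    replace (RtoC (INR (S m)) * P * (1 * z + RtoC r * 0) * (RtoC (/ INR (S m)) * f) +
      ((RtoC r * z) ^ S m) * 0)%C with (RtoC (INR (S m)) * RtoC (/ INR (S m)) * (z * (P * f)))%C by ring.
    rewrite E. ring.
Qed.

(** Induction on the order along the ray [r z]: the derivative of one remainder is
    [z] times the previous one. *)
Lemma Cexp_taylor (z : C) (m : nat) (r : R) : 0 <= r <= 1 ->
  Cmod (Cexp (RtoC r * z) - Ctaylor m (RtoC r * z))%C <= (2 * Cmod z) ^ S m * exp (Cmod z).
Proof.
  assert (Hexp : forall r, 0 <= r <= 1 -> Cmod (Cexp (RtoC r * z)) <= exp (Cmod z)).
  { intros s Hs. rewrite Cmod_Cexp. apply exp_mono. eapply Rle_trans; [apply Rle_abs|].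
    eapply Rle_trans; [apply re_le_Cmod|]. rewrite Cmod_mult, Cmod_R, Rabs_right by lra.
    pose proof (Cmod_ge_0 z). nra. }
  assert (HdE : forall r, Cderiv (fun r => Cexp (RtoC r * z)) r (z * Cexp (RtoC r * z))%C).
  { intro s. eapply Cderiv_eq.
    - apply Cderiv_exp. apply Cderiv_mult; [apply Cderiv_id|apply Cderiv_const].
    - cbv beta. ring. }
  assert (Hz : 0 <= Cmod z) by apply Cmod_ge_0.
  revert r. induction m as [|m IH]; intros r Hr.
  - simpl Ctaylor. rewrite pow_1.
    assert (H := Cderiv_bound (fun r => Cexp (RtoC r * z)) (fun r => (z * Cexp (RtoC r * z))%C) 0 r (Cmod z * exp (Cmod z)) (proj1 Hr)).
    cbv beta in H. replace (RtoC 0 * z)%C with (RtoC 0) in H by ring. rewrite Cexp_0 in H.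
    eapply Rle_trans; [apply H|].
    + intros; apply HdE.
    + intros x Hx. apply Cmod_mult_le; [lra|apply Hexp; lra].
    + rewrite Rminus_0_r. pose proof (exp_pos (Cmod z)).
      assert (0 <= 2 * (Cmod z * exp (Cmod z))) by (apply Rmult_le_pos; [lra|apply Rmult_le_pos; lra]). nra.
  - assert (HdT : forall k r, Cderiv (fun r => Ctaylor (S k) (RtoC r * z)) r (z * Ctaylor k (RtoC r * z))%C).
    { clear. induction k as [|k IHk]; intro r.
      - simpl Ctaylor. eapply Cderiv_eq; [apply Cderiv_plus; [apply Cderiv_const|apply (Cderiv_ray z 0 r)]|].
        replace (/ INR (fact 0)) with 1 by (simpl; field). simpl Cpow. ring.
      - change (fun r => Ctaylor (S (S k)) (RtoC r * z)) with
          (fun r => (Ctaylor (S k) (RtoC r * z) + (RtoC r * z) ^ S (S k) * RtoC (/ INR (fact (S (S k)))))%C).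
        eapply Cderiv_eq; [apply Cderiv_plus; [apply IHk|apply Cderiv_ray]|].
        change (Ctaylor (S k) (RtoC r * z)) with (Ctaylor k (RtoC r * z) + (RtoC r * z) ^ S k * RtoC (/ INR (fact (S k))))%C. ring. }
    assert (H := Cderiv_bound (fun r => Cexp (RtoC r * z) - Ctaylor (S m) (RtoC r * z))%C
      (fun r => (z * (Cexp (RtoC r * z) - Ctaylor m (RtoC r * z)))%C) 0 r
      (Cmod z * ((2 * Cmod z) ^ S m * exp (Cmod z))) (proj1 Hr)).
    cbv beta in H. replace (RtoC 0 * z)%C with (RtoC 0) in H by ring. rewrite Cexp_0 in H.
    assert (HT0 : forall k, Ctaylor k (RtoC 0) = RtoC 1).
    { clear. induction k as [|k IHk]; [reflexivity|]. simpl Ctaylor. rewrite IHk. simpl. ring. }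
    rewrite HT0 in H.
    replace (Cexp (RtoC r * z) - Ctaylor (S m) (RtoC r * z))%C with
      (Cexp (RtoC r * z) - Ctaylor (S m) (RtoC r * z) - (RtoC 1 - RtoC 1))%C by ring.
    eapply Rle_trans; [apply H|].
    + intros x _. eapply Cderiv_eq; [apply Cderiv_minus; [apply HdE|apply HdT]|]. ring.
    + intros x Hx. apply Cmod_mult_le; [lra|]. apply IH; lra.
    + rewrite Rminus_0_r. pose proof (exp_pos (Cmod z)).
      assert (0 <= (2 * Cmod z) ^ S m) by (apply pow_le; lra).
      change ((2 * Cmod z) ^ S (S m)) with (2 * Cmod z * (2 * Cmod z) ^ S m).
      set (Q := (2 * Cmod z) ^ S m) in *.
      assert (0 <= 2 * (Cmod z * (Q * exp (Cmod z)))).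
      { apply Rmult_le_pos; [lra|]. apply Rmult_le_pos; [lra|]. apply Rmult_le_pos; lra. } nra.
Qed.

Lemma Cexp_taylor_1 (z : C) (m : nat) :
  Cmod (Cexp z - Ctaylor m z)%C <= (2 * Cmod z) ^ S m * exp (Cmod z).
Proof.
  assert (H := Cexp_taylor z m 1 ltac:(lra)). replace (RtoC 1 * z)%C with z in H by ring. exact H.
Qed.

Lemma Cpow_one_plus (h : C) (n : nat) : INR n * Cmod h <= 1 / 2 ->
  Cmod ((1 + h) ^ n - 1)%C <= 2 * (INR n * Cmod h).
Proof.
  intro H. assert (Hh := Cmod_ge_0 h). pose proof (pos_INR n) as Hn.
  assert (A : Cmod ((1 + h) ^ n - 1)%C <= (1 + Cmod h) ^ n - 1).
  { clear H Hn. induction n as [|n IH].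
    - simpl. replace (1 - 1)%C with (RtoC 0) by ring. rewrite Cmod_0. lra.
    - replace ((1 + h) ^ S n - 1)%C with ((1 + h) * ((1 + h) ^ n - 1) + h)%C by (simpl; ring).
      assert (H1 : Cmod (1 + h)%C <= 1 + Cmod h) by (apply Cmod_plus_le; [rewrite Cmod_1|]; lra).
      eapply Rle_trans; [apply Cmod_plus_le; [apply Cmod_mult_le; [exact H1|exact IH]|apply Rle_refl]|].
      simpl. lra. }
  assert (B : (1 + Cmod h) ^ n <= exp (INR n * Cmod h)).
  { clear. assert (Hh := Cmod_ge_0 h). induction n as [|n IH]; [simpl; rewrite Rmult_0_l, exp_0; lra|].
    rewrite S_INR, Rmult_plus_distr_r, Rmult_1_l, exp_plus, (Rmult_comm (exp _)). simpl pow.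
    pose proof (exp_ineq1_le (Cmod h)). apply Rmult_le_compat; [lra|apply pow_le; lra|lra|exact IH]. }
  set (y := INR n * Cmod h) in *.
  assert (Hy : 0 <= y) by (apply Rmult_le_pos; lra).
  assert (D : exp y <= / (1 - y)).
  { pose proof (exp_ineq1_le (- y)). rewrite exp_Ropp in *. pose proof (exp_pos y).
    rewrite <- (Rinv_inv (exp y)). apply Rinv_le_contravar; lra. }
  assert (/ (1 - y) <= 1 + 2 * y).
  { apply Rmult_le_reg_l with (1 - y); [lra|]. rewrite Rinv_r by lra. nra. }
  lra.
Qed.

(** Coefficients of [log (1 + i s) - i (e^s - 1)] in powers of [s], where [i]
    is the inverse of the saddle point; those of degree 0 and 1 vanish. *)
Definition ph2 (i : C) : C := (- (i ^ 2) / 2 - i / 2)%C.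
Definition ph3 (i : C) : C := (i ^ 3 / 3 - i / 6)%C.
Definition ph4 (i : C) : C := (- (i ^ 4) / 4 - i / 24)%C.
Definition ph5 (i : C) : C := (i ^ 5 / 5 - i / 120)%C.
Definition ph6 (i : C) : C := (- (i ^ 6) / 6 - i / 720)%C.

Definition phase6 (i s : C) : C :=
  (ph2 i * s ^ 2 + ph3 i * s ^ 3 + ph4 i * s ^ 4 + ph5 i * s ^ 5 + ph6 i * s ^ 6)%C.

Lemma RtoC_neq (x : R) : x <> 0 -> RtoC x <> RtoC 0.
Proof. intros H h. apply RtoC_inj in h. contradiction. Qed.

Lemma Cmod_pow_le (x : C) (A : R) (n : nat) : Cmod x <= A -> Cmod (x ^ n)%C <= A ^ n.
Proof. intro H. rewrite Cmod_pow. apply pow_incr. split; [apply Cmod_ge_0|exact H]. Qed.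

Lemma Cmod_div_le (x : C) (r A B : R) : 0 < r -> Cmod x <= A -> A / r <= B -> Cmod (x / RtoC r)%C <= B.
Proof.
  intros Hr Hx HB. unfold Cdiv. rewrite Cmod_mult, Cmod_inv by (apply RtoC_neq; lra).
  rewrite Cmod_R, Rabs_right by lra. unfold Rdiv in HB. eapply Rle_trans; [|exact HB].
  apply Rmult_le_compat_r; [apply Rlt_le, Rinv_0_lt_compat, Hr|exact Hx].
Qed.

Lemma ph_bounds (i : C) : Cmod i <= 1 / 2 ->
  Cmod (ph2 i) <= 3 / 8 /\ Cmod (ph3 i) <= 1 / 8 /\ Cmod (ph4 i) <= 1 / 16
  /\ Cmod (ph5 i) <= 1 / 16 /\ Cmod (ph6 i) <= 1 / 16.
Proof.
  intro Hi.
  assert (P : forall n, Cmod (i ^ n)%C <= (1 / 2) ^ n) by (intro n; now apply Cmod_pow_le).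
  assert (Pn : forall n, Cmod (- i ^ n)%C <= (1 / 2) ^ n) by (intro n; rewrite Cmod_opp; apply P).
  unfold ph2, ph3, ph4, ph5, ph6.
  repeat split; (eapply Rle_trans; [apply Cmod_minus_le;
    (eapply Cmod_div_le; [|first [apply P|apply Pn|exact Hi]|apply Rle_refl]; lra)|]); lra.
Qed.

(** Truncating the phase after degree 6 costs a factor [1 + O(s^7)].  The factor
    itself is differentiated rather than its logarithm, which would require a
    branch; in the derivative everything cancels up to the last term [i^7 s^6] of
    a geometric sum and the Taylor remainder of [e^s]. *)
Lemma phase_factor (i : C) (s : R) : Cmod i <= 1 / 2 -> Rabs s <= 1 ->
  Cmod ((1 + i * RtoC s) * Cexp (- i * (RtoC (exp s) - 1) - phase6 i (RtoC s)) - 1)%C <= 3000 * Rabs s ^ 7.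
Proof.
  intros Hi Hs.
  destruct (ph_bounds i Hi) as (B2 & B3 & B4 & B5 & B6).
  set (ex := fun r : R => (- i * (RtoC (exp (r * s)) - 1) - phase6 i (RtoC r * RtoC s))%C).
  set (g := fun r : R => ((1 + i * (RtoC r * RtoC s)) * Cexp (ex r))%C).
  set (rem := fun r : R => (RtoC (exp (r * s)) - Ctaylor 5 (RtoC (r * s)))%C).
  set (g' := fun r : R => (RtoC s * (i ^ 7 * (RtoC r * RtoC s) ^ 6 - (1 + i * (RtoC r * RtoC s)) * (i * rem r)) * Cexp (ex r))%C).
  assert (Hd : forall r, Cderiv g r (g' r)).
  { intro r.
    assert (Hs1 : Cderiv (fun r => RtoC r * RtoC s)%C r (RtoC s)).
    { eapply Cderiv_eq; [apply Cderiv_mult; [apply Cderiv_id|apply Cderiv_const]|]. cbv beta. ring. }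
    assert (Hex : Cderiv (fun r => RtoC (exp (r * s))) r (RtoC s * RtoC (exp (r * s)))%C).
    { eapply Cderiv_eq; [apply Cderiv_real; auto_derive; [exact I|reflexivity]|].
      rewrite <- RtoC_mult. f_equal. ring. }
    unfold g. eapply Cderiv_eq.
    - apply Cderiv_mult.
      + apply Cderiv_plus; [apply Cderiv_const|apply Cderiv_scal; exact Hs1].
      + apply Cderiv_exp. unfold ex, phase6. apply Cderiv_minus.
        * apply Cderiv_scal. apply Cderiv_minus; [exact Hex|apply Cderiv_const].
        * do 4 (apply Cderiv_plus; [|apply Cderiv_scal, (Cderiv_pow (fun r => RtoC r * RtoC s)%C); exact Hs1]).
          apply Cderiv_scal, (Cderiv_pow (fun r => RtoC r * RtoC s)%C); exact Hs1.
    - cbv beta. unfold g', rem. simpl Ctaylor. rewrite RtoC_mult.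
      set (x := (RtoC r * RtoC s)%C). set (e := RtoC (exp (r * s))). set (E := Cexp (ex r)).
      cbn [pred INR]. rewrite !RtoC_inv by (simpl; lra).
      replace (RtoC (INR (fact 1))) with (RtoC 1) by (f_equal; simpl; ring).
      replace (RtoC (INR (fact 2))) with (RtoC 2) by (f_equal; simpl; ring).
      replace (RtoC (INR (fact 3))) with (RtoC 6) by (f_equal; simpl; ring).
      replace (RtoC (INR (fact 4))) with (RtoC 24) by (f_equal; simpl; ring).
      replace (RtoC (INR (fact 5))) with (RtoC 120) by (f_equal; simpl; ring).
      rewrite !RtoC_plus. unfold ph2, ph3, ph4, ph5, ph6.
      field. }
  set (a := Rabs s) in *. assert (Ha : 0 <= a) by apply Rabs_pos.
  assert (Hrs : forall r, 0 <= r <= 1 -> Cmod (RtoC r * RtoC s)%C <= a).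
  { intros r Hr. rewrite <- RtoC_mult, Cmod_R, Rabs_mult, (Rabs_right r) by lra. fold a. nra. }
  assert (Hrs1 : forall r, 0 <= r <= 1 -> Cmod (RtoC r * RtoC s)%C <= 1) by (intros r Hr; specialize (Hrs r Hr); lra).
  assert (E3 := exp_le_3).
  assert (Hrem : forall r, 0 <= r <= 1 -> Cmod (rem r) <= 192 * a ^ 6).
  { intros r Hr. unfold rem.
    replace (RtoC (exp (r * s))) with (Cexp (RtoC r * RtoC s)).
    2: { now rewrite <- RtoC_mult, Cexp_real. }
    rewrite RtoC_mult. eapply Rle_trans; [apply Cexp_taylor_1|].
    specialize (Hrs r Hr). set (c := Cmod (RtoC r * RtoC s)%C) in *. assert (0 <= c) by apply Cmod_ge_0.
    assert (exp c <= 3) by (apply Rle_trans with (exp 1); [apply exp_mono; lra|exact E3]).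
    replace (192 * a ^ 6) with ((2 * a) ^ 6 * 3) by ring.
    apply Rmult_le_compat; [apply pow_le; lra|apply Rlt_le, exp_pos| |assumption].
    apply pow_incr; lra. }
  assert (HE : forall r, 0 <= r <= 1 -> Cmod (Cexp (ex r)) <= 9).
  { intros r Hr. rewrite Cmod_Cexp. apply Rle_trans with (exp (1 + 1)).
    2: { rewrite exp_plus. pose proof (exp_pos 1). nra. }
    apply exp_mono. eapply Rle_trans; [apply Rle_abs|]. eapply Rle_trans; [apply re_le_Cmod|].
    unfold ex. apply Cmod_minus_le.
    - replace 1 with (1 / 2 * 2) by field. apply Cmod_mult_le; [rewrite Cmod_opp; exact Hi|].
      rewrite <- RtoC_minus. apply Cmod_RtoC_le.
      assert (Hab : Rabs (r * s) <= 1) by (rewrite Rabs_mult, (Rabs_right r) by lra; fold a; nra).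
      apply Rabs_le_between in Hab.
      assert (exp (r * s) <= 3) by (apply Rle_trans with (exp 1); [apply exp_mono; lra|exact E3]).
      pose proof (exp_pos (r * s)). lra.
    - specialize (Hrs1 r Hr). unfold phase6.
      assert (P : forall k, Cmod ((RtoC r * RtoC s) ^ k)%C <= 1).
      { intro k. rewrite <- (pow1 k). now apply Cmod_pow_le. }
      eapply Rle_trans; [do 4 (apply Cmod_plus_le; [|apply Cmod_mult_le; [eassumption|apply P]]); apply Cmod_mult_le; [eassumption|apply P]|]. lra. }
  assert (Hg' : forall r, 0 <= r <= 1 -> Cmod (g' r) <= 1400 * a ^ 7).
  { intros r Hr. unfold g'.
    assert (Hi7 : Cmod (i ^ 7)%C <= (1 / 2) ^ 7) by (now apply Cmod_pow_le).
    assert (H6 : Cmod ((RtoC r * RtoC s) ^ 6)%C <= a ^ 6) by (apply Cmod_pow_le; now apply Hrs).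
    assert (H1 : Cmod (1 + i * (RtoC r * RtoC s))%C <= 1 + 1 / 2 * 1).
    { apply Cmod_plus_le; [rewrite Cmod_1; lra|]. apply Cmod_mult_le; [exact Hi|now apply Hrs1]. }
    assert (Hsa : Cmod (RtoC s) <= a) by (rewrite Cmod_R; apply Rle_refl).
    eapply Rle_trans.
    - apply Cmod_mult_le; [apply Cmod_mult_le; [exact Hsa|apply Cmod_minus_le]|apply HE; exact Hr].
      + apply Cmod_mult_le; [exact Hi7|exact H6].
      + apply Cmod_mult_le; [exact H1|]. apply Cmod_mult_le; [exact Hi|apply Hrem; exact Hr].
    - assert (0 <= a ^ 7) by (apply pow_le; exact Ha).
      replace (a * ((1 / 2) ^ 7 * a ^ 6 + (1 + 1 / 2 * 1) * (1 / 2 * (192 * a ^ 6))) * 9)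
        with (((1 / 2) ^ 7 + 144) * 9 * a ^ 7) by field. lra. }
  assert (H := Cderiv_bound g g' 0 1 (1400 * a ^ 7) ltac:(lra) (fun x _ => Hd x) Hg').
  assert (Eg0 : g 0 = RtoC 1).
  { unfold g, ex. rewrite Rmult_0_l, exp_0. unfold phase6.
    replace (- i * (1 - 1) - _)%C with (RtoC 0) by ring. rewrite Cexp_0. ring. }
  assert (Eg1 : g 1 = ((1 + i * RtoC s) * Cexp (- i * (RtoC (exp s) - 1) - phase6 i (RtoC s)))%C).
  { unfold g, ex. rewrite Rmult_1_l. replace (RtoC 1 * RtoC s)%C with (RtoC s) by ring. reflexivity. }
  rewrite Eg0, Eg1 in H. eapply Rle_trans; [exact H|].
  assert (0 <= a ^ 7) by (apply pow_le; exact Ha). lra.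
Qed.

(** The ratio of the first harmonic at distance [s] from the saddle point to its
    value at the saddle point [1 / i]. *)
Definition saddle_ratio (n : nat) (i : C) (s : R) : C :=
  ((1 + i * RtoC s) ^ n * Cexp (RtoC (INR n) * (- i * (RtoC (exp s) - 1))))%C.

Definition saddle_q (n : nat) (i : C) : C := (- (RtoC (INR n) * ph2 i))%C.

(** The exponential of the cubic and higher part of [n] times the phase, with
    [g] standing for [n s^2] and terms of degree above 4 in the remaining powers
    of [s] dropped: as [g] stays bounded up to logarithms on the window, those
    are of order [n^(-5/2)]. *)
Definition saddle_poly (i g s : C) : C :=
  (1 + g * (ph3 i * s + ph4 i * s ^ 2 + ph5 i * s ^ 3 + ph6 i * s ^ 4)
   + g ^ 2 * (ph3 i ^ 2 * s ^ 2 + 2 * ph3 i * ph4 i * s ^ 3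
              + (ph4 i ^ 2 + 2 * ph3 i * ph5 i) * s ^ 4) / 2
   + g ^ 3 * (ph3 i ^ 3 * s ^ 3 + 3 * ph3 i ^ 2 * ph4 i * s ^ 4) / 6
   + g ^ 4 * (ph3 i ^ 4 * s ^ 4) / 24)%C.

Lemma saddle_ratio_factor (n : nat) (i : C) (s : R) :
  saddle_ratio n i s = (gauss (saddle_q n i) s
    * (Cexp (RtoC (INR n) * (phase6 i (RtoC s) - ph2 i * RtoC s ^ 2))
    * ((1 + i * RtoC s) * Cexp (- i * (RtoC (exp s) - 1) - phase6 i (RtoC s))) ^ n))%C.
Proof.
  rewrite Cpow_mult_l, <- Cexp_nat_mult. unfold saddle_ratio, gauss, saddle_q.
  set (N := RtoC (INR n)). set (P := phase6 i (RtoC s)). set (A := ((1 + i * RtoC s) ^ n)%C).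
  set (e := (- i * (RtoC (exp s) - 1))%C). set (a2 := ph2 i).
  rewrite RtoC_pow.
  replace (N * e)%C with (- - (N * a2) * RtoC s ^ 2 + (N * (P - a2 * RtoC s ^ 2) + N * (e - P)))%C by ring.
  rewrite !Cexp_plus. ring.
Qed.

Lemma Ctaylor_4 (z : C) : Ctaylor 4 z = (1 + z + z ^ 2 / 2 + z ^ 3 / 6 + z ^ 4 / 24)%C.
Proof.
  assert (H : forall k, RtoC (/ INR (fact k)) = (/ RtoC (INR (fact k)))%C).
  { intro k. apply RtoC_inv, INR_fact_neq_0. }
  unfold Ctaylor. rewrite !H.
  replace (INR (fact 1)) with 1 by (simpl; ring).
  replace (INR (fact 2)) with 2 by (simpl; ring).
  replace (INR (fact 3)) with 6 by (simpl; ring).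
  replace (INR (fact 4)) with 24 by (simpl; ring).
  field.
Qed.

(** With [z = g s (a3 + s b)] each power of [a3 + s b] is split into the terms that
    are kept and a remainder divisible by the power of [s] that completes
    [s^5]. *)
Lemma saddle_poly_approx (i : C) (g s G : R) : Cmod i <= 1 / 2 -> Rabs s <= 1 ->
  0 <= g <= G -> 1 <= G ->
  Cmod (Ctaylor 4 (RtoC g * RtoC s * (ph3 i + RtoC s * (ph4 i + ph5 i * RtoC s + ph6 i * RtoC s ^ 2)))
        - saddle_poly i (RtoC g) (RtoC s))%C <= 6 * G ^ 4 * Rabs s ^ 5.
Proof.
  intros Hi Hs Hg HG.
  destruct (ph_bounds i Hi) as (_ & B3 & B4 & B5 & B6).
  set (x := RtoC s). set (y := RtoC g).
  set (b := (ph4 i + ph5 i * x + ph6 i * x ^ 2)%C).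
  set (a3 := ph3 i) in *. set (a4 := ph4 i) in *. set (a5 := ph5 i) in *. set (a6 := ph6 i) in *.
  set (R2 := (2 * (a3 * a6) + (a5 + a6 * x) * (b + a4))%C).
  set (R3 := (3 * (a3 * a3) * (a5 + a6 * x) + 3 * a3 * (b * b) + b * (b * b) * x)%C).
  set (R4 := (4 * (a3 * (a3 * a3)) * b + 6 * (a3 * a3) * (b * b) * x + 4 * a3 * (b * (b * b)) * (x * x) + b * b * (b * b) * (x * (x * x)))%C).
  replace (Ctaylor 4 (y * x * (a3 + x * b)) - saddle_poly i y x)%C
    with (x ^ 5 * (y ^ 2 * (R2 * RtoC (/ 2)) + y ^ 3 * (R3 * RtoC (/ 6)) + y ^ 4 * (R4 * RtoC (/ 24))))%C.
  2: { unfold saddle_poly, R2, R3, R4. fold a3 a4 a5 a6. rewrite Ctaylor_4.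
       rewrite !RtoC_inv by lra. unfold b. clearbody a3 a4 a5 a6 x y. field. }
  assert (Hx : Cmod x <= 1) by (unfold x; rewrite Cmod_R; exact Hs).
  assert (Hx2 : Cmod (x ^ 2)%C <= 1) by (rewrite <- (pow1 2); now apply Cmod_pow_le).
  assert (Hb : Cmod b <= 3 / 16).
  { unfold b. eapply Rle_trans; [apply Cmod_plus_le; [apply Cmod_plus_le; [exact B4|]|]|];
    [apply Cmod_mult_le; [exact B5|exact Hx]|apply Cmod_mult_le; [exact B6|exact Hx2]|lra]. }
  assert (Hc : Cmod (a5 + a6 * x)%C <= 1 / 8).
  { eapply Rle_trans; [apply Cmod_plus_le; [exact B5|apply Cmod_mult_le; [exact B6|exact Hx]]|lra]. }
  assert (Hr : forall r, 0 <= r -> Cmod (RtoC r) <= r) by (intros; apply Cmod_RtoC_le; lra).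
  assert (H33 : Cmod (a3 * a3)%C <= 1 / 8 * (1 / 8)) by (apply Cmod_mult_le; exact B3).
  assert (Hbb : Cmod (b * b)%C <= 3 / 16 * (3 / 16)) by (apply Cmod_mult_le; exact Hb).
  assert (Hbbb : Cmod (b * (b * b))%C <= 3 / 16 * (3 / 16 * (3 / 16))) by (apply Cmod_mult_le; assumption).
  assert (Hxx : Cmod (x * x)%C <= 1 * 1) by (apply Cmod_mult_le; exact Hx).
  assert (HR2 : Cmod (R2 * RtoC (/ 2))%C <= 2).
  { unfold R2. eapply Rle_trans; [apply Cmod_mult_le; [apply Cmod_plus_le|apply Hr; lra]|].
    - apply Cmod_mult_le; [apply Hr; lra|apply Cmod_mult_le; [exact B3|exact B6]].
    - apply Cmod_mult_le; [exact Hc|apply Cmod_plus_le; [exact Hb|exact B4]].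
    - lra. }
  assert (HR3 : Cmod (R3 * RtoC (/ 6))%C <= 2).
  { unfold R3. eapply Rle_trans; [apply Cmod_mult_le; [apply Cmod_plus_le; [apply Cmod_plus_le|]|apply Hr; lra]|].
    - apply Cmod_mult_le; [apply Cmod_mult_le; [apply Hr; lra|exact H33]|exact Hc].
    - apply Cmod_mult_le; [apply Cmod_mult_le; [apply Hr; lra|exact B3]|exact Hbb].
    - apply Cmod_mult_le; [exact Hbbb|exact Hx].
    - lra. }
  assert (HR4 : Cmod (R4 * RtoC (/ 24))%C <= 2).
  { unfold R4. eapply Rle_trans; [apply Cmod_mult_le; [apply Cmod_plus_le; [apply Cmod_plus_le; [apply Cmod_plus_le|]|]|apply Hr; lra]|].
    - apply Cmod_mult_le; [apply Cmod_mult_le; [apply Hr; lra|apply Cmod_mult_le; [exact B3|exact H33]]|exact Hb].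
    - apply Cmod_mult_le; [apply Cmod_mult_le; [apply Cmod_mult_le; [apply Hr; lra|exact H33]|exact Hbb]|exact Hx].
    - apply Cmod_mult_le; [apply Cmod_mult_le; [apply Cmod_mult_le; [apply Hr; lra|exact B3]|exact Hbbb]|exact Hxx].
    - apply Cmod_mult_le; [apply Cmod_mult_le; [exact Hbb|exact Hbb]|apply Cmod_mult_le; [exact Hx|exact Hxx]].
    - lra. }
  assert (Hy : Cmod y <= G) by (apply Cmod_RtoC_le; lra).
  assert (Hyk : forall k, Cmod (y ^ k)%C <= G ^ k) by (intro k; now apply Cmod_pow_le).
  assert (Hx5 : Cmod (x ^ 5)%C <= Rabs s ^ 5) by (apply Cmod_pow_le; unfold x; rewrite Cmod_R; apply Rle_refl).
  eapply Rle_trans.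
  - apply Cmod_mult_le; [exact Hx5|apply Cmod_plus_le; [apply Cmod_plus_le|]];
      (apply Cmod_mult_le; [apply Hyk|eassumption]).
  - assert (0 <= Rabs s ^ 5) by (apply pow_le, Rabs_pos).
    assert (G ^ 2 <= G ^ 4) by (apply Rle_pow; [lra|lia]).
    assert (G ^ 3 <= G ^ 4) by (apply Rle_pow; [lra|lia]).
    rewrite (Rmult_comm (6 * G ^ 4)). apply Rmult_le_compat_l; [assumption|lra].
Qed.

(** Three errors are collected: the truncation of the phase, which is raised to
    the n-th power, that of the exponential series, and that of its polynomial
    arguments. *)
Lemma saddle_ratio_approx (n : nat) (i : C) (s G : R) : Cmod i <= 1 / 2 -> Rabs s <= 1 ->
  0 <= Re (saddle_q n i) -> INR n * s ^ 2 <= G -> 1 <= G -> 10000 * (G * Rabs s) <= 1 ->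
  Cmod (saddle_ratio n i s - gauss (saddle_q n i) s * saddle_poly i (RtoC (INR n * s ^ 2)) (RtoC s))%C
    <= 20000 * G ^ 5 * Rabs s ^ 5.
Proof.
  intros Hi Hs Hq Hg HG HGs.
  rewrite saddle_ratio_factor.
  assert (Heta := phase_factor i s Hi Hs).
  set (h := ((1 + i * RtoC s) * Cexp (- i * (RtoC (exp s) - 1) - phase6 i (RtoC s)) - 1)%C) in *.
  replace ((1 + i * RtoC s) * Cexp (- i * (RtoC (exp s) - 1) - phase6 i (RtoC s)))%C with (1 + h)%C by (unfold h; ring).
  set (y := INR n * s ^ 2) in *.
  assert (Hy : 0 <= y) by (apply Rmult_le_pos; [apply pos_INR|apply pow2_ge_0]).
  replace (RtoC (INR n) * (phase6 i (RtoC s) - ph2 i * RtoC s ^ 2))%C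
    with (RtoC y * RtoC s * (ph3 i + RtoC s * (ph4 i + ph5 i * RtoC s + ph6 i * RtoC s ^ 2)))%C.
  2: { unfold y, phase6. rewrite RtoC_mult, RtoC_pow. ring. }
  assert (HT := saddle_poly_approx i y s G Hi Hs (conj Hy Hg) HG).
  set (z := (RtoC y * RtoC s * (ph3 i + RtoC s * (ph4 i + ph5 i * RtoC s + ph6 i * RtoC s ^ 2)))%C) in *.
  set (K := saddle_poly i (RtoC y) (RtoC s)) in *.
  set (a := Rabs s) in *. assert (Ha : 0 <= a) by apply Rabs_pos.
  assert (Ha5 : 0 <= a ^ 5) by (apply pow_le; exact Ha).
  assert (Hz : Cmod z <= G * a).
  { destruct (ph_bounds i Hi) as (_ & B3 & B4 & B5 & B6).
    assert (Hx : Cmod (RtoC s) <= 1) by (rewrite Cmod_R; exact Hs).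
    assert (Hx2 : Cmod (RtoC s ^ 2)%C <= 1) by (rewrite <- (pow1 2); now apply Cmod_pow_le).
    unfold z. rewrite <- (Rmult_1_r (G * a)). apply Cmod_mult_le.
    - apply Cmod_mult_le; [apply Cmod_RtoC_le; lra|rewrite Cmod_R; apply Rle_refl].
    - eapply Rle_trans; [apply Cmod_plus_le; [exact B3|apply Cmod_mult_le; [exact Hx|apply Cmod_plus_le; [apply Cmod_plus_le; [exact B4|]|]]]|].
      + apply Cmod_mult_le; [exact B5|exact Hx].
      + apply Cmod_mult_le; [exact B6|exact Hx2].
      + lra. }
  assert (Hz1 : exp (Cmod z) <= 3) by (apply Rle_trans with (exp 1); [apply exp_mono; lra|apply exp_le_3]).
  assert (HE : Cmod (Cexp z) <= 3).
  { rewrite Cmod_Cexp. eapply Rle_trans; [|exact Hz1]. apply exp_mono.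
    eapply Rle_trans; [apply Rle_abs|apply re_le_Cmod]. }
  assert (Hexp : Cmod (Cexp z - Ctaylor 4 z)%C <= 96 * (G ^ 5 * a ^ 5)).
  { eapply Rle_trans; [apply Cexp_taylor_1|].
    replace (96 * (G ^ 5 * a ^ 5)) with ((2 * (G * a)) ^ 5 * 3) by ring.
    apply Rmult_le_compat; [apply pow_le; pose proof (Cmod_ge_0 z); lra|apply Rlt_le, exp_pos| |exact Hz1].
    apply pow_incr. pose proof (Cmod_ge_0 z). lra. }
  assert (Hnh : INR n * Cmod h <= 3000 * (G * a ^ 5)).
  { apply Rle_trans with (INR n * (3000 * a ^ 7)); [apply Rmult_le_compat_l; [apply pos_INR|exact Heta]|].
    replace (INR n * (3000 * a ^ 7)) with (3000 * ((INR n * a ^ 2) * a ^ 5)) by ring.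
    unfold a at 1. rewrite pow2_abs. fold y. apply Rmult_le_compat_l; [lra|]. apply Rmult_le_compat_r; lra. }
  assert (Ha4 : a ^ 5 <= a).
  { replace (a ^ 5) with (a * a ^ 4) by ring. assert (a ^ 4 <= 1) by (rewrite <- (pow1 4); apply pow_incr; lra). nra. }
  assert (Hnh2 : INR n * Cmod h <= 1 / 2).
  { eapply Rle_trans; [exact Hnh|]. assert (G * a ^ 5 <= G * a) by (apply Rmult_le_compat_l; lra). lra. }
  assert (Hpow := Cpow_one_plus h n Hnh2).
  replace (gauss (saddle_q n i) s * (Cexp z * (1 + h) ^ n) - gauss (saddle_q n i) s * K)%C
    with (gauss (saddle_q n i) s * (Cexp z * ((1 + h) ^ n - 1) + (Cexp z - Ctaylor 4 z) + (Ctaylor 4 z - K)))%C by ring.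
  assert (Hgm : Cmod (gauss (saddle_q n i) s) <= 1).
  { rewrite Cmod_gauss, <- exp_0. apply exp_mono. pose proof (pow2_ge_0 s). nra. }
  eapply Rle_trans.
  - apply Cmod_mult_le; [exact Hgm|]. apply Cmod_plus_le; [apply Cmod_plus_le|].
    + apply Cmod_mult_le; [exact HE|]. eapply Rle_trans; [exact Hpow|]. apply Rmult_le_compat_l; [lra|exact Hnh].
    + exact Hexp.
    + exact HT.
  - assert (G <= G ^ 5) by (rewrite <- (pow_1 G) at 1; apply Rle_pow; [lra|lia]).
    assert (G ^ 4 <= G ^ 5) by (apply Rle_pow; [lra|lia]).
    assert (G * a ^ 5 <= G ^ 5 * a ^ 5) by (apply Rmult_le_compat_r; lra).
    assert (G ^ 4 * a ^ 5 <= G ^ 5 * a ^ 5) by (apply Rmult_le_compat_r; lra).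
    replace (6 * G ^ 4 * a ^ 5) with (6 * (G ^ 4 * a ^ 5)) by ring.
    replace (20000 * G ^ 5 * a ^ 5) with (20000 * (G ^ 5 * a ^ 5)) by ring. 
    assert (0 <= G ^ 5 * a ^ 5) by (apply Rmult_le_pos; [apply pow_le|]; lra). lra.
Qed.

Lemma CInt_minus f g a b :
  a <= b -> (forall t, a <= t <= b -> Ccont f t) -> (forall t, a <= t <= b -> Ccont g t) ->
  CInt (fun t => f t - g t)%C a b = (CInt f a b - CInt g a b)%C.
Proof.
  intros Hab Hf Hg.
  rewrite (CInt_ext (fun t => f t - g t)%C (fun t => f t + (- (1)) * g t)%C) by (try exact Hab; intros; ring).
  rewrite CInt_plus, CInt_scal; try assumption; [ring|].
  intros t Ht. apply Ccont_mult; [apply Ccont_const|now apply Hg].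
Qed.

Lemma Ccont_saddle_ratio n i t : Ccont (saddle_ratio n i) t.
Proof.
  unfold saddle_ratio. eapply Cderiv_cont. apply Cderiv_mult.
  - apply (Cderiv_pow (fun s => 1 + i * RtoC s)%C).
    apply Cderiv_plus; [apply Cderiv_const|apply Cderiv_scal, Cderiv_id].
  - apply Cderiv_exp. apply Cderiv_scal, Cderiv_scal. apply Cderiv_minus; [|apply Cderiv_const].
    apply Cderiv_real, is_derive_exp.
Qed.

(** Coefficients of the even powers of [s] in [saddle_poly]; the odd ones integrate
    to 0 against the Gaussian. *)
Definition sc4 (N i : C) : C := (N * ph4 i)%C.
Definition sc6 (N i : C) : C := (N * ph6 i + N ^ 2 * ph3 i ^ 2 / 2)%C.
Definition sc8 (N i : C) : C := (N ^ 2 * (ph4 i ^ 2 + 2 * ph3 i * ph5 i) / 2)%C.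
Definition sc10 (N i : C) : C := (N ^ 3 * ph3 i ^ 2 * ph4 i / 2)%C.
Definition sc12 (N i : C) : C := (N ^ 4 * ph3 i ^ 4 / 24)%C.

Definition saddle_series (N i P : C) : C :=
  (1 + sc4 N i * (3 / P ^ 2) + sc6 N i * (15 / P ^ 3) + sc8 N i * (105 / P ^ 4)
   + sc10 N i * (945 / P ^ 5) + sc12 N i * (10395 / P ^ 6))%C.

(** Replacing each even power of [s] by its Gaussian moment reproduces the two
    coefficients of the expansion exactly: every term contributes only to the
    orders [N^-1] and [N^-2]. *)
Lemma saddle_series_eq (N t : C) : N <> RtoC 0 -> t <> RtoC 0 -> (1 + t)%C <> RtoC 0 ->
  saddle_series N (/ t) (N * ((1 + t) / t ^ 2)) = (1 + cd1 t / N + cd2 t / N ^ 2)%C.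
Proof.
  intros HN Ht H1. unfold saddle_series, sc4, sc6, sc8, sc10, sc12, ph3, ph4, ph5, ph6, cd1, cd2, wp2, wp4.
  field. repeat split; assumption.
Qed.

Lemma saddle_poly_moments n i w : 0 <= w ->  saddle_q n i <> RtoC 0 ->
  let q := saddle_q n i in let N := RtoC (INR n) in
  CInt (fun s => gauss q s * saddle_poly i (RtoC (INR n * s ^ 2)) (RtoC s))%C (- w) w
  = (gauss_moment q w 0 + sc4 N i * gauss_moment q w 4 + sc6 N i * gauss_moment q w 6
     + sc8 N i * gauss_moment q w 8 + sc10 N i * gauss_moment q w 10 + sc12 N i * gauss_moment q w 12)%C.
Proof.
  intros Hw Hq q N.
  set (c3 := (N * ph3 i)%C). set (c5 := (N * ph5 i)%C). set (c7 := (N ^ 2 * (ph3 i * ph4 i))%C).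
  set (c9 := (N ^ 3 * ph3 i ^ 3 / 6)%C).
  set (m := fun j s => (RtoC (s ^ j) * gauss q s)%C).
  rewrite (CInt_ext _ (fun s => m 0%nat s + sc4 N i * m 4%nat s + sc6 N i * m 6%nat s + sc8 N i * m 8%nat s
     + sc10 N i * m 10%nat s + sc12 N i * m 12%nat s + c3 * m 3%nat s + c5 * m 5%nat s + c7 * m 7%nat s + c9 * m 9%nat s)%C); [|lra|].
  2: { intros s _. unfold m, saddle_poly, sc4, sc6, sc8, sc10, sc12, c3, c5, c7, c9.
       rewrite !RtoC_mult, !RtoC_pow. fold N. simpl Cpow at 1. field. }
  assert (Hm : forall j t, Ccont (m j) t) by (intros; apply Ccont_pow_gauss).
  assert (Hcm : forall c j t, Ccont (fun s => c * m j s)%C t) by (intros; apply Ccont_mult; [apply Ccont_const|apply Hm]).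
  assert (step : forall f c j, (forall t, Ccont f t) ->
    (forall t, Ccont (fun s => f s + c * m j s)%C t) /\
    CInt (fun s => f s + c * m j s)%C (- w) w = (CInt f (- w) w + c * gauss_moment q w j)%C).
  { intros f c j Hf. split; [intro t; apply Ccont_plus; [apply Hf|apply Hcm]|].
    rewrite CInt_plus; [|lra|intros; apply Hf|intros; apply Hcm]. f_equal.
    apply CInt_scal; [lra|intros; apply Hm]. }
  destruct (step (m 0%nat) (sc4 N i) 4%nat (Hm 0%nat)) as [C1 E1].
  destruct (step _ (sc6 N i) 6%nat C1) as [C2 E2].
  destruct (step _ (sc8 N i) 8%nat C2) as [C3 E3].
  destruct (step _ (sc10 N i) 10%nat C3) as [C4 E4].
  destruct (step _ (sc12 N i) 12%nat C4) as [C5 E5].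
  destruct (step _ c3 3%nat C5) as [C6 E6].
  destruct (step _ c5 5%nat C6) as [C7 E7].
  destruct (step _ c7 7%nat C7) as [C8 E8].
  destruct (step _ c9 9%nat C8) as [C9 E9].
  rewrite E9, E8, E7, E6, E5, E4, E3, E2, E1.
  change (gauss_moment q w 3) with (gauss_moment q w (S (2 * 1))).
  change (gauss_moment q w 5) with (gauss_moment q w (S (2 * 2))).
  change (gauss_moment q w 7) with (gauss_moment q w (S (2 * 3))).
  change (gauss_moment q w 9) with (gauss_moment q w (S (2 * 4))).
  rewrite !gauss_moment_odd by assumption.
  change (CInt (m 0%nat) (- w) w) with (gauss_moment q w 0). ring.
Qed.

Lemma gauss_moment_0 q w : 0 <= w -> gauss_moment q w 0 = CInt (gauss q) (- w) w.
Proof.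
  intro Hw. apply CInt_ext; [lra|]. intros t _. simpl. ring.
Qed.

Lemma saddle_coef_bounds (N : R) (i : C) : 1 <= N -> Cmod i <= 1 / 2 ->
  Cmod (sc4 (RtoC N) i) <= N ^ 4 /\ Cmod (sc6 (RtoC N) i) <= N ^ 4 /\ Cmod (sc8 (RtoC N) i) <= N ^ 4
  /\ Cmod (sc10 (RtoC N) i) <= N ^ 4 /\ Cmod (sc12 (RtoC N) i) <= N ^ 4.
Proof.
  intros HN Hi. destruct (ph_bounds i Hi) as (_ & B3 & B4 & B5 & B6).
  assert (P : forall k, Cmod (RtoC N ^ k)%C <= N ^ k).
  { intro k. apply Cmod_pow_le. rewrite Cmod_R, Rabs_right; lra. }
  assert (HN0 : Cmod (RtoC N) <= N) by (rewrite Cmod_R, Rabs_right; lra).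
  assert (L1 : N <= N ^ 4) by (rewrite <- (pow_1 N) at 1; apply Rle_pow; [lra|lia]).
  assert (L2 : N ^ 2 <= N ^ 4) by (apply Rle_pow; [lra|lia]).
  assert (L3 : N ^ 3 <= N ^ 4) by (apply Rle_pow; [lra|lia]).
  assert (H2 : Cmod (RtoC 2) <= 2) by (rewrite Cmod_R, Rabs_right; lra).
  unfold sc4, sc6, sc8, sc10, sc12. repeat split.
  - eapply Rle_trans; [apply Cmod_mult_le; [exact HN0|exact B4]|lra].
  - eapply Rle_trans; [apply Cmod_plus_le; [apply Cmod_mult_le; [exact HN0|exact B6]|]|].
    + apply (Cmod_div_le _ 2 (N ^ 2 * (1 / 8) ^ 2) (N ^ 2 * (1 / 8) ^ 2 / 2)); [lra| |lra].
      apply Cmod_mult_le; [apply P|now apply Cmod_pow_le].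
    + lra.
  - apply (Cmod_div_le _ 2 (N ^ 2 * ((1 / 16) ^ 2 + 2 * (1 / 8) * (1 / 16)))); [lra| |].
    + apply Cmod_mult_le; [apply P|]. apply Cmod_plus_le; [now apply Cmod_pow_le|].
      apply Cmod_mult_le; [apply Cmod_mult_le; assumption|exact B5].
    + lra.
  - apply (Cmod_div_le _ 2 (N ^ 3 * (1 / 8) ^ 2 * (1 / 16))); [lra| |lra].
    apply Cmod_mult_le; [apply Cmod_mult_le; [apply P|now apply Cmod_pow_le]|exact B4].
  - apply (Cmod_div_le _ 24 (N ^ 4 * (1 / 8) ^ 4)); [lra| |lra].
    apply Cmod_mult_le; [apply P|now apply Cmod_pow_le].
Qed.

(** The first error is the pointwise one times the length of the window.  The
    second gathers what the finite window does to the moments and to the total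
    mass; it carries the value of the Gaussian at the edge. *)
Lemma saddle_window_integral (n : nat) (i g0 : C) (w G : R) :
  (1 <= n)%nat -> Cmod i <= 1 / 2 ->
  let q := saddle_q n i in let N := INR n in
  1 <= Cmod (2 * q)%C -> 0 < Re q -> Rabs (Im q) <= Re q ->
  (q * (g0 * g0) = RtoC PI)%C -> Cmod g0 / 2 <= Re g0 -> Cmod g0 <= 1 ->
  0 < w <= 1 -> N * w ^ 2 <= G -> 1 <= G -> 10000 * (G * w) <= 1 ->
  Cmod (CInt (saddle_ratio n i) (- w) w - g0 * saddle_series (RtoC N) i (2 * q))%C
    <= 80000 * G ^ 5 * w ^ 6 + 105000 * N ^ 4 * exp (- (Re q * w ^ 2)).
Proof.
  intros Hn Hi q N HP Hq Hq' Hg0 Hg0r Hg01 Hw HG HG1 HGw.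
  assert (HN : 1 <= N) by (apply (le_INR 1); exact Hn).
  assert (Hq0 : q <> RtoC 0) by (intro h; rewrite h in Hq; simpl in Hq; lra).
  set (b := exp (- (Re q * w ^ 2))). assert (Hb : 0 < b) by apply exp_pos.
  set (K := fun s => (gauss q s * saddle_poly i (RtoC (N * s ^ 2)) (RtoC s))%C).
  assert (HK : forall t, Ccont K t).
  { intro t. unfold K, saddle_poly. apply Ccont_mult; [apply Ccont_gauss|].
    assert (Hsq : Cderiv (fun s => RtoC (N * s ^ 2)) t (RtoC (N * (2 * t)))).
    { apply Cderiv_real. auto_derive; [exact I|ring]. }
    assert (Hid := Cderiv_id t).
    assert (HpN : forall k, Ccont (fun s => RtoC (N * s ^ 2) ^ k)%C t) by (intro k; eapply Cderiv_cont, (Cderiv_pow (fun s => RtoC (N * s ^ 2))), Hsq).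
    assert (Hps : forall k, Ccont (fun s => RtoC s ^ k)%C t) by (intro k; eapply Cderiv_cont, (Cderiv_pow (fun s => RtoC s)), Hid).
    assert (Hs1 := Cderiv_cont _ _ _ Hid). assert (HN1 := Cderiv_cont _ _ _ Hsq).
    assert (Hcs : forall c k, Ccont (fun s => c * RtoC s ^ k)%C t) by (intros c k; apply Ccont_mult; [apply Ccont_const|apply Hps]).
    apply Ccont_plus; [apply Ccont_plus; [apply Ccont_plus; [apply Ccont_plus; [apply Ccont_const|]|]|]|].
    - apply Ccont_mult; [exact HN1|]. do 3 (apply Ccont_plus; [|apply Hcs]).
      apply Ccont_mult; [apply Ccont_const|exact Hs1].
    - apply Ccont_mult; [|apply Ccont_const]. apply Ccont_mult; [apply HpN|].
      do 2 (apply Ccont_plus; [|apply Hcs]). apply Hcs.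
    - apply Ccont_mult; [|apply Ccont_const]. apply Ccont_mult; [apply HpN|].
      apply Ccont_plus; apply Hcs.
    - apply Ccont_mult; [|apply Ccont_const]. apply Ccont_mult; [apply HpN|apply Hcs]. }
  assert (HJ : Cmod (CInt (saddle_ratio n i) (- w) w - CInt K (- w) w)%C <= 80000 * G ^ 5 * w ^ 6).
  { rewrite <- CInt_minus; [|lra|intros; apply Ccont_saddle_ratio|intros; apply HK].
    replace (80000 * G ^ 5 * w ^ 6) with (2 * (20000 * G ^ 5 * w ^ 5) * (w - - w)) by ring.
    apply CInt_bound; [lra| |].
    - intros t _. apply (Ccont_ext (fun s => saddle_ratio n i s + - K s)%C); [reflexivity|].
      apply Ccont_plus; [apply Ccont_saddle_ratio|apply Ccont_opp, HK].
    - intros s Hs. assert (Hsw : Rabs s <= w) by (apply Rabs_le; lra).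
      assert (Hs2 : s ^ 2 <= w ^ 2) by (rewrite <- (pow2_abs s); apply pow_incr; split; [apply Rabs_pos|exact Hsw]).
      eapply Rle_trans; [apply (saddle_ratio_approx n i s G Hi)|].
      + lra.
      + fold q; lra.
      + eapply Rle_trans; [|exact HG]. apply Rmult_le_compat_l; [fold N; lra|exact Hs2].
      + exact HG1.
      + assert (G * Rabs s <= G * w) by (apply Rmult_le_compat_l; lra). lra.
      + assert (Rabs s ^ 5 <= w ^ 5) by (apply pow_incr; split; [apply Rabs_pos|exact Hsw]).
        assert (0 <= G ^ 5) by (apply pow_le; lra). nra. }
  assert (HM := saddle_poly_moments n i w ltac:(lra) Hq0). cbv zeta in HM. fold q in HM. fold N in HM.
  change (CInt K (- w) w = (gauss_moment q w 0 + sc4 (RtoC N) i * gauss_moment q w 4 + sc6 (RtoC N) i * gauss_moment q w 6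
     + sc8 (RtoC N) i * gauss_moment q w 8 + sc10 (RtoC N) i * gauss_moment q w 10 + sc12 (RtoC N) i * gauss_moment q w 12)%C) in HM.
  rewrite HM in HJ. clear HM.
  assert (Hev := fun j => gauss_moment_even q w j ltac:(lra) HP). fold b in Hev.
  assert (Hv := gauss_value q g0 w (proj1 Hw) Hq Hq' Hg0 Hg0r). fold b in Hv.
  rewrite <- gauss_moment_0 in Hv by lra.
  set (P := (2 * q)%C) in *. set (m0 := gauss_moment q w 0) in *.
  assert (HP0 : P <> RtoC 0) by (intro h; rewrite h, Cmod_0 in HP; lra).
  assert (H2 := Hev 2%nat). assert (H3 := Hev 3%nat). assert (H4 := Hev 4%nat).
  assert (H5 := Hev 5%nat). assert (H6 := Hev 6%nat). clear Hev.
  cbn [double_fact moment_err INR Nat.mul Nat.add] in H2, H3, H4, H5, H6.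
  destruct (saddle_coef_bounds N i HN Hi) as (K4 & K6 & K8 & K10 & K12).
  set (k4 := sc4 (RtoC N) i) in *. set (k6 := sc6 (RtoC N) i) in *. set (k8 := sc8 (RtoC N) i) in *.
  set (k10 := sc10 (RtoC N) i) in *. set (k12 := sc12 (RtoC N) i) in *.
  set (M4 := gauss_moment q w 4) in *. set (M6 := gauss_moment q w 6) in *. set (M8 := gauss_moment q w 8) in *.
  set (M10 := gauss_moment q w 10) in *. set (M12 := gauss_moment q w 12) in *.
  assert (D2 : Cmod (M4 - 3 / P ^ 2 * m0)%C <= 8 * b).
  { eapply Rle_trans; [|eapply Rle_trans; [exact H2|]]; [|lra]. right. do 4 f_equal. f_equal. ring. }
  assert (D3 : Cmod (M6 - 15 / P ^ 3 * m0)%C <= 42 * b).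
  { eapply Rle_trans; [|eapply Rle_trans; [exact H3|]]; [|lra]. right. do 4 f_equal. f_equal. ring. }
  assert (D4 : Cmod (M8 - 105 / P ^ 4 * m0)%C <= 296 * b).
  { eapply Rle_trans; [|eapply Rle_trans; [exact H4|]]; [|lra]. right. do 4 f_equal. f_equal. ring. }
  assert (D5 : Cmod (M10 - 945 / P ^ 5 * m0)%C <= 2666 * b).
  { eapply Rle_trans; [|eapply Rle_trans; [exact H5|]]; [|lra]. right. do 4 f_equal. f_equal. ring. }
  assert (D6 : Cmod (M12 - 10395 / P ^ 6 * m0)%C <= 29328 * b).
  { eapply Rle_trans; [|eapply Rle_trans; [exact H6|]]; [|lra]. right. do 4 f_equal. f_equal. ring. }
  set (S := saddle_series (RtoC N) i P).
  assert (HN4 : 1 <= N ^ 4) by (apply pow_R1_Rle; exact HN).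
  assert (HS : Cmod S <= 12000 * N ^ 4).
  { assert (Hpk : forall r k, 0 <= r -> Cmod (RtoC r / P ^ k)%C <= r).
    { intros r k Hr. unfold Cdiv. rewrite Cmod_mult, Cmod_inv by (apply Cpow_nz; exact HP0).
      rewrite Cmod_R, Rabs_right, Cmod_pow by lra.
      assert (Hk : 1 <= Cmod P ^ k) by (apply pow_R1_Rle; exact HP).
      assert (/ Cmod P ^ k <= 1) by (rewrite <- Rinv_1; apply Rinv_le_contravar; lra). nra. }
    unfold S, saddle_series. fold k4 k6 k8 k10 k12.
    eapply Rle_trans; [do 5 (apply Cmod_plus_le; [|apply Cmod_mult_le; [eassumption|apply Hpk; lra]]); rewrite Cmod_1; apply Rle_refl|].
    lra. }
  replace (CInt (saddle_ratio n i) (- w) w - g0 * S)%C with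
    ((CInt (saddle_ratio n i) (- w) w - (m0 + k4 * M4 + k6 * M6 + k8 * M8 + k10 * M10 + k12 * M12))
      + ((k4 * (M4 - 3 / P ^ 2 * m0) + k6 * (M6 - 15 / P ^ 3 * m0) + k8 * (M8 - 105 / P ^ 4 * m0)
         + k10 * (M10 - 945 / P ^ 5 * m0) + k12 * (M12 - 10395 / P ^ 6 * m0)) + S * (m0 - g0)))%C.
  2: { unfold S, saddle_series. fold k4 k6 k8 k10 k12. ring. }
  apply Cmod_plus_le; [exact HJ|].
  eapply Rle_trans.
  - apply Cmod_plus_le.
    + do 4 (apply Cmod_plus_le; [|apply Cmod_mult_le; eassumption]). apply Cmod_mult_le; eassumption.
    + apply Cmod_mult_le; [exact HS|exact Hv].
  - assert (Hnb : 0 <= N ^ 4 * b) by (apply Rmult_le_pos; lra).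
    assert (12000 * N ^ 4 * (6 * Cmod g0 * b) <= 72000 * (N ^ 4 * b)).
    { replace (12000 * N ^ 4 * (6 * Cmod g0 * b)) with (72000 * (N ^ 4 * b) * Cmod g0) by ring.
      pose proof (Cmod_ge_0 g0). nra. }
    replace (105000 * N ^ 4 * b) with (105000 * (N ^ 4 * b)) by ring.
    replace (N ^ 4 * (8 * b) + N ^ 4 * (42 * b) + N ^ 4 * (296 * b) + N ^ 4 * (2666 * b) + N ^ 4 * (29328 * b))
      with (32340 * (N ^ 4 * b)) by ring. lra.
Qed.

(** * The saddle point *)

(** The real and imaginary parts of [t e^t = i N / (2 PI)], with the quadrant in
    which the principal branch lies. *)
Record is_saddle (N : R) (t : C) : Prop := {
  saddle_u : 0 < Re t;
  saddle_v : 0 < Im t < PI / 2;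
  saddle_re : Re t * cos (Im t) = Im t * sin (Im t);
  saddle_im : 2 * PI * exp (Re t) * (Re t * sin (Im t) + Im t * cos (Im t)) = N }.

(** The equation forces [u cos v = v sin v], and the imaginary part is positive.
    The range of the principal branch excludes the solutions with [u < 0], where
    [- v cot v] would be positive.  For [u > 0] the signs of [v] and of the
    imaginary part agree. *)
Lemma lambertW0_saddle (N : R) (t : C) : 0 < N ->
  is_lambertW0 (RtoC N * Ci / RtoC (2 * PI))%C t -> is_saddle N t.
Proof.
  intros HN [He (Hrng & H0 & Hp & Hm)].
  pose proof PI_RGT_0 as HPI. set (u := Re t) in *. set (v := Im t) in *.
  pose proof (exp_pos u) as Heu.
  set (rhs := (RtoC N * Ci / RtoC (2 * PI))%C) in *.
  assert (E1 : u * (exp u * cos v) - v * (exp u * sin v) = fst rhs) by exact (f_equal Re He).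
  assert (E2 : u * (exp u * sin v) + v * (exp u * cos v) = snd rhs) by exact (f_equal Im He).
  assert (Er : fst rhs = 0).
  { unfold rhs, Cdiv. rewrite <- RtoC_inv by lra. simpl. ring. }
  assert (Ei : snd rhs = N / (2 * PI)).
  { unfold rhs, Cdiv. rewrite <- RtoC_inv by lra. simpl. field. lra. }
  rewrite Er in E1. rewrite Ei in E2.
  assert (F1 : u * cos v = v * sin v) by (apply Rmult_eq_reg_l with (exp u); lra).
  assert (F2 : 2 * PI * exp u * (u * sin v + v * cos v) = N).
  { replace N with (2 * PI * (N / (2 * PI))) at 1 by (field; lra). rewrite <- E2. ring. }
  assert (F3 : 0 < u * sin v + v * cos v).
  { apply Rmult_lt_reg_l with (2 * PI * exp u); [|lra]. apply Rmult_lt_0_compat; lra. }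
  destruct (Rtotal_order v 0) as [Hv|[Hv|Hv]].
  - exfalso. specialize (Hm Hv).
    assert (Hs : sin v < 0) by (rewrite <- (Ropp_involutive v), sin_neg; pose proof (sin_gt_0 (- v)); lra).
    assert (Huc : 0 < u * cos v) by (rewrite F1; nra).
    destruct (Rlt_le_dec 0 u) as [hu|hu].
    + assert (0 < cos v) by nra. nra.
    + assert (Hcv : cos v < 0) by nra.
      assert (0 < cos v / sin v).
      { unfold Rdiv. replace (cos v * / sin v) with ((- cos v) * / (- sin v)) by (field; lra).
        apply Rmult_lt_0_compat; [lra|apply Rinv_0_lt_compat; lra]. }
      assert (0 < - v * (cos v / sin v)) by nra. lra.
  - exfalso. rewrite Hv, sin_0, cos_0 in F1, F3. lra.
  - specialize (Hp Hv).
    assert (Hs : 0 < sin v) by (apply sin_gt_0; lra).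
    assert (Huc : 0 < u * cos v) by (rewrite F1; nra).
    assert (Hu : 0 < u).
    { destruct (Rlt_le_dec 0 u) as [hu|hu]; [exact hu|exfalso].
      assert (Hcv : cos v < 0) by nra.
      assert (0 < - v * (cos v / sin v)).
      { unfold Rdiv. replace (- v * (cos v * / sin v)) with (v * (- cos v) * / sin v) by (field; lra).
        apply Rmult_lt_0_compat; [nra|apply Rinv_0_lt_compat; lra]. } lra. }
    assert (Hc : 0 < cos v) by nra.
    constructor; fold u v; try assumption. split; [exact Hv|].
    destruct (Rlt_le_dec v (PI / 2)) as [h|h]; [exact h|exfalso].
    assert (cos v <= 0) by (apply cos_le_0; lra). lra.
Qed.

Section Saddle.

Context (N : R) (t : C).
Hypothesis HN : 0 < N.
Hypothesis Hsaddle : is_saddle N t.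
Let u := Re t.
Let v := Im t.
Let D := u ^ 2 + v ^ 2.

Lemma saddle_Re_pos : 0 < u. Proof. apply (saddle_u N t Hsaddle). Qed.
Lemma saddle_Im_bounds : 0 < v < 2.
Proof. destruct (saddle_v N t Hsaddle) as [h1 h2]. pose proof PI_4. fold v in h1, h2. lra. Qed.
Lemma saddle_norm_pos : 0 < D. Proof. pose proof saddle_Re_pos. unfold D. nra. Qed.

Lemma saddle_neq_0 : t <> RtoC 0.
Proof. intro h. pose proof saddle_Re_pos as H. unfold u in H. rewrite h in H. simpl in H. lra. Qed.

Lemma saddle_plus_1_neq_0 : (1 + t)%C <> RtoC 0.
Proof. intro h. pose proof saddle_Re_pos as H. apply (f_equal Re) in h. rewrite re_plus in h. fold u in h. simpl in h. lra. Qed.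

Lemma Cmod_saddle_sqr : Cmod t ^ 2 = D.
Proof. rewrite Cmod_sqr. reflexivity. Qed.

(** The real part of the saddle point equation: the derivative of the modulus along
    the horizontal line vanishes. *)
Lemma saddle_exponent : N * u / D = 2 * PI * exp u * sin v.
Proof.
  pose proof saddle_norm_pos. rewrite <- (saddle_im N t Hsaddle). fold u v.
  assert (E := saddle_re N t Hsaddle). fold u v in E.
  apply Rmult_eq_reg_r with D; [|lra]. unfold Rdiv. rewrite Rmult_assoc, Rinv_l, Rmult_1_r by lra.
  replace (2 * PI * exp u * (u * sin v + v * cos v) * u) with (2 * PI * exp u * (u ^ 2 * sin v + v * (u * cos v))) by ring.
  rewrite E. unfold D. ring.
Qed.

Lemma saddle_modulus : N = 2 * PI * exp u * Cmod t.
Proof.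
  rewrite <- (saddle_im N t Hsaddle). fold u v. f_equal.
  assert (E := saddle_re N t Hsaddle). fold u v in E.
  assert (Hpos : 0 < u * sin v + v * cos v).
  { assert (Hi := saddle_im N t Hsaddle). fold u v in Hi. pose proof PI_RGT_0. pose proof (exp_pos u).
    apply Rmult_lt_reg_l with (2 * PI * exp u); [|lra]. apply Rmult_lt_0_compat; lra. }
  rewrite <- (Rabs_right (u * sin v + v * cos v)) by lra.
  rewrite <- (Rabs_right (Cmod t)) by (apply Rle_ge, Cmod_ge_0).
  apply Rsqr_eq_abs_0. unfold Rsqr. replace (Cmod t * Cmod t) with (Cmod t ^ 2) by ring. rewrite Cmod_saddle_sqr.
  pose proof (sin2_cos2 v) as Hsc. unfold Rsqr in Hsc. unfold D.
  replace ((u * sin v + v * cos v) * (u * sin v + v * cos v))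
    with ((u ^ 2 + v ^ 2) * (sin v * sin v + cos v * cos v) - (u * cos v - v * sin v) ^ 2) by ring.
  rewrite Hsc, E. ring.
Qed.

(** Since [2 PI i e^t = - N / t], the double exponential at the saddle point is
    an ordinary exponential. *)
Lemma saddle_Cexp : (Ci * RtoC (2 * PI) * Cexp t)%C = (- (RtoC N / t))%C.
Proof.
  pose proof saddle_norm_pos as HD. pose proof saddle_Re_pos as Hu.
  assert (E := saddle_re N t Hsaddle). assert (Hi := saddle_im N t Hsaddle). fold u v in E, Hi.
  assert (Hc : (t * (Ci * RtoC (2 * PI) * Cexp t))%C = (- RtoC N)%C).
  { unfold Cexp. fold u v. rewrite <- Hi. apply Ceq.
    - simpl. fold (Re t) (Im t). fold u v.
      transitivity (- (2 * PI * exp u * (u * sin v + v * cos v))); ring.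
    - simpl. fold (Re t) (Im t). fold u v.
      transitivity (2 * PI * exp u * (u * cos v - v * sin v)); [ring|]. rewrite E. ring. }
  replace (Ci * RtoC (2 * PI) * Cexp t)%C with (/ t * (t * (Ci * RtoC (2 * PI) * Cexp t)))%C by (field; apply saddle_neq_0).
  rewrite Hc. field. apply saddle_neq_0.
Qed.

(** * Polar forms *)

Lemma polar_form (x y : R) : 0 < x ->
  ((x, y) : C) = Cexp (1 / 2 * ln (x ^ 2 + y ^ 2), atan (y / x)).
Proof.
  intro Hx. assert (Hxy : 0 < x ^ 2 + y ^ 2) by nra.
  unfold Cexp. cbn [Re Im fst snd].
  replace (exp (1 / 2 * ln (x ^ 2 + y ^ 2))) with (sqrt (x ^ 2 + y ^ 2)).
  2: { rewrite <- Rpower_sqrt by exact Hxy. unfold Rpower. f_equal. field. }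
  assert (Hs : sqrt (x ^ 2 + y ^ 2) = x * sqrt (1 + Rsqr (y / x))).
  { replace (x ^ 2 + y ^ 2) with (x ^ 2 * (1 + Rsqr (y / x))) by (unfold Rsqr; field; lra).
    rewrite sqrt_mult_alt by nra. rewrite <- Rsqr_pow2, sqrt_Rsqr; lra. }
  assert (Hp : 0 < sqrt (1 + Rsqr (y / x))) by (apply sqrt_lt_R0; pose proof (Rle_0_sqr (y / x)); lra).
  rewrite cos_atan, sin_atan, Hs. f_equal; field; lra.
Qed.

Lemma Csqrt_sqr (z : C) : 0 <= Im z -> (Csqrt z * Csqrt z)%C = z.
Proof.
  intro Hz. unfold Csqrt. destruct (Rle_dec 0 (Im z)) as [_|h]; [|contradiction].
  assert (Hr := re_le_Cmod z). apply Rabs_le_between in Hr.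
  assert (H2 := Cmod_sqr z).
  apply Ceq; simpl; fold (Re z) (Im z).
  - rewrite !Rmult_1_l, !sqrt_sqrt by lra. field.
  - rewrite !Rmult_1_l, (Rmult_comm (sqrt ((Cmod z - Re z) / 2))), <- sqrt_mult_alt by lra.
    replace ((Cmod z + Re z) / 2 * ((Cmod z - Re z) / 2)) with (Rsqr (Im z / 2)).
    + rewrite sqrt_Rsqr by lra. field.
    + unfold Rsqr. replace ((Cmod z + Re z) / 2 * ((Cmod z - Re z) / 2)) with ((Cmod z ^ 2 - Re z ^ 2) / 4) by field.
      rewrite H2. field.
Qed.

Lemma Csqrt_Re_pos (z : C) : 0 < Re z -> 0 < Re (Csqrt z).
Proof.
  intro H. simpl. apply sqrt_lt_R0. pose proof (Cmod_ge_0 z). lra.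
Qed.

Lemma square_root_unique (z w : C) : 0 < Re z -> 0 < Re w -> (z * z)%C = (w * w)%C -> z = w.
Proof.
  intros Hz Hw H.
  assert (Hne : (z + w)%C <> RtoC 0).
  { intro h. apply (f_equal Re) in h. rewrite re_plus in h. simpl in h. unfold Re in *. lra. }
  replace z with (w + / (z + w) * (z * z - w * w))%C by (field; exact Hne). rewrite H. field. exact Hne.
Qed.

Lemma Csqrt_polar : Csqrt (1 + t)%C
  = Cexp (1 / 4 * ln ((1 + u) ^ 2 + v ^ 2), 1 / 2 * atan (v / (1 + u))).
Proof.
  pose proof saddle_Re_pos as Hu. pose proof saddle_Im_bounds as Hv.
  apply square_root_unique.
  - apply Csqrt_Re_pos. rewrite re_plus. fold u. simpl. lra.
  - unfold Cexp. cbn [Re Im fst snd]. apply Rmult_lt_0_compat; [apply exp_pos|].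
    assert (Hb := atan_bound (v / (1 + u))). apply cos_gt_0; lra.
  - rewrite Csqrt_sqr, <- Cexp_plus.
    + replace (1 + t)%C with ((1 + u, v) : C) by (apply Ceq; simpl; unfold u, v, Re, Im; ring).
      rewrite polar_form by lra. f_equal. apply Ceq; simpl; field.
    + rewrite im_plus. fold v. simpl. lra.
Qed.

(** Taking arguments in [t e^t = i N / (2 PI)]: those of [t] and [e^t] add up to [PI / 2]. *)
Lemma saddle_arg : atan (v / u) = PI / 2 - v.
Proof.
  pose proof saddle_Re_pos as Hu. pose proof saddle_Im_bounds as Hv0. destruct (saddle_v N t Hsaddle) as [Hv1 Hv2].
  fold v in Hv1, Hv2. assert (E := saddle_re N t Hsaddle). fold u v in E.
  rewrite <- (atan_tan (PI / 2 - v)) by lra. f_equal. unfold tan. rewrite sin_shift, cos_shift.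
  assert (Hs : 0 < sin v) by (apply sin_gt_0; lra).
  apply Rmult_eq_reg_r with (u * sin v); [|apply Rgt_not_eq; nra].
  replace (v / u * (u * sin v)) with (v * sin v) by (field; lra).
  replace (cos v / sin v * (u * sin v)) with (u * cos v) by (field; lra). lra.
Qed.

(** The square root of [PI / q] with positive real part, for [q] the Gaussian
    parameter at the saddle point. *)
Definition saddle_gauss : C := (RtoC (sqrt (2 * PI) / sqrt N) * (t / Csqrt (1 + t)))%C.

Lemma Csqrt_neq_0 : Csqrt (1 + t)%C <> RtoC 0.
Proof. rewrite Csqrt_polar. apply Cexp_neq_0. Qed.

Lemma Cmod_saddle_gauss : Cmod saddle_gauss = coefB t / (2 * sqrt N).
Proof.
  assert (Hs : 0 < sqrt N) by (now apply sqrt_lt_R0).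
  unfold saddle_gauss, coefB. rewrite Cmod_mult, Cmod_R, Rabs_right.
  - field. lra.
  - apply Rle_ge. apply Rmult_le_pos; [apply sqrt_pos|]. apply Rlt_le, Rinv_0_lt_compat, Hs.
Qed.

Lemma saddle_gauss_polar :
  saddle_gauss = (RtoC (Cmod saddle_gauss) * Cexp (0, coefb t))%C.
Proof.
  assert (Hs : 0 < sqrt N) by (now apply sqrt_lt_R0).
  pose proof saddle_Re_pos as Hu.
  assert (Ht : t = Cexp (1 / 2 * ln D, PI / 2 - v)).
  { rewrite <- saddle_arg. unfold D. rewrite <- polar_form by exact Hu. apply Ceq; reflexivity. }
  assert (Hq : (t / Csqrt (1 + t))%C
     = Cexp (1 / 2 * ln D - 1 / 4 * ln ((1 + u) ^ 2 + v ^ 2), coefb t)).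
  { rewrite Csqrt_polar.
    rewrite Ht at 1.
    set (z := ((1 / 4 * ln ((1 + u) ^ 2 + v ^ 2), 1 / 2 * atan (v / (1 + u))) : C)).
    set (y := ((1 / 2 * ln D, PI / 2 - v) : C)).
    replace (1 / 2 * ln D - 1 / 4 * ln ((1 + u) ^ 2 + v ^ 2), coefb t) with (y + - z)%C.
    - rewrite Cexp_plus. assert (Ho := Cexp_opp_l z). assert (Hz := Cexp_neq_0 z).
      replace (Cexp (- z)) with (Cexp (- z) * Cexp z * / Cexp z)%C by (field; exact Hz). rewrite Ho. field. exact Hz.
    - apply Ceq; simpl; [ring|]. unfold coefb. fold u v. field. }
  assert (Hm : Cmod (t / Csqrt (1 + t))%C = exp (1 / 2 * ln D - 1 / 4 * ln ((1 + u) ^ 2 + v ^ 2))).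
  { rewrite Hq, Cmod_Cexp. reflexivity. }
  assert (Hc : 0 <= sqrt (2 * PI) / sqrt N).
  { apply Rmult_le_pos; [apply sqrt_pos|]. apply Rlt_le, Rinv_0_lt_compat, Hs. }
  unfold saddle_gauss. rewrite Cmod_mult, Cmod_R, Rabs_right, RtoC_mult by lra.
  rewrite <- Cmult_assoc. f_equal. rewrite Hm, Hq. unfold Cexp. apply Ceq; cbn [Re Im RtoC Cmult fst snd]; rewrite exp_0; ring.
Qed.

End Saddle.

Lemma harmonic_saddle_polar (n : nat) (t : C) : is_saddle (INR n) t ->
  harmonic n (2 * PI) t = Cexp (INR n * coefA t, INR n * coefa t).
Proof.
  intro Hs. assert (Hu := saddle_Re_pos _ _ Hs). unfold harmonic. rewrite (saddle_Cexp _ _ Hs).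
  assert (HD := saddle_norm_pos _ _ Hs).
  assert (Hne := saddle_neq_0 _ _ Hs).
  assert (Ht : t = Cexp (1 / 2 * ln (Re t ^ 2 + Im t ^ 2), atan (Im t / Re t))).
  { rewrite <- polar_form by exact Hu. apply Ceq; reflexivity. }
  rewrite Ht at 1. rewrite <- Cexp_nat_mult, <- Cexp_plus. f_equal.
  assert (Hinv : (RtoC (INR n) / t)%C = (INR n * Re t / (Re t ^ 2 + Im t ^ 2), - (INR n * Im t / (Re t ^ 2 + Im t ^ 2))) :> C).
  { unfold Cdiv, Cinv. apply Ceq; simpl; unfold Re, Im in *; field; simpl in *; lra. }
  rewrite Hinv. apply Ceq; cbn [Re Im fst snd Cplus Cmult Copp Cminus RtoC]; unfold coefA, coefa, Re, Im in *; field; try split; lra.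
Qed.

Lemma harmonic_saddle_ratio (n : nat) (t : C) (s : R) : is_saddle (INR n) t ->
  harmonic n (2 * PI) (Re t + s, Im t) = (harmonic n (2 * PI) t * saddle_ratio n (/ t) s)%C.
Proof.
  intro Hs. assert (Hne := saddle_neq_0 _ _ Hs).
  assert (E := saddle_Cexp _ _ Hs).
  assert (Et : ((Re t + s, Im t) : C) = (t + RtoC s)%C) by (apply Ceq; simpl; unfold Re, Im; ring).
  rewrite Et. unfold harmonic, saddle_ratio.
  replace (t + RtoC s)%C with (t * (1 + / t * RtoC s))%C at 1 by (field; exact Hne).
  rewrite Cpow_mult_l.
  replace (Ci * RtoC (2 * PI) * Cexp (t + RtoC s))%C
    with (Ci * RtoC (2 * PI) * Cexp t + RtoC (INR n) * (- / t * (RtoC (exp s) - 1)))%C.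
  - rewrite Cexp_plus. ring.
  - rewrite Cexp_plus, Cexp_real.
    replace (Ci * RtoC (2 * PI) * (Cexp t * RtoC (exp s)))%C with (Ci * RtoC (2 * PI) * Cexp t * RtoC (exp s))%C by ring.
    rewrite E. field. exact Hne.
Qed.

Lemma saddle_window_Re (n : nat) (t : C) (w : R) : is_saddle (INR n) t -> 0 <= w ->
  RInt (fun x => Re (harmonic n (2 * PI) (x, Im t))) (Re t - w) (Re t + w)
    = Re (harmonic n (2 * PI) t * CInt (saddle_ratio n (/ t)) (- w) w)%C.
Proof.
  intros Hs Hw.
  rewrite <- CInt_scal; [|lra|intros; apply Ccont_saddle_ratio].
  assert (H := RInt_comp_lin (V:=R_CompleteNormedModule) (fun x => Re (harmonic n (2 * PI) (x, Im t))) 1 (Re t) (- w) w).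
  replace (1 * - w + Re t) with (Re t - w) in H by ring. replace (1 * w + Re t) with (Re t + w) in H by ring.
  rewrite <- H.
  - unfold CInt. cbn [Re fst]. apply RInt_ext. intros s _.
    rewrite <- (harmonic_saddle_ratio n t s Hs). unfold scal; simpl; unfold mult; simpl.
    replace (1 * s + Re t) with (Re t + s) by ring. ring.
  - apply ex_RInt_cont; [lra|]. intros; apply continuous_Re_horizontal.
Qed.

(** * Size of the error terms *)

(** Since [n >= e^u], this makes [sqrt n] larger than any prescribed power of
    [u]. *)
Lemma large_saddle (c : R) (m : nat) :
  exists U : R, 20 <= U /\ forall u, U <= u -> (c * u ^ m) ^ 2 <= exp u.
Proof.
  set (k := (2 * m)%nat).
  assert (HF := fun u => pow_le_fact_exp u (S k)). assert (Hf := INR_fact_lt_0 (S k)).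
  set (f := INR (fact (S k))) in *. clearbody f.
  assert (Hc := pow2_ge_0 c). assert (Hfc : 0 <= f * c ^ 2) by (apply Rmult_le_pos; lra).
  exists (20 + f * c ^ 2). split; [lra|]. intros u Hu.
  assert (H := HF u ltac:(lra)).
  assert (Hk : 0 <= u ^ k) by (apply pow_le; lra).
  apply Rmult_le_reg_l with f; [exact Hf|].
  replace (f * (c * u ^ m) ^ 2) with (u ^ k * (f * c ^ 2)).
  - eapply Rle_trans; [|exact H]. change (u ^ S k) with (u * u ^ k). rewrite (Rmult_comm u).
    apply Rmult_le_compat_l; [exact Hk|lra].
  - unfold k. rewrite Rpow_mult_distr, (Nat.mul_comm 2 m), pow_mult. ring.
Qed.

Section Estimates.

Context (n : nat) (t : C).
Let N := INR n.
Let u := Re t.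
Let v := Im t.
Let D := u ^ 2 + v ^ 2.
Hypothesis Hn : (1 <= n)%nat.
Hypothesis Hs : is_saddle (INR n) t.
Hypothesis Hu : 20 <= u.
Hypothesis Hlarge : (160000 * u ^ 49) ^ 2 <= exp u.
Let q := saddle_q n (/ t).
Let w := u ^ 3 / sqrt N.
(* a common bound for the relative size of all terms below every power of [1 / N] *)
Let tiny := exp (- (u ^ 4 / 12)).

Local Lemma N_ge_1 : 1 <= N. Proof. apply (le_INR 1); exact Hn. Qed.
Local Lemma N_gt_0 : 0 < INR n. Proof. pose proof N_ge_1. fold N. lra. Qed.
Local Lemma v_range : 0 < v < 2. Proof. apply (saddle_Im_bounds _ _ Hs). Qed.
Local Lemma D_range : u ^ 2 <= D <= 2 * u ^ 2.
Proof. pose proof v_range. unfold D. nra. Qed.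
Local Lemma D_gt_0 : 0 < D. Proof. pose proof D_range. nra. Qed.

Local Lemma Cmod_t_range : u <= Cmod t <= u + 2.
Proof.
  pose proof v_range. split.
  - eapply Rle_trans; [apply Rle_abs|apply (re_le_Cmod t)].
  - eapply Rle_trans; [apply Cmod_le_Re_Im|]. fold u v. rewrite !Rabs_right; lra.
Qed.

Local Lemma N_lower : exp u <= N.
Proof.
  unfold N. rewrite (saddle_modulus _ _ N_gt_0 Hs). fold u. pose proof Cmod_t_range. pose proof PI_gt_3. pose proof (exp_pos u).
  assert (1 <= 2 * PI * Cmod t) by nra. nra.
Qed.

Local Lemma N_upper : N <= exp (3 * u).
Proof.
  unfold N. rewrite (saddle_modulus _ _ N_gt_0 Hs). fold u. pose proof Cmod_t_range. pose proof PI_4. pose proof PI_RGT_0. pose proof (exp_pos u).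
  replace (3 * u) with (u + 2 * u) by ring. rewrite exp_plus.
  assert (Hquad := exp_quadratic_lower (2 * u) ltac:(lra)).
  assert (2 * PI * Cmod t <= 8 * (u + 2)) by nra.
  assert (8 * (u + 2) <= exp (2 * u)) by nra. nra.
Qed.

Local Lemma sqrtN_sqr : sqrt N * sqrt N = N.
Proof. apply sqrt_sqrt. pose proof N_ge_1. lra. Qed.

Local Lemma sqrtN_lower : 160000 * u ^ 49 <= sqrt N.
Proof.
  assert (H : 0 <= 160000 * u ^ 49) by (apply Rmult_le_pos; [lra|apply pow_le; lra]).
  rewrite <- (sqrt_Rsqr (160000 * u ^ 49)) by exact H. apply sqrt_le_1_alt.
  rewrite Rsqr_pow2. pose proof N_lower. lra.
Qed.

Local Lemma u_pow (a b : nat) : (a <= b)%nat -> 0 < u ^ a <= u ^ b.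
Proof. intro H. split; [apply pow_lt; lra|apply Rle_pow; [lra|exact H]]. Qed.

Local Lemma sqrtN_pos : 0 < sqrt N.
Proof. pose proof sqrtN_lower. destruct (u_pow 49 49 (le_n _)). lra. Qed.

Local Lemma w_sqr : N * w ^ 2 = u ^ 6.
Proof.
  pose proof sqrtN_pos. unfold w. rewrite <- sqrtN_sqr at 1. field. lra.
Qed.

Local Lemma w_small : 0 < w /\ 10000 * (u ^ 6 * w) <= 1.
Proof.
  pose proof sqrtN_pos as Hp. pose proof sqrtN_lower as Hl. destruct (u_pow 9 49 ltac:(lia)) as [H9 H49].
  split.
  - unfold w. apply Rdiv_lt_0_compat; [apply pow_lt; lra|exact Hp].
  - unfold w. apply Rmult_le_reg_r with (sqrt N); [exact Hp|].
    replace (10000 * (u ^ 6 * (u ^ 3 / sqrt N)) * sqrt N) with (10000 * u ^ 9) by (field; lra). lra.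
Qed.

Local Lemma w_le_1 : w <= 1.
Proof.
  destruct w_small as [H0 H1]. destruct (u_pow 0 6 ltac:(lia)) as [_ H6]. simpl (u ^ 0) in H6. nra.
Qed.

Local Lemma inv_parts : (/ t)%C = (u / D, - (v / D)) :> C.
Proof.
  pose proof D_gt_0 as HD. unfold Cinv. fold (Re t) (Im t). fold u v. 
  apply Ceq; simpl; unfold D; field; unfold D in HD; lra.
Qed.

Local Lemma q_parts : Re q = N / 2 * (u / D + (u ^ 2 - v ^ 2) / D ^ 2) /\ Im q = - (N / 2 * (v / D + 2 * u * v / D ^ 2)).
Proof.
  pose proof D_gt_0 as HD.
  assert (E : q = (RtoC (N / 2) * ((/ t) ^ 2 + / t))%C).
  { unfold q, saddle_q, ph2. fold N. rewrite RtoC_div by lra. field. apply (saddle_neq_0 _ _ Hs). }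
  rewrite E, inv_parts. clearbody N u v D. simpl. split; field; lra.
Qed.

Local Lemma q_Re_lower : N / (4 * u) <= Re q.
Proof.
  destruct q_parts as [-> _]. pose proof D_range as HD. pose proof D_gt_0 as HD0. pose proof v_range. pose proof N_ge_1.
  replace (N / (4 * u)) with (N / 2 * (1 / (2 * u))) by (field; lra).
  apply Rmult_le_compat_l; [lra|].
  assert (1 / (2 * u) <= u / D).
  { apply Rmult_le_reg_r with (2 * u * D); [nra|].
    replace (1 / (2 * u) * (2 * u * D)) with D by (field; lra).
    replace (u / D * (2 * u * D)) with (2 * u ^ 2) by (field; lra). lra. }
  assert (0 <= (u ^ 2 - v ^ 2) / D ^ 2).
  { apply Rmult_le_pos; [nra|]. apply Rlt_le, Rinv_0_lt_compat. apply pow_lt; lra. }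
  lra.
Qed.

Local Lemma q_phase : Rabs (Im q) <= Re q.
Proof.
  destruct q_parts as [-> ->]. pose proof D_gt_0 as HD0. pose proof v_range. pose proof N_ge_1.
  assert (H1 : 0 <= v / D + 2 * u * v / D ^ 2).
  { assert (0 <= / D) by (apply Rlt_le, Rinv_0_lt_compat; lra).
    assert (0 <= / D ^ 2) by (apply Rlt_le, Rinv_0_lt_compat, pow_lt; lra).
    unfold Rdiv. assert (0 <= v * / D) by (apply Rmult_le_pos; lra).
    assert (0 <= 2 * u * v * / D ^ 2) by (apply Rmult_le_pos; [nra|lra]). lra. }
  rewrite Rabs_Ropp, Rabs_right by (apply Rle_ge, Rmult_le_pos; lra).
  apply Rmult_le_compat_l; [lra|].
  apply Rmult_le_reg_r with (D ^ 2); [apply pow_lt; lra|].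
  replace ((v / D + 2 * u * v / D ^ 2) * D ^ 2) with (v * D + 2 * u * v) by (field; lra).
  replace ((u / D + (u ^ 2 - v ^ 2) / D ^ 2) * D ^ 2) with (u * D + (u ^ 2 - v ^ 2)) by (field; lra).
  assert (v * D <= u * D) by (apply Rmult_le_compat_r; lra). nra.
Qed.

Local Lemma N_ge_4u : 16 * u <= N.
Proof.
  pose proof sqrtN_sqr. pose proof sqrtN_lower. destruct (u_pow 1 49 ltac:(lia)) as [H1 H2]. rewrite pow_1 in *.
  assert (160000 * u <= sqrt N) by lra. nra.
Qed.

Local Lemma q_Re_ge : 4 <= Re q.
Proof.
  eapply Rle_trans; [|apply q_Re_lower]. pose proof N_ge_4u.
  apply Rmult_le_reg_r with (4 * u); [lra|]. replace (N / (4 * u) * (4 * u)) with N by (field; lra). lra.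
Qed.

Local Lemma N_ge_quartic : u ^ 4 / 12 <= N.
Proof.
  pose proof N_lower. assert (Hexpu := pow_le_fact_exp u 5 ltac:(lra)).
  replace (INR (fact 5)) with 120 in Hexpu by (simpl; ring).
  assert (H4 : 0 < u ^ 4) by (apply pow_lt; lra). replace (u ^ 5) with (u ^ 4 * u) in Hexpu by ring. nra.
Qed.

Local Lemma gauss_boundary_tiny : exp (- (Re q * w ^ 2)) <= tiny.
Proof.
  apply exp_mono, Ropp_le_contravar. pose proof q_Re_lower as Hq. pose proof w_sqr as Hw.
  apply Rle_trans with (N / (4 * u) * w ^ 2); [|apply Rmult_le_compat_r; [apply pow2_ge_0|exact Hq]].
  replace (N / (4 * u) * w ^ 2) with (N * w ^ 2 / (4 * u)) by (field; lra). rewrite Hw.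
  replace (u ^ 6 / (4 * u)) with (u ^ 4 * (u / 4)) by (field; lra).
  assert (0 < u ^ 4) by (apply pow_lt; lra). nra.
Qed.

Local Lemma window_edge_tiny : let beta := N * w / (6 * (u ^ 2 + v ^ 2)) in
  1 <= beta /\ exp (- (beta * w)) <= tiny.
Proof.
  intro beta. pose proof D_range as HD. pose proof D_gt_0 as HD0. fold D in beta.
  pose proof sqrtN_pos as Hp. destruct w_small as [Hw0 _].
  split.
  - unfold beta. apply Rmult_le_reg_r with (6 * D); [lra|].
    replace (N * w / (6 * D) * (6 * D)) with (N * w) by (field; lra).
    assert (E : N * w = sqrt N * u ^ 3).
    { unfold w. rewrite <- sqrtN_sqr at 1. field. lra. }
    rewrite E. pose proof sqrtN_lower. destruct (u_pow 0 49 ltac:(lia)) as [_ H49]. simpl (u ^ 0) in H49.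
    assert (160000 <= sqrt N) by lra. assert (0 < u ^ 3) by (apply pow_lt; lra).
    assert (160000 * u ^ 3 <= sqrt N * u ^ 3) by (apply Rmult_le_compat_r; lra).
    replace (u ^ 3) with (u ^ 2 * u) in * by ring. nra.
  - apply exp_mono, Ropp_le_contravar. unfold beta.
    replace (N * w / (6 * D) * w) with (N * w ^ 2 / (6 * D)) by (field; lra). rewrite w_sqr.
    apply Rmult_le_reg_r with (12 * D); [lra|].
    replace (u ^ 6 / (6 * D) * (12 * D)) with (2 * u ^ 6) by (field; lra).
    replace (u ^ 4 / 12 * (12 * D)) with (u ^ 4 * D) by field.
    replace (2 * u ^ 6) with (u ^ 4 * (2 * u ^ 2)) by ring.
    apply Rmult_le_compat_l; [apply pow_le; lra|lra].
Qed.

Local Lemma second_harmonic_tiny : exp (- (PI * exp (u - w))) <= tiny.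
Proof.
  apply exp_mono, Ropp_le_contravar. pose proof w_le_1. pose proof exp_le_3. pose proof PI_gt_3.
  assert (Hexpu : exp u <= 3 * exp (u - w)).
  { replace u with (w + (u - w)) at 1 by ring. rewrite exp_plus. apply Rmult_le_compat_r; [apply Rlt_le, exp_pos|].
    apply Rle_trans with (exp 1); [apply exp_mono; lra|assumption]. }
  pose proof (exp_pos (u - w)).
  apply Rle_trans with (exp u); [|nra].
  assert (H5 := pow_le_fact_exp u 5 ltac:(lra)). replace (INR (fact 5)) with 120 in H5 by (simpl; ring).
  assert (H4 : 0 < u ^ 4) by (apply pow_lt; lra). replace (u ^ 5) with (u ^ 4 * u) in H5 by ring. nra.
Qed.

(** The modulus at the saddle point exceeds [(u / e)^n], hence [18^n e^(-n)], which
    leaves room for a factor [e^(-n)]. *)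
Local Lemma first_harmonic_large : 2 ^ n <= Cmod (harmonic n (2 * PI) t) * tiny.
Proof.
  assert (Et : t = ((u, v) : C)) by (destruct t; reflexivity).
  rewrite Et. rewrite Cmod_harmonic. rewrite <- Et.
  pose proof (saddle_exponent _ _ Hs) as Hexp. fold u v N in Hexp. fold D in Hexp. rewrite <- Hexp.
  pose proof Cmod_t_range as Hm. pose proof D_range as HD. pose proof D_gt_0 as HD0. pose proof N_ge_1 as HN1.
  assert (H1 : N * u / D <= N).
  { apply Rmult_le_reg_r with D; [lra|]. replace (N * u / D * D) with (N * u) by (field; lra).
    apply Rmult_le_compat_l; [lra|]. nra. }
  assert (H2 : exp (- (2 * N)) <= exp (- (N * u / D)) * tiny).
  { unfold tiny. rewrite <- exp_plus. apply exp_mono. pose proof N_ge_quartic. lra. }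
  assert (H3 : 18 ^ n <= Cmod t ^ n) by (apply pow_incr; lra).
  assert (H4 : 2 ^ n <= 18 ^ n * exp (- (2 * N))).
  { replace (- (2 * N)) with (INR n * - (1 + 1)) by (unfold N; ring). rewrite exp_INR_mult, <- Rpow_mult_distr.
    apply pow_incr. split; [lra|]. rewrite exp_Ropp, exp_plus.
    pose proof exp_le_3. pose proof (exp_pos 1). 
    apply Rmult_le_reg_r with (exp 1 * exp 1); [nra|]. rewrite Rmult_assoc, Rinv_l by nra. nra. }
  rewrite Rmult_assoc.
  eapply Rle_trans; [exact H4|]. apply Rmult_le_compat; [apply pow_le; lra|apply Rlt_le, exp_pos|exact H3|exact H2].
Qed.

(** The saddle point equation reads [cot v = v / u], so that [v] is close to
    [PI / 2]. *)
Local Lemma sin_v_large : 1 / 2 <= sin v.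
Proof.
  pose proof v_range as Hv. assert (E := saddle_re _ _ Hs). fold u v in E.
  pose proof (SIN_bound v). pose proof (sin2_cos2 v) as Hsc. unfold Rsqr in Hsc.
  assert (Hsp : 0 < sin v) by (apply sin_gt_0; pose proof PI_gt_3; lra).
  assert (Hc0 : 0 <= cos v) by nra.
  assert (20 * cos v <= 2) by nra. nra.
Qed.

Let g0 := saddle_gauss (INR n) t.

Local Lemma g0_sqr : (q * (g0 * g0))%C = RtoC PI.
Proof.
  pose proof v_range as Hv. pose proof sqrtN_pos as Hp. pose proof N_ge_1 as HN1.
  assert (Hne := saddle_neq_0 _ _ Hs). assert (H1 := saddle_plus_1_neq_0 _ _ Hs).
  assert (Hsq : (Csqrt (1 + t) * Csqrt (1 + t))%C = (1 + t)%C).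
  { apply Csqrt_sqr. rewrite im_plus. fold v. simpl. lra. }
  assert (Hc0 : Csqrt (1 + t)%C <> RtoC 0) by (intro h; rewrite h in Hsq; apply H1; rewrite <- Hsq; ring).
  set (r := Csqrt (1 + t)%C) in *.
  assert (E : q = (RtoC (N / 2) * ((/ t) ^ 2 + / t))%C).
  { unfold q, saddle_q, ph2. fold N. rewrite RtoC_div by lra. field. exact Hne. }
  unfold g0, saddle_gauss. fold r. fold N. rewrite E.
  replace (RtoC (N / 2) * ((/ t) ^ 2 + / t) * (RtoC (sqrt (2 * PI) / sqrt N) * (t / r) * (RtoC (sqrt (2 * PI) / sqrt N) * (t / r))))%C
    with (RtoC (N / 2) * (RtoC (sqrt (2 * PI) / sqrt N) * RtoC (sqrt (2 * PI) / sqrt N)) * ((1 + t) / (r * r)))%C.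
  2: { field. split; assumption. }
  rewrite Hsq, <- !RtoC_mult.
  replace (N / 2 * (sqrt (2 * PI) / sqrt N * (sqrt (2 * PI) / sqrt N))) with PI.
  - field. exact H1.
  - replace (sqrt (2 * PI) / sqrt N * (sqrt (2 * PI) / sqrt N)) with (sqrt (2 * PI) * sqrt (2 * PI) / (sqrt N * sqrt N)) by (field; lra).
    rewrite sqrtN_sqr, sqrt_sqrt by (pose proof PI_RGT_0; lra). field. lra.
Qed.

(** The phase [coefb] is the difference of two angles that are both small because
    [v / u] is. *)
Local Lemma g0_Re : Cmod g0 / 2 <= Re g0.
Proof.
  pose proof v_range as Hv. pose proof N_ge_1 as HN1.
  assert (HN0 : 0 < INR n) by (fold N; lra).
  unfold g0. rewrite (saddle_gauss_polar _ _ HN0 Hs) at 2.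
  set (c := Cmod (saddle_gauss (INR n) t)). assert (Hc : 0 <= c) by apply Cmod_ge_0.
  replace (Re (RtoC c * Cexp (0, coefb t))%C) with (c * cos (coefb t)) by (unfold Cexp; simpl; rewrite exp_0; ring).
  assert (Hb : Rabs (coefb t) <= 1 / 10).
  { unfold coefb. fold u v. assert (Ha := saddle_arg _ _ Hs). fold u v in Ha.
    assert (Hat : forall x, 0 <= x -> 0 <= atan x <= x).
    { intros x Hx. split.
      - rewrite <- atan_0. destruct Hx as [Hx|Hx]; [left; now apply atan_increasing|rewrite Hx; lra].
      - assert (H := nonincr_of_deriv (fun t => atan t - t) (fun t => / (1 + t ^ 2) - 1) 0 x Hx).
        cbv beta in H. rewrite atan_0 in H. cut (atan x - x <= 0 - 0); [lra|]. apply H.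
        + intros y _. auto_derive; [exact I|]. field. apply Rgt_not_eq; nra.
        + intros y _. pose proof (pow2_ge_0 y). assert (/ (1 + y ^ 2) <= / 1) by (apply Rinv_le_contravar; lra). lra. }
    assert (B1 : 0 <= v / u <= 1 / 10).
    { split; [apply Rlt_le, Rdiv_lt_0_compat; lra|]. apply Rmult_le_reg_r with u; [lra|].
      replace (v / u * u) with v by (field; lra). lra. }
    assert (B2 : 0 <= v / (1 + u) <= 1 / 10).
    { split; [apply Rlt_le, Rdiv_lt_0_compat; lra|]. apply Rmult_le_reg_r with (1 + u); [lra|].
      replace (v / (1 + u) * (1 + u)) with v by (field; lra). lra. }
    assert (A1 := Hat _ (proj1 B1)). assert (A2 := Hat _ (proj1 B2)). rewrite Ha in A1. apply Rabs_le. lra. }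
  assert (H := cos_ge_quadratic (coefb t)).
  assert (coefb t ^ 2 <= 1).
  { rewrite <- pow2_abs, <- (pow1 2). apply pow_incr. split; [apply Rabs_pos|lra]. }
  nra.
Qed.

Local Lemma g0_le_1 : Cmod g0 <= 1.
Proof.
  assert (E := f_equal Cmod g0_sqr). rewrite !Cmod_mult, Cmod_R, Rabs_right in E by (pose proof PI_RGT_0; lra).
  pose proof q_Re_ge as Hq. pose proof PI_4.
  assert (Hq4 : 4 <= Cmod q) by (eapply Rle_trans; [exact Hq|eapply Rle_trans; [apply Rle_abs|apply re_le_Cmod]]).
  pose proof (Cmod_ge_0 g0). destruct (Rle_lt_dec (Cmod g0) 1) as [h|h]; [exact h|exfalso]. nra.
Qed.

Let F := harmonic n (2 * PI) t.
Let S := (1 + cd1 t / RtoC N + cd2 t / RtoC N ^ 2)%C.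

Lemma stieltjes_estimate (g : R) : is_lim_seq (stieltjes_sum n) g ->
  Rabs (g - 2 * Re (F * (g0 * S))%C)
    <= Cmod F * (160000 * u ^ 48 / sqrt N ^ 6 + (210000 * N ^ 4 + 4 * u + 21) * tiny).
Proof.
  intro Hg.
  pose proof v_range as Hv. pose proof N_ge_1 as HN1. pose proof D_gt_0 as HD0.
  pose proof sqrtN_pos as Hp. destruct w_small as [Hw0 Hw1]. pose proof w_le_1 as Hw2.
  destruct window_edge_tiny as [Hb1 Hb2].
  assert (Hn2 : (2 <= n)%nat).
  { destruct (Nat.le_gt_cases 2 n) as [h|h]; [exact h|exfalso].
    assert (N <= 1) by (apply (le_INR n 1); lia). pose proof N_ge_4u. lra. }
  assert (Et : ((u, v) : C) = t) by (destruct t; reflexivity).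
  assert (H1 := stieltjes_window n u v w ltac:(lra) (conj (proj1 Hv) (Rlt_le _ _ (proj2 (saddle_v _ _ Hs)))) sin_v_large
    (saddle_exponent _ _ Hs) (conj Hw0 Hw2) Hb1 g Hn2 Hg).
  rewrite Et in H1. fold F in H1.
  assert (EW : RInt (fun x => Re (harmonic n (2 * PI) (x, v))) (u - w) (u + w)
     = Re (F * CInt (saddle_ratio n (/ t)) (- w) w)%C) by (apply (saddle_window_Re n t w Hs); lra).
  rewrite EW in H1.
  assert (Hi : Cmod (/ t)%C <= 1 / 2).
  { rewrite Cmod_inv by apply (saddle_neq_0 _ _ Hs). pose proof Cmod_t_range.
    replace (1 / 2) with (/ 2) by field. apply Rinv_le_contravar; lra. }
  assert (HP : 1 <= Cmod (2 * q)%C).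
  { eapply Rle_trans; [|apply re_le_Cmod]. eapply Rle_trans; [|apply Rle_abs].
    replace (Re (2 * q)%C) with (2 * Re q) by (rewrite re_mult; simpl; ring). pose proof q_Re_ge. lra. }
  assert (HG1 : 1 <= u ^ 6) by (destruct (u_pow 0 6 ltac:(lia)) as [_ h]; exact h).
  assert (H2 := saddle_window_integral n (/ t)%C g0 w (u ^ 6) Hn Hi).
  cbv zeta in H2. fold q in H2. fold N in H2.
  specialize (H2 HP ltac:(pose proof q_Re_ge; lra) q_phase g0_sqr g0_Re g0_le_1 (conj Hw0 Hw2) (Req_le _ _ w_sqr) HG1 Hw1).
  assert (ES : saddle_series (RtoC N) (/ t) (2 * q) = S).
  { unfold S. rewrite <- saddle_series_eq.
    - f_equal. unfold q, saddle_q, ph2. fold N. field. apply (saddle_neq_0 _ _ Hs).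
    - apply RtoC_neq; lra.
    - apply (saddle_neq_0 _ _ Hs).
    - apply (saddle_plus_1_neq_0 _ _ Hs). }
  rewrite ES in H2.
  set (J := CInt (saddle_ratio n (/ t)) (- w) w) in *.
  set (H := Cmod F) in *. assert (HF : 0 <= H) by apply Cmod_ge_0.
  assert (Ht0 : 0 < tiny) by apply exp_pos.
  assert (H3 : Rabs (2 * Re (F * J)%C - 2 * Re (F * (g0 * S))%C)
     <= H * (160000 * u ^ 48 / sqrt N ^ 6 + 210000 * N ^ 4 * tiny)).
  { replace (2 * Re (F * J)%C - 2 * Re (F * (g0 * S))%C) with (2 * Re (F * (J - g0 * S))%C).
    2: { replace (F * (J - g0 * S))%C with (F * J - F * (g0 * S))%C by ring. rewrite re_minus. ring. }
    rewrite Rabs_mult, (Rabs_right 2) by lra.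
    assert (Hre := re_le_Cmod (F * (J - g0 * S))%C). rewrite Cmod_mult in Hre. fold H in Hre.
    apply Rle_trans with (2 * (H * (80000 * u ^ 48 / sqrt N ^ 6 + 105000 * N ^ 4 * tiny))).
    2: { right. field. lra. }
    apply Rmult_le_compat_l; [lra|]. eapply Rle_trans; [exact Hre|]. apply Rmult_le_compat_l; [exact HF|].
    eapply Rle_trans; [exact H2|]. apply Rplus_le_compat.
    - right. unfold w. field. lra.
    - apply Rmult_le_compat_l; [|apply gauss_boundary_tiny].
      apply Rmult_le_pos; [lra|apply pow_le; lra]. }
  assert (H4 : 2 ^ n + H * (4 * (u + 1) * exp (- (N * w / (6 * (u ^ 2 + v ^ 2)) * w)) + 16 * w * exp (- (PI * exp (u - w))))
     <= H * ((4 * u + 21) * tiny)).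
  { pose proof first_harmonic_large as Hfl. fold F in Hfl. fold H in Hfl. pose proof second_harmonic_tiny as Hsh.
    assert (B1 : 4 * (u + 1) * exp (- (N * w / (6 * (u ^ 2 + v ^ 2)) * w)) <= 4 * (u + 1) * tiny).
    { apply Rmult_le_compat_l; [lra|exact Hb2]. }
    assert (B2 : 16 * w * exp (- (PI * exp (u - w))) <= 16 * tiny).
    { apply Rmult_le_compat; [lra|apply Rlt_le, exp_pos|lra|exact Hsh]. }
    assert (B3 : H * (4 * (u + 1) * exp (- (N * w / (6 * (u ^ 2 + v ^ 2)) * w)) + 16 * w * exp (- (PI * exp (u - w))))
       <= H * (4 * (u + 1) * tiny + 16 * tiny)) by (apply Rmult_le_compat_l; lra).
    replace (H * ((4 * u + 21) * tiny)) with (H * tiny + H * (4 * (u + 1) * tiny + 16 * tiny)) by ring. lra. }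
  replace (g - 2 * Re (F * (g0 * S))%C) with ((g - 2 * Re (F * J)%C) + (2 * Re (F * J)%C - 2 * Re (F * (g0 * S))%C)) by ring.
  eapply Rle_trans; [apply Rabs_triang|].
  replace (H * (160000 * u ^ 48 / sqrt N ^ 6 + (210000 * N ^ 4 + 4 * u + 21) * tiny))
    with (H * ((4 * u + 21) * tiny) + H * (160000 * u ^ 48 / sqrt N ^ 6 + 210000 * N ^ 4 * tiny)) by (field; lra).
  apply Rplus_le_compat; [|exact H3]. eapply Rle_trans; [exact H1|exact H4].
Qed.

(** The exponent 5/2 collects the factor [N^2] of the claim and the [sqrt N] by which
    the main term is smaller than the harmonic at the saddle point.  The power of
    [u] in the first term is absorbed by [sqrt N], and [tiny] beats every power of
    [N <= e^(3 u)]. *)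
Lemma error_scale :
  N ^ 2 * (sqrt N * (160000 * u ^ 48 / sqrt N ^ 6 + (210000 * N ^ 4 + 4 * u + 21) * tiny)) <= 3000000 / u.
Proof.
  pose proof sqrtN_pos as Hp. pose proof N_ge_1 as HN1. pose proof sqrtN_lower as Hl.
  set (r := sqrt N) in *. assert (Er : N = r ^ 2) by (unfold r; rewrite <- sqrtN_sqr at 1; ring).
  assert (T1 : N ^ 2 * (r * (160000 * u ^ 48 / r ^ 6)) <= 1 / u).
  { rewrite Er. replace ((r ^ 2) ^ 2 * (r * (160000 * u ^ 48 / r ^ 6))) with (160000 * u ^ 48 / r) by (field; lra).
    apply Rmult_le_reg_r with (r * u); [apply Rmult_lt_0_compat; lra|].
    replace (160000 * u ^ 48 / r * (r * u)) with (160000 * u ^ 49) by (field; lra).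
    replace (1 / u * (r * u)) with r by (field; lra). exact Hl. }
  assert (Hr1 : 1 <= r) by (unfold r; rewrite <- sqrt_1; apply sqrt_le_1_alt; exact HN1).
  assert (HrN : r <= N) by (rewrite Er; nra).
  assert (Ht0 : 0 < tiny) by apply exp_pos.
  assert (T2 : N ^ 2 * (r * ((210000 * N ^ 4 + 4 * u + 21) * tiny)) <= 1000000 * (u * exp (- u))).
  { assert (HN7 : N ^ 7 * tiny <= exp (- u)).
    { apply Rle_trans with (exp (3 * u) ^ 7 * tiny).
      - apply Rmult_le_compat_r; [lra|]. apply pow_incr. pose proof N_upper. lra.
      - rewrite <- exp_INR_mult. unfold tiny. rewrite <- exp_plus. apply exp_mono. simpl INR.
        assert (u ^ 4 >= 8000 * u).
        { replace (u ^ 4) with (u * (u * (u * u))) by ring. assert (400 <= u * u) by nra.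
          assert (8000 <= u * (u * u)) by nra. nra. }
        lra. }
    assert (H4 : 1 <= N ^ 4) by (apply pow_R1_Rle; exact HN1).
    assert (H2 : 0 < N ^ 2) by (apply pow_lt; lra).
    apply Rle_trans with (1000000 * u * (N ^ 7 * tiny)).
    - replace (1000000 * u * (N ^ 7 * tiny)) with (N ^ 2 * (N * (1000000 * u * N ^ 4 * tiny))) by ring.
      apply Rmult_le_compat_l; [lra|]. apply Rmult_le_compat; [lra| |exact HrN|].
      + apply Rmult_le_pos; [|lra]. nra.
      + apply Rmult_le_compat_r; [lra|]. nra.
    - rewrite Rmult_assoc. apply Rmult_le_compat_l; [lra|]. apply Rmult_le_compat_l; lra. }
  assert (T3 : u * exp (- u) <= 2 / u).
  { assert (H := exp_ge_sqr u ltac:(lra)). apply Rmult_le_reg_r with u; [lra|].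
    replace (2 / u * u) with 2 by (field; lra). eapply Rle_trans; [|exact H]. right. ring. }
  assert (0 < / u) by (apply Rinv_0_lt_compat; lra).
  replace (N ^ 2 * (r * (160000 * u ^ 48 / r ^ 6 + (210000 * N ^ 4 + 4 * u + 21) * tiny)))
    with (N ^ 2 * (r * (160000 * u ^ 48 / r ^ 6)) + N ^ 2 * (r * ((210000 * N ^ 4 + 4 * u + 21) * tiny))) by ring.
  unfold Rdiv in *. lra.
Qed.

Lemma coefB_ge_1 : 1 <= coefB t.
Proof.
  pose proof N_ge_1 as HN1. pose proof sqrtN_pos as Hp. pose proof D_range as HD. pose proof D_gt_0 as HD0.
  pose proof v_range as Hv.
  assert (EB : coefB t = 2 * sqrt N * Cmod g0).
  { unfold g0. rewrite (Cmod_saddle_gauss _ t N_gt_0). fold N. field. lra. }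
  assert (E := f_equal Cmod g0_sqr). rewrite !Cmod_mult, Cmod_R, Rabs_right in E by (pose proof PI_RGT_0; lra).
  assert (Hq : Cmod q <= N).
  { eapply Rle_trans; [apply Cmod_le_Re_Im|]. pose proof q_phase. pose proof q_Re_ge. rewrite (Rabs_right (Re q)) by lra.
    assert (Re q <= N / 2); [|lra]. destruct q_parts as [-> _].
    assert (u / D <= 1 / 2).
    { apply Rmult_le_reg_r with D; [lra|]. replace (u / D * D) with u by (field; lra). nra. }
    assert ((u ^ 2 - v ^ 2) / D ^ 2 <= 1 / 2).
    { assert (0 < D ^ 2) by (apply pow_lt; lra).
      apply Rmult_le_reg_r with (D ^ 2); [lra|].
      replace ((u ^ 2 - v ^ 2) / D ^ 2 * D ^ 2) with (u ^ 2 - v ^ 2) by (field; lra). assert (400 <= D) by nra. assert (400 * D <= D ^ 2) by nra. nra. }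
    apply Rle_trans with (N / 2 * 1); [apply Rmult_le_compat_l; lra|lra]. }
  pose proof PI_gt_3. pose proof (Cmod_ge_0 g0). pose proof sqrtN_sqr as Hss.
  set (G := Cmod g0) in *. set (r := sqrt N) in *.
  assert (3 <= N * (G * G)) by (assert (Cmod q * (G * G) <= N * (G * G)) by (apply Rmult_le_compat_r; nra); lra).
  rewrite EB. rewrite <- Hss in *. assert (0 <= r * G) by (apply Rmult_le_pos; lra).
  destruct (Rle_lt_dec 1 (2 * r * G)) as [h|h]; [exact h|exfalso].
  assert (r * G < 1) by lra. replace (r * r * (G * G)) with ((r * G) * (r * G)) in * by ring. nra.
Qed.

End Estimates.

(** * The asymptotic expansion *)

Lemma saddle_main_term (n : nat) (t : C) : (1 <= n)%nat -> is_saddle (INR n) t ->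
  let x := INR n in
  2 * Re (harmonic n (2 * PI) t
          * (saddle_gauss x t * (1 + cd1 t / RtoC x + cd2 t / RtoC x ^ 2)))%C
  = coefB t * exp (x * coefA t) / sqrt x *
      (cos (x * coefa t + coefb t) * (1 + coefc1 t / x + coefc2 t / x ^ 2)
       - sin (x * coefa t + coefb t) * (coefd1 t / x + coefd2 t / x ^ 2)).
Proof.
  intros Hn Hs x.
  assert (Hx : 1 <= x) by (apply (le_INR 1); exact Hn).
  assert (Hp : 0 < sqrt x) by (apply sqrt_lt_R0; lra).
  rewrite (harmonic_saddle_polar n t Hs), (saddle_gauss_polar x t ltac:(lra) Hs).
  fold x. rewrite (Cmod_saddle_gauss x t ltac:(lra)).
  set (A := x * coefA t). set (a := x * coefa t). set (b := coefb t). set (B := coefB t).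
  set (S := (1 + cd1 t / RtoC x + cd2 t / RtoC x ^ 2)%C).
  assert (HSr : Re S = 1 + coefc1 t / x + coefc2 t / x ^ 2).
  { unfold S, coefc1, coefc2. rewrite <- RtoC_pow. unfold Cdiv. rewrite <- !RtoC_inv by (try apply pow_nonzero; lra).
    rewrite !re_plus, !re_mult. cbn [Re Im RtoC fst snd]. unfold Re, Im. field. lra. }
  assert (HSi : Im S = coefd1 t / x + coefd2 t / x ^ 2).
  { unfold S, coefd1, coefd2. rewrite <- RtoC_pow. unfold Cdiv. rewrite <- !RtoC_inv by (try apply pow_nonzero; lra).
    rewrite !im_plus, !im_mult. cbn [Re Im RtoC fst snd]. unfold Re, Im. field. lra. }
  rewrite <- HSr, <- HSi.
  replace (Cexp (A, a) * (RtoC (B / (2 * sqrt x)) * Cexp (0, b) * S))%C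
    with (RtoC (B / (2 * sqrt x)) * (Cexp ((A, a) + (0, b))%C * S))%C by (rewrite Cexp_plus; ring).
  assert (E : Cexp (((A, a) : C) + ((0, b) : C))%C = ((exp A * cos (a + b), exp A * sin (a + b)) : C)).
  { unfold Cexp. apply Ceq; cbn [Re Im fst snd Cplus]; rewrite Rplus_0_r; reflexivity. }
  rewrite E, !re_mult. cbn [Re Im RtoC fst snd]. unfold Re, Im. field. lra.
Qed.

(** This forces the saddle point to infinity: [u >= ln (N / 16) / 2]. *)
Lemma saddle_Re_lower (N : R) (t : C) : 0 < N -> is_saddle N t -> N <= 16 * exp (2 * Re t).
Proof.
  intros HN Hs. assert (Hu := saddle_Re_pos _ _ Hs). assert (Hv := saddle_Im_bounds _ _ Hs).
  rewrite (saddle_modulus _ _ HN Hs). pose proof PI_4. pose proof PI_RGT_0.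
  assert (Hm : Cmod t <= Re t + 2).
  { eapply Rle_trans; [apply Cmod_le_Re_Im|]. rewrite !Rabs_right; lra. }
  replace (2 * Re t) with (Re t + Re t) by ring. rewrite exp_plus.
  pose proof (exp_ineq1_le (Re t)) as He. pose proof (Cmod_ge_0 t).
  set (e := exp (Re t)) in *.
  assert (Cmod t <= 2 * e) by lra.
  assert (2 * PI * e * Cmod t <= 2 * PI * e * (2 * e)) by (apply Rmult_le_compat_l; [|assumption]; nra).
  nra.
Qed.

Theorem theorem2
  (zeta : C -> C) (Hzeta : is_riemann_zeta zeta)
  (gamma : nat -> R) (Hgamma : is_stieltjes zeta gamma)
  (t0 : nat -> C)
  (Ht0 : forall n : nat, (0 < n)%nat ->
     is_lambertW0 (RtoC (INR n) * Ci / RtoC (2 * PI))%C (t0 n)) :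
  exists eps : nat -> R,
    (forall n : nat, (0 < n)%nat ->
       let t := t0 n in
       let x := INR n in
       gamma n =
         coefB t * exp (x * coefA t) / sqrt x *
         (cos (x * coefa t + coefb t) * (1 + coefc1 t / x + coefc2 t / x ^ 2)
          - sin (x * coefa t + coefb t) * (coefd1 t / x + coefd2 t / x ^ 2)
          + eps n)) /\
    is_lim_seq (fun n : nat => INR n ^ 2 * eps n) 0.
Proof.
  assert (Hlim := stieltjes_limit zeta gamma Hzeta Hgamma).
  assert (Hs : forall n, (0 < n)%nat -> is_saddle (INR n) (t0 n)).
  { intros n Hn. apply lambertW0_saddle; [now apply lt_0_INR|now apply Ht0]. }
  set (K := fun n => coefB (t0 n) * exp (INR n * coefA (t0 n)) / sqrt (INR n)).
  set (Main := fun n => cos (INR n * coefa (t0 n) + coefb (t0 n)) * (1 + coefc1 (t0 n) / INR n + coefc2 (t0 n) / INR n ^ 2)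
       - sin (INR n * coefa (t0 n) + coefb (t0 n)) * (coefd1 (t0 n) / INR n + coefd2 (t0 n) / INR n ^ 2)).
  assert (HK : forall n, (0 < n)%nat -> 0 < K n).
  { intros n Hn. assert (Hx : 0 < INR n) by (now apply lt_0_INR). assert (Hp : 0 < sqrt (INR n)) by (now apply sqrt_lt_R0).
    assert (HB : 0 < coefB (t0 n)).
    { unfold coefB. apply Rmult_lt_0_compat.
      - apply Rmult_lt_0_compat; [lra|]. apply sqrt_lt_R0. pose proof PI_RGT_0. lra.
      - apply Cmod_gt_0. unfold Cdiv. apply Cmult_neq_0; [apply (saddle_neq_0 _ _ (Hs n Hn))|].
        intro h. assert (H1 := Csqrt_neq_0 _ _ (Hs n Hn)). apply H1.
        replace (Csqrt (1 + t0 n)) with (Csqrt (1 + t0 n) * (Csqrt (1 + t0 n) * / Csqrt (1 + t0 n)))%C by (field; exact H1).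
        rewrite h. ring. }
    unfold K. apply Rdiv_lt_0_compat; [|exact Hp]. apply Rmult_lt_0_compat; [exact HB|apply exp_pos]. }
  exists (fun n => gamma n / K n - Main n). split.
  - intros n Hn t x. fold (Main n). fold (K n). specialize (HK n Hn).
    change (gamma n = K n * (Main n + (gamma n / K n - Main n))). field. lra.
  - destruct (large_saddle 160000 49) as [U [HU HUlarge]].
    apply is_lim_seq_spec. intros e.
    (* beyond [V] the saddle point is far enough to the right for the error bound to be below [e] *)
    set (V := U + 3000001 / e).
    assert (He : 0 < e) by apply cond_pos.
    assert (Hde : 0 < 3000001 / e) by (apply Rdiv_lt_0_compat; lra).
    destruct (archimed (16 * exp (2 * V))) as [Ha _].
    exists (Z.to_nat (up (16 * exp (2 * V)))). intros n Hn.
    assert (HnR : 16 * exp (2 * V) < INR n).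
    { apply Rlt_le_trans with (IZR (up (16 * exp (2 * V)))); [lra|]. rewrite INR_IZR_INZ. apply IZR_le. lia. }
    assert (Hn0 : (0 < n)%nat).
    { apply INR_lt. simpl. pose proof (exp_pos (2 * V)). lra. }
    specialize (Hs n Hn0). specialize (HK n Hn0).
    assert (Hx0 : 0 < INR n) by (now apply lt_0_INR).
    assert (HV : V < Re (t0 n)).
    { assert (H := saddle_Re_lower _ _ Hx0 Hs).
      assert (H1 : exp (2 * V) < exp (2 * Re (t0 n))) by lra. apply exp_lt_inv in H1. lra. }
    set (t := t0 n) in *. set (u := Re t) in *.
    assert (HuU : U <= u) by (unfold V in HV; lra).
    assert (Hest := stieltjes_estimate n t Hn0 Hs ltac:(fold u; lra) (HUlarge u HuU) (gamma n) (Hlim n)).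
    assert (Hsc := error_scale n t Hn0 Hs ltac:(fold u; lra) (HUlarge u HuU)).
    assert (HB := coefB_ge_1 n t Hn0 Hs ltac:(fold u; lra) (HUlarge u HuU)).
    fold u in Hest, Hsc.
    assert (Hm := saddle_main_term n t Hn0 Hs). cbv zeta in Hm. rewrite Hm in Hest. clear Hm.
    change (Rabs (gamma n - K n * Main n) <= Cmod (harmonic n (2 * PI) t) *
      (160000 * u ^ 48 / sqrt (INR n) ^ 6 + (210000 * INR n ^ 4 + 4 * u + 21) * exp (- (u ^ 4 / 12)))) in Hest.
    set (err := 160000 * u ^ 48 / sqrt (INR n) ^ 6 + (210000 * INR n ^ 4 + 4 * u + 21) * exp (- (u ^ 4 / 12))) in *.
    assert (HF : Cmod (harmonic n (2 * PI) t) = exp (INR n * coefA t)).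
    { rewrite (harmonic_saddle_polar n t Hs), Cmod_Cexp. reflexivity. }
    rewrite HF in Hest.
    assert (Hp : 0 < sqrt (INR n)) by (now apply sqrt_lt_R0).
    assert (HKB : exp (INR n * coefA t) <= K n * sqrt (INR n)).
    { unfold K. fold t. replace (coefB t * exp (INR n * coefA t) / sqrt (INR n) * sqrt (INR n)) with (coefB t * exp (INR n * coefA t)) by (field; lra).
      pose proof (exp_pos (INR n * coefA t)). nra. }
    pose proof (exp_pos (INR n * coefA t)) as HeA.
    assert (Herr : 0 <= err).
    { apply Rmult_le_reg_l with (exp (INR n * coefA t)); [exact HeA|]. rewrite Rmult_0_r.
      eapply Rle_trans; [apply Rabs_pos|exact Hest]. }
    assert (Heps : Rabs (gamma n / K n - Main n) <= sqrt (INR n) * err).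
    { apply Rmult_le_reg_l with (K n); [exact HK|].
      rewrite <- (Rabs_right (K n)) at 1 by lra. rewrite <- Rabs_mult.
      replace (K n * (gamma n / K n - Main n)) with (gamma n - K n * Main n) by (field; lra).
      eapply Rle_trans; [exact Hest|]. rewrite <- Rmult_assoc. apply Rmult_le_compat_r; assumption. }
    rewrite Rminus_0_r, Rabs_mult, (Rabs_right (INR n ^ 2)) by (apply Rle_ge, pow_le; lra).
    apply Rle_lt_trans with (3000000 / u).
    { eapply Rle_trans; [|exact Hsc]. apply Rmult_le_compat_l; [apply pow_le; lra|exact Heps]. }
    assert (Hu0 : 0 < u) by lra.
    apply Rmult_lt_reg_r with u; [exact Hu0|]. replace (3000000 / u * u) with 3000000 by (field; lra).
    assert (3000001 / e <= u) by (unfold V in HV; lra).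
    assert (e * (3000001 / e) <= e * u) by (apply Rmult_le_compat_l; lra).
    replace (e * (3000001 / e)) with 3000001 in * by (field; lra). lra.
Qed.
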